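(* Let $\varphi$ be a bounded positive measurable function on $\mathbb C$, and let $d\mu=\varphi\,dA$. Then the following statements are equivalent: (a) the Toeplitz operator $T_\mu=T_\varphi$ is invertible on the Fock space $\mathcal F^2$; (b) the Berezin transform $\widetilde\mu=\widetilde\varphi$ is bounded below on $\mathbb C$ (there is $\delta>0$ with $\widetilde\mu(z)\geqslant\delta$ for all $z\in\mathbb C$); (c) there exists an $r>0$ such that $\chi_{\{z\in\mathbb C:\,\varphi(z)>r\}}\,dA$ is a reverse Carleson measure for $\mathcal F^2$; (d) $\mu$ is a reverse Carleson measure for $\mathcal F^2$; (e) $\mu$ satisfies the reverse Carleson condition for $\mathcal F^2$.
   Context: $dA=\frac1\pi dx\,dy$ and $d\lambda(z)=\frac12\mathrm e^{-|z|^2/2}dA(z)$ on $\mathbb C$. The Fock space $\mathcal F^2$ is the Hilbert space of entire functions in $L^2(\mathbb C,d\lambda)$. For a positive Borel measure $\mu$ on $\mathbb C$, the Toeplitz operator is $T_\mu f(z)=\frac12\int_{\mathbb C}f(w)\,\mathrm e^{z\overline w/2}\,\mathrm e^{-|w|^2/2}\,d\mu(w)$; for $d\mu=\varphi\,dA$ with $\varphi$ bounded this is the bounded operator $T_\varphi f(z)=\int_{\mathbb C}f(w)\varphi(w)\mathrm e^{z\overline w/2}d\lambda(w)$ on $\mathcal F^2$. The Berezin transform is $\widetilde\mu(z)=\frac12\int_{\mathbb C}\mathrm e^{-|z-w|^2/2}d\mu(w)$, written $\widetilde\varphi$ when $d\mu=\varphi\,dA$. $\chi_G$ is the characteristic function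 of $G$. $\mu$ is a reverse Carleson measure for $\mathcal F^2$ if there is a constant $C>0$ with $\int_{\mathbb C}|f(w)|^2\mathrm e^{-|w|^2/2}d\mu(w)\geqslant C\int_{\mathbb C}|f(w)|^2\mathrm e^{-|w|^2/2}dA(w)$ for all $f\in\mathcal F^2$. $\mu$ satisfies the reverse Carleson condition for $\mathcal F^2$ if there are $r>0$ and $C>0$ such that $C^{-1}\leqslant\mu(B(z,r))\leqslant C$ for all $z\in\mathbb C$, where $B(z,r)=\{w\in\mathbb C:|w-z|<r\}$. *)

(* Defs.v *)
From HB Require Import structures.
From mathcomp Require Import all_boot all_order all_algebra.
From mathcomp Require Import all_classical all_reals all_analysis.
From mathcomp Require Import measurable_realfun complex lra.

Set Implicit Arguments.
Unset Strict Implicit.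
Unset Printing Implicit Defensive.

Import Order.TTheory GRing.Theory Num.Theory.
Import numFieldNormedType.Exports.
Import ComplexField.Normc.

Local Open Scope classical_set_scope.
Local Open Scope ring_scope.
Local Open Scope complex_scope.

(* The cast to numClosedFieldType is what gives R[i] the topology of its norm. *)
Definition Cplx (R : realType) : numClosedFieldType := R[i].

(* C with its Borel sigma-algebra; convertible to Cplx R as a type. *)
Definition CplxB (R : realType) : measurableType _ :=
  g_sigma_algebraType (@open (Cplx R)).

Section area_measure.
Variable R : realType.

Definition cplx_of_pair (p : measurableTypeR R * measurableTypeR R) : CplxB R :=
  p.1 +i* p.2.

Lemma measurable_cplx_of_pair : measurable_fun setT cplx_of_pair.
Proof.
apply: (@measurability _ _ _ (CplxB R) _ _ (@open (Cplx R)) erefl).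
move=> _ [U oU <-]; rewrite setTI.
pose box (a b c d : rat) : set (measurableTypeR R * measurableTypeR R) :=
  `]ratr a, ratr b[%classic `*` `]ratr c, ratr d[%classic.
pose F a b c d := if pselect (box a b c d `<=` cplx_of_pair @^-1` U)
  then box a b c d else set0.
suff -> : cplx_of_pair @^-1` U =
    \bigcup_a \bigcup_b \bigcup_c \bigcup_d F a b c d.
  apply: bigcupT_measurable_rat => a; apply: bigcupT_measurable_rat => b.
  apply: bigcupT_measurable_rat => c; apply: bigcupT_measurable_rat => d.
  rewrite /F.
  case: (pselect _) => [sub|nsub]; last exact: measurable0.
  by apply: measurableX; exact: measurable_itv.
apply/seteqP; split => [[x y] /= Uxy|p [a _ [b _ [c _ [d _]]]]]; last first.
  by rewrite /F; case: pselect => // sub /sub.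
move: oU; rewrite openE => /(_ _ Uxy) /nbhs_normP[e /= e0 eU].
have [r re r0] : exists2 r : R, e = r%:C & 0 < r.
  by move: e e0 {eU} => [er ei]; rewrite ltcE /= => /andP[/eqP -> ?]; exists er.
have h0 : 0 < r / 2 by rewrite divr_gt0.
have [a ax] : exists q : rat, ratr q \in `]x - r / 2, x[.
  by apply: rat_in_itvoo; rewrite ltrBlDr ltrDl.
have [b bx] : exists q : rat, ratr q \in `]x, x + r / 2[.
  by apply: rat_in_itvoo; rewrite ltrDl.
have [c cy] : exists q : rat, ratr q \in `]y - r / 2, y[.
  by apply: rat_in_itvoo; rewrite ltrBlDr ltrDl.
have [d dy] : exists q : rat, ratr q \in `]y, y + r / 2[.
  by apply: rat_in_itvoo; rewrite ltrDl.
move: ax bx cy dy; rewrite !in_itv/=.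
move=> /andP[a1 a2] /andP[b1 b2] /andP[c1 c2] /andP[d1 d2].
exists a => //; exists b => //; exists c => //; exists d => //.
rewrite /F; case: pselect => [sub|]; first by split; rewrite /= in_itv/= ?a2 ?c2.
case=> -[x' y'] /= [] /=; rewrite !in_itv/= => /andP[x1 x2] /andP[y1 y2].
apply: eU => /=; rewrite re.
change (`|(x - x') +i* (y - y')| < r%:C).
rewrite normc_def /= ltcR -[ltRHS]ger0_norm ?ltW// -sqrtr_sqr ltr_sqrt; last first.
  by rewrite exprn_gt0.
have X : (x - x') ^+ 2 < (r / 2) ^+ 2 by rewrite !expr2; nra.
have Y : (y - y') ^+ 2 < (r / 2) ^+ 2 by rewrite !expr2; nra.
rewrite /=; nra.
Qed.

Definition lebesgueC : set (CplxB R) -> \bar R :=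
  pushforward (lebesgue_measure \x lebesgue_measure)%E cplx_of_pair.

Lemma lebesgueC0 : lebesgueC set0 = 0%E.
Proof. by rewrite /lebesgueC /pushforward preimage_set0 measure0. Qed.

Lemma lebesgueC_ge0 A : (0 <= lebesgueC A)%E.
Proof. by rewrite /lebesgueC /pushforward measure_ge0. Qed.

Lemma lebesgueC_sigma_additive : semi_sigma_additive lebesgueC.
Proof.
move=> F mF tF mUF; rewrite /lebesgueC /pushforward preimage_bigcup.
have mpre B : measurable B -> measurable (cplx_of_pair @^-1` B).
  move=> mB; rewrite -[X in measurable X]setTI.
  exact: measurable_cplx_of_pair.
apply: measure_semi_sigma_additive.
- by move=> n; exact: mpre.
- apply/trivIsetP => /= i j _ _ ij; rewrite -preimage_setI.
  by move/trivIsetP : tF => /(_ _ _ _ _ ij) ->//; rewrite preimage_set0.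
- by rewrite -preimage_bigcup; exact: mpre.
Qed.

HB.instance Definition _ := isMeasure.Build _ _ _ lebesgueC
  lebesgueC0 lebesgueC_ge0 lebesgueC_sigma_additive.

Lemma inv_pi_ge0 : 0 <= (pi : R)^-1.
Proof. by rewrite invr_ge0 pi_ge0. Qed.

Definition dA : {measure set (CplxB R) -> \bar R} :=
  mscale (NngNum inv_pi_ge0) lebesgueC.

End area_measure.
Arguments dA {R}.

Section density.
Context d (T : measurableType d) (R : realType).
Variables (mu : {measure set T -> \bar R}) (g : T -> R).

Definition density_fun of measurable_fun setT g & (forall x, 0 <= g x) :
    set T -> \bar R :=
  fun A => (\int[mu]_(x in A) (g x)%:E)%E.

Variables (mg : measurable_fun setT g) (g0 : forall x, 0 <= g x).
Local Notation nu := (density_fun mg g0).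

Lemma density0 : nu set0 = 0%E. Proof. exact: integral_set0. Qed.

Lemma density_ge0 A : (0 <= nu A)%E.
Proof. by apply: integral_ge0 => x _; rewrite lee_fin. Qed.

Lemma density_sigma_additive : semi_sigma_additive nu.
Proof.
apply: semi_sigma_additive_nng_induced => [|x]; last by rewrite lee_fin.
exact/measurable_EFinP.
Qed.

HB.instance Definition _ := isMeasure.Build _ _ _ (density_fun mg g0)
  density0 density_ge0 density_sigma_additive.

(* The measure g dmu. *)
Definition density : {measure set T -> \bar R} := density_fun mg g0.

End density.

Section chi_dA.
Variable R : realType.

Lemma indic_ge0 (G : set (CplxB R)) z : 0 <= \1_G z :> R.
Proof. by rewrite indicE. Qed.

Definition chi_dA (G : set (CplxB R)) (mG : measurable G) :
    {measure set (CplxB R) -> \bar R} :=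
  density dA (measurable_indic mG) (indic_ge0 G).

Lemma measurable_superlevel (phi : CplxB R -> R) (r : R) :
  measurable_fun setT phi -> measurable [set z | phi z > r].
Proof.
move=> mphi; rewrite -[X in measurable X]setTI.
rewrite (_ : [set z | _] = phi @^-1` `]r, +oo[%classic); first exact: mphi.
by apply/seteqP; split => z /=; rewrite in_itv/= andbT.
Qed.

End chi_dA.

Section fock_space.
Variable R : realType.
Local Notation C := (Cplx R).

(* normc is the real-valued modulus, whereas `|z| has type C. *)
Definition gauss (z : C) : R := expR (- normc z ^+ 2 / 2).

Lemma measurable_normc : measurable_fun setT (@normc R : CplxB R -> R).
Proof.
apply: (measurability _ (RGenOInfty.measurableE R)) => _ [_ [a ->] <-].
suff oa : open ([set z | a < normc z] : set C).
  rewrite setTI (_ : _ @^-1` _ = [set z | a < normc z]).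
    exact: sub_sigma_algebra.
  by apply/seteqP; split => z /=; rewrite in_itv/= andbT.
rewrite openE => z /= az; apply/nbhs_normP.
exists (normc z - a)%:C => /=; first by rewrite ltcR subr_gt0.
move=> w /=.
change ((normc (z - w))%:C < (normc z - a)%:C -> a < normc w).
rewrite ltcR => h; have := le_normcD (z - w) w; rewrite subrK; lra.
Qed.

Lemma measurable_gauss : measurable_fun setT (fun z : CplxB R => 2^-1 * gauss z).
Proof.
apply: measurable_funM => //; apply: measurableT_comp => //.
apply: measurable_funM => //; apply: measurableT_comp => //.
exact: measurable_funX measurable_normc.
Qed.

Lemma gauss_ge0 (z : CplxB R) : 0 <= 2^-1 * gauss z.
Proof. by rewrite mulr_ge0 ?invr_ge0 ?expR_ge0. Qed.

Definition lambda : {measure set (CplxB R) -> \bar R} :=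
  density dA measurable_gauss gauss_ge0.

Definition entire (f : C -> C) : Prop := forall z, derivable f z 1.

Definition fock : set (C -> C) :=
  [set f | entire f /\ (\int[lambda]_z (normc (f z) ^+ 2)%:E < +oo)%E].

Definition fock_norm (f : C -> C) : R :=
  Num.sqrt (\int[lambda]_z (normc (f z) ^+ 2)).

(* An operator on F^2 is given by a map on all functions C -> C, of which only
   the restriction to F^2 matters. *)
Definition fock_bounded_operator (T : (C -> C) -> (C -> C)) : Prop :=
  [/\ forall f, fock f -> fock (T f),
      forall (a b : C) f g, fock f -> fock g ->
        T (fun z => a * f z + b * g z) = (fun z => a * T f z + b * T g z) &
      exists M : R, forall f, fock f -> fock_norm (T f) <= M * fock_norm f].

(* Invertibility in the algebra of bounded operators on F^2. *)
Definition fock_invertible (T : (C -> C) -> (C -> C)) : Prop :=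
  fock_bounded_operator T /\
  exists S, fock_bounded_operator S /\
    forall f, fock f -> S (T f) = f /\ T (S f) = f.

Definition expC (z : C) : C :=
  (expR (complex.Re z) * cos (complex.Im z)) +i*
  (expR (complex.Re z) * sin (complex.Im z)).

Definition integralC (mu : {measure set (CplxB R) -> \bar R}) (f : C -> C) : C :=
  (\int[mu]_w complex.Re (f w)) +i* (\int[mu]_w complex.Im (f w)).

Definition toeplitz (mu : {measure set (CplxB R) -> \bar R})
    (f : C -> C) : C -> C :=
  fun z => 2^-1 *
    integralC mu (fun w => f w * expC (z * conjc w / 2) * (gauss w)%:C).

Definition berezin (mu : {measure set (CplxB R) -> \bar R}) (z : C) : \bar R :=
  ((2^-1)%:E * \int[mu]_w (gauss (z - w))%:E)%E.

Definition reverse_carleson (mu : {measure set (CplxB R) -> \bar R}) : Prop :=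
  exists2 c : R, 0 < c & forall f, fock f ->
    (c%:E * \int[dA]_w (normc (f w) ^+ 2 * gauss w)%:E <=
     \int[mu]_w (normc (f w) ^+ 2 * gauss w)%:E)%E.

Definition discC (z : C) (r : R) : set C := [set w | normc (w - z) < r].

Definition reverse_carleson_condition
    (mu : {measure set (CplxB R) -> \bar R}) : Prop :=
  exists r c : R, [/\ 0 < r, 0 < c &
    forall z, ((c^-1)%:E <= mu (discC z r) <= c%:E)%E].

End fock_space.

(* Main.v *)
(* Goursat's lemma gives the mean value property of entire functions, hence the reproducing formula
   of F^2 and the Bargmann projection P, a contraction of L^2 with T_phi = P (phi .).
   (a) => (b), (b) <=> (e) and (d) => (e) come from testing on normalized reproducing kernels,
   for which |k_z|^2 times the weight is a Gaussian centred at z. (b) makes G = {phi > r} relatively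
   dense, and Luecking's theorem then gives (c): log |h|^2 is subharmonic, so by Jensen's inequality
   |h(0)|^2 is at most the mean over a disc of W |h|^2 for any weight W whose logarithm has
   nonnegative mean there; W is chosen large on G and small off G, and the small part is absorbed
   after integrating over all translates. Finally (d) makes the compression of 1 - phi / M a strict
   contraction of F^2, so that T_phi is inverted by a Neumann series. *)

From HB Require Import structures.
Require Import Defs.
From mathcomp Require Import all_boot all_order all_algebra.
From mathcomp Require Import all_classical all_reals all_analysis.
From mathcomp Require Import measurable_realfun complex ring lra.

Set Implicit Arguments.
Unset Strict Implicit.
Unset Printing Implicit Defensive.

Import Order.TTheory GRing.Theory Num.Theory.
Import numFieldNormedType.Exports.
Import ComplexField.Normc.

Local Open Scope classical_set_scope.
Local Open Scope ring_scope.
Local Open Scope complex_scope.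

(** The obstacle is regularity: all facts about entire functions are extracted from means over
    circles, by way of integral formulas. Pulling [f] back by [w e^z] turns circles into vertical
    segments, so Goursat's lemma is wanted on rectangles only. Averaging the circle means against
    the Gaussian gives [f 0], weighted translations move the point, and the resulting identity
    [bproj f = f] supplies the bounds on point evaluations and the local Lipschitz bounds. As
    [bproj g] is entire for every [g] of finite norm, holomorphy of the sum of the Neumann series is
    read off the fixed-point equation that it solves. Zeros of [h] spoil [log |h|^2]: it is replaced
    by [log (|h|^2 + e)], and subharmonicity becomes a maximum principle for a finite product of
    rotated copies of [h]. Norms are measured by [norm2], twice the squared norm of F^2 and valued
    in [\bar R], so that finiteness is part of each estimate. *)

Section density_integral.
Context d (T : measurableType d) (R : realType).
Variables (mu : {measure set T -> \bar R}) (g : T -> R).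
Variables (mg : measurable_fun setT g) (g0 : forall x, 0 <= g x).
Local Open Scope ereal_scope.
Import HBNNSimple.

Let integral_density_nnsfun (h : {nnsfun T >-> R}) :
  \int[density mu mg g0]_x (h x)%:E = \int[mu]_x ((h x)%:E * (g x)%:E).
Proof.
have mk k : measurable (h @^-1` [set k]) by [].
under eq_integral do rewrite fimfunE -fsumEFin//.
under [RHS]eq_integral => x _.
  rewrite fimfunE -fsumEFin// ge0_mule_fsuml; last first.
    by move=> r; rewrite EFinM nnfun_muleindic_ge0.
  over.
rewrite [LHS]ge0_integral_fsum//; last 2 first.
  - by move=> r; exact/measurable_EFinP/measurable_funM.
  - by move=> r x _; rewrite nnfun_muleindic_ge0.
rewrite [RHS]ge0_integral_fsum//; last 2 first.
  - move=> r; under eq_fun do rewrite -EFinM.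
    exact/measurable_EFinP/measurable_funM/mg/measurable_funM.
  - by move=> r x _; rewrite mule_ge0// ?nnfun_muleindic_ge0 ?lee_fin.
apply: eq_fsbigr => r _.
rewrite integralZl_indic_nnsfun//= integral_indic// setIT.
have [r0|r0] := leP 0%R r; last first.
  rewrite preimage_nnfun0// measure0 mule0 integral0_eq// => x _.
  by rewrite indicE in_set0 mulr0 mul0e.
rewrite /density/= /density_fun integral_mkcond -ge0_integralZl_EFin//; last 2 first.
  - by move=> x _; rewrite patchE; case: ifPn => // _; rewrite lee_fin.
  - rewrite (_ : _ \_ _ = (fun x => (g x)%:E) \_ (h @^-1` [set r]))//.
    by apply/(measurable_restrictT _ _).1 => //; apply/measurable_EFinP; exact: measurable_funTS.
apply: eq_integral => x _.
rewrite patchE indicE; case: ifPn => _ /=; first by rewrite mulr1.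
by rewrite mulr0 mul0e mule0.
Qed.

Lemma ge0_integral_density (F : T -> \bar R) :
  measurable_fun setT F -> (forall x, 0 <= F x) ->
  \int[density mu mg g0]_x F x = \int[mu]_x (F x * (g x)%:E).
Proof.
move=> mF F0; pose f_ := nnsfun_approx measurableT mF.
have cvgf x : (f_ ^~ x n)%:E @[n --> \oo] --> F x.
  by apply: cvg_nnsfun_approx => // y _; exact: F0.
have mEg : measurable_fun setT (EFin \o g) by exact/measurable_EFinP.
transitivity (limn (fun n => \int[density mu mg g0]_x (f_ n x)%:E)).
  rewrite -monotone_convergence//.
  - by apply: eq_integral => x _; apply/esym/cvg_lim => //; exact: cvgf.
  - by move=> n; exact/measurable_EFinP.
  - by move=> n x _; rewrite lee_fin.
  - by move=> x _ a b ab; rewrite lee_fin; exact/lefP/nd_nnsfun_approx.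
under eq_fun do rewrite integral_density_nnsfun.
rewrite -monotone_convergence//.
- apply: eq_integral => x _; apply/cvg_lim => //.
  by apply: cvgeZr => //; exact: cvgf.
- by move=> n; apply: emeasurable_funM => //; exact/measurable_EFinP.
- by move=> n x _; rewrite mule_ge0// lee_fin.
- move=> x _ a b ab; rewrite lee_wpmul2r ?lee_fin//.
  exact/lefP/nd_nnsfun_approx.
Qed.

(** Multiplication by [g >= 0] commutes with taking positive and negative parts, so both sides are
    the same difference of nonnegative integrals. *)
Lemma integral_density (F : T -> \bar R) : measurable_fun setT F ->
  \int[density mu mg g0]_x F x = \int[mu]_x (F x * (g x)%:E).
Proof.
move=> mF; rewrite integralE [RHS]integralE.
rewrite !ge0_integral_density//; [|exact: measurable_funeneg|exact: measurable_funepos].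
congr (_ - _); apply: eq_integral => x _.
  rewrite !funeposE; have [F0|/ltW F0] := leP 0 (F x).
    by rewrite !max_l// mule_ge0// lee_fin.
  have FG0 : F x * (g x)%:E <= 0 by rewrite mule_le0_ge0// lee_fin.
  by rewrite !max_r ?mul0e.
rewrite !funenegE; have [F0|/ltW F0] := leP 0 (F x).
  have FG0 : 0 <= F x * (g x)%:E by rewrite mule_ge0// lee_fin.
  by rewrite !max_r ?mul0e// oppe_le0.
have FG0 : F x * (g x)%:E <= 0 by rewrite mule_le0_ge0// lee_fin.
by rewrite !max_l ?mulNe// oppe_ge0.
Qed.

End density_integral.

(** * Lebesgue measure on the plane: translations and shears *)

Section plane.
Variable R : realType.
Local Notation mu := (@lebesgue_measure R).
Local Notation RR := (measurableTypeR R).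
Local Notation mu2 := ((@lebesgue_measure R) \x (@lebesgue_measure R))%E.
Local Open Scope ereal_scope.

Lemma lebesgue_measure_translation (c : R) (A : set RR) : measurable A ->
  pushforward mu (+%R c : RR -> RR) A = mu A.
Proof.
have mc : measurable_fun setT (+%R c : RR -> RR) by exact: measurable_funD.
pose H := isMeasurableFun.Build _ _ _ _ _ mc.
pose f : {mfun RR >-> RR} := HB.pack (+%R c : RR -> RR) H.
move=> mA; apply/esym.
apply: (@lebesgue_measure_unique _ (pushforward mu f)) => //= _ [[a b]] _ <-.
rewrite /pushforward (_ : _ @^-1` _ = `]a - c, b - c]%classic)%R; last first.
  by apply/seteqP; split => x /=; rewrite !in_itv/= ltrBlDl lerBrDl.
by rewrite !lebesgue_measure_itv/= !lte_fin ltrD2r -!EFinD; congr (if _ then _%:E else _); ring.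
Qed.

Lemma ge0_integral_translation (c : R) (F : RR -> \bar R) :
  measurable_fun setT F -> (forall x, 0 <= F x) ->
  \int[mu]_x F (c + x)%R = \int[mu]_x F x.
Proof.
move=> mF F0.
have mc : measurable_fun setT (+%R c : RR -> RR) by exact: measurable_funD.
have := @ge0_integral_pushforward _ _ _ _ _ _ mc mu setT F measurableT mF
  (fun y _ => F0 y).
rewrite preimage_setT => <-.
by apply: eq_measure_integral => A mA _; exact: lebesgue_measure_translation.
Qed.

(** By Tonelli: on each vertical line the shear is a translation. Shears are the building blocks of
    translations and rotations of the plane. *)
Lemma ge0_integral_shear_y (c : RR -> R) (F : RR * RR -> \bar R) :
  measurable_fun setT c -> measurable_fun setT F -> (forall x, 0 <= F x) ->
  \int[mu2]_p F (p.1, c p.1 + p.2)%R = \int[mu2]_p F p.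
Proof.
move=> mc mF F0; rewrite !fubini_tonelli1//; last first.
  apply: (measurableT_comp mF); apply: measurable_fun_pair => //=.
  by apply: measurable_funD => //; exact: measurableT_comp.
apply: eq_integral => x _; rewrite /fubini_F/=.
apply: (ge0_integral_translation (c x) (F := fun y => F (x, y))) => //.
by apply: measurableT_comp => //; exact: pair1_measurable.
Qed.

Lemma ge0_integral_shear_x (c : RR -> R) (F : RR * RR -> \bar R) :
  measurable_fun setT c -> measurable_fun setT F -> (forall x, 0 <= F x) ->
  \int[mu2]_p F (c p.2 + p.1, p.2)%R = \int[mu2]_p F p.
Proof.
move=> mc mF F0; rewrite !fubini_tonelli2//; last first.
  apply: (measurableT_comp mF); apply: measurable_fun_pair => //=.
  by apply: measurable_funD => //; exact: measurableT_comp.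
apply: eq_integral => y _; rewrite /fubini_G/=.
apply: (ge0_integral_translation (c y) (F := fun x => F (x, y))) => //.
by apply: measurableT_comp => //; exact: pair2_measurable.
Qed.

Lemma ge0_integral_dA (F : CplxB R -> \bar R) :
  measurable_fun setT F -> (forall x, 0 <= F x) ->
  \int[dA]_z F z = (pi^-1)%:E * \int[mu2]_p F (p.1 +i* p.2)%C.
Proof.
move=> mF F0; rewrite /dA ge0_integral_mscale//=; congr (_ * _).
rewrite [in LHS]/lebesgueC ge0_integral_pushforward//.
exact: measurable_cplx_of_pair.
Qed.

End plane.

(** * The complex plane: modulus, measurability, translations and rotations *)

Section complex_plane.
Variable R : realType.
Local Notation C := (Cplx R).
Local Notation RR := (measurableTypeR R).
Local Notation mu2 := ((@lebesgue_measure R) \x (@lebesgue_measure R))%E.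

Lemma normc_Re_le (z : R[i]) : `|complex.Re z| <= normc z.
Proof.
case: z => x y /=; rewrite -[X in X <= _]sqrtr_sqr ler_sqrt ?addr_ge0 ?sqr_ge0//.
by rewrite lerDl sqr_ge0.
Qed.

Lemma normc_Im_le (z : R[i]) : `|complex.Im z| <= normc z.
Proof.
case: z => x y /=; rewrite -[X in X <= _]sqrtr_sqr ler_sqrt ?addr_ge0 ?sqr_ge0//.
by rewrite lerDr sqr_ge0.
Qed.

Lemma normc_le_ReIm (z : R[i]) : normc z <= `|complex.Re z| + `|complex.Im z|.
Proof.
case: z => x y /=; rewrite -[leRHS]ger0_norm ?addr_ge0// -sqrtr_sqr ler_sqrt ?sqr_ge0//.
by rewrite sqrrD !real_normK ?num_real// lerD2r lerDl mulrn_wge0// mulr_ge0.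
Qed.

Lemma normc_ge0 (z : R[i]) : 0 <= normc z.
Proof. by case: z => x y; exact: sqrtr_ge0. Qed.

Lemma normc_sqr (z : R[i]) : normc z ^+ 2 = complex.Re z ^+ 2 + complex.Im z ^+ 2.
Proof. by case: z => x y /=; rewrite sqr_sqrtr// addr_ge0// sqr_ge0. Qed.

Lemma measurable_fun_of_continuous (f : C -> R) :
  (forall z e, 0 < e -> exists2 d, 0 < d &
    forall w, normc (w - z) < d -> `|f w - f z| < e) ->
  measurable_fun setT (f : CplxB R -> R).
Proof.
move=> cf; apply: (measurability _ (RGenOInfty.measurableE R)) => _ [_ [a ->] <-].
suff oa : open ([set z | a < f z] : set C).
  rewrite setTI (_ : _ @^-1` _ = [set z | a < f z]).
    exact: sub_sigma_algebra.
  by apply/seteqP; split => z /=; rewrite in_itv/= andbT.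
rewrite openE => z /= az; apply/nbhs_normP.
have az0 : 0 < f z - a by rewrite subr_gt0.
have [d d0 hd] := cf z (f z - a) az0.
exists d%:C => /=; first by rewrite ltcR.
move=> w /=.
change ((normc (z - w))%:C < d%:C -> a < f w).
rewrite ltcR -normcN opprB => /hd; rewrite ltr_norml => /andP[+ _]; lra.
Qed.

Lemma measurable_Re : measurable_fun setT (@complex.Re R : CplxB R -> R).
Proof.
apply: measurable_fun_of_continuous => z e e0; exists e => // w.
by apply: le_lt_trans; rewrite -[X in `|X|]raddfB; exact: normc_Re_le.
Qed.

Lemma measurable_Im : measurable_fun setT (@complex.Im R : CplxB R -> R).
Proof.
apply: measurable_fun_of_continuous => z e e0; exists e => // w.
by apply: le_lt_trans; rewrite -[X in `|X|]raddfB; exact: normc_Im_le.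
Qed.

(** [f] factors through [cplx_of_pair], so measurability into the Borel plane can be checked on real
    and imaginary parts. *)
Lemma measurable_cplxP d (T : measurableType d) (f : T -> CplxB R) :
  measurable_fun setT (fun t => complex.Re (f t)) ->
  measurable_fun setT (fun t => complex.Im (f t)) ->
  measurable_fun setT f.
Proof.
move=> mre mim; rewrite (_ : f = (@cplx_of_pair R) \o (fun t => (complex.Re (f t), complex.Im (f t)))).
  apply: (measurableT_comp (@measurable_cplx_of_pair R)).
  exact: measurable_fun_pair.
by apply/funext => t /=; rewrite /cplx_of_pair; case: (f t).
Qed.

Lemma ge0_integral_dA_translation (c : C) (F : CplxB R -> \bar R) :
  measurable_fun setT F -> (forall x, 0 <= F x)%E ->
  (\int[dA]_z F (c + z)%R = \int[dA]_z F z)%E.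
Proof.
move=> mF F0; have mp := measurableT_comp mF (@measurable_cplx_of_pair R).
rewrite !ge0_integral_dA//; last first.
  apply: (measurableT_comp mF); apply: measurable_cplxP.
    rewrite (_ : (fun _ => _) = (fun z : CplxB R => complex.Re c + complex.Re z)).
      by apply: measurable_funD => //; exact: measurable_Re.
    by apply/funext => z /=; rewrite raddfD.
  rewrite (_ : (fun _ => _) = (fun z : CplxB R => complex.Im c + complex.Im z)).
    by apply: measurable_funD => //; exact: measurable_Im.
  by apply/funext => z /=; rewrite raddfD.
congr (_ * _)%E.
rewrite -(@ge0_integral_shear_y _ (cst (complex.Im c)) (fun p => F (p.1 +i* p.2)))//.
rewrite -(@ge0_integral_shear_x _ (cst (complex.Re c))
  (fun p => F ((p.1 +i* (complex.Im c + p.2)))))//.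
  by apply: eq_integral => -[x y] _ /=; case: c.
have mT : measurable_fun setT (fun p : RR * RR => (p.1, complex.Im c + p.2) : RR * RR).
  by apply: measurable_fun_pair => //=; exact: measurable_funD.
exact: (measurableT_comp mp mT).
Qed.

(** A rotation with [b != 0] is a product of three shears, horizontal, vertical, horizontal, with
    slopes [c], [b], [c] where [c = (a - 1) / b]; the relation [a^2 + b^2 = 1] enters as
    [c (a + 1) = - b]. *)
Lemma ge0_integral_rotation (a b : R) (F : RR * RR -> \bar R) :
  a ^+ 2 + b ^+ 2 = 1 -> measurable_fun setT F -> (forall x, 0 <= F x)%E ->
  (\int[mu2]_p F (a * p.1 - b * p.2, b * p.1 + a * p.2)%R = \int[mu2]_p F p)%E.
Proof.
have main a' b' G : b' != 0 -> a' ^+ 2 + b' ^+ 2 = 1 -> measurable_fun setT G ->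
  (forall x, 0 <= G x)%E ->
  (\int[mu2]_p G (a' * p.1 - b' * p.2, b' * p.1 + a' * p.2)%R = \int[mu2]_p G p)%E.
  move=> {a b F} b0 ab mG G0; set a := a'; set b := b'; pose c := (a - 1) / b.
  pose S1 := fun p : RR * RR => (c * p.2 + p.1, p.2) : RR * RR.
  pose S2 := fun p : RR * RR => (p.1, b * p.1 + p.2) : RR * RR.
  have mS1 : measurable_fun setT S1.
    apply: measurable_fun_pair => //=; apply: measurable_funD => //.
    exact: measurable_funM.
  have mS2 : measurable_fun setT S2.
    apply: measurable_fun_pair => //=; apply: measurable_funD => //.
    exact: measurable_funM.
  rewrite -(@ge0_integral_shear_x _ (fun y => c * y) G)//; last exact: measurable_funM.
  rewrite -(@ge0_integral_shear_y _ (fun y => b * y) (G \o S1))//=; last 2 first.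
  - exact: measurable_funM.
  - exact: measurableT_comp.
  rewrite -(@ge0_integral_shear_x _ (fun y => c * y) ((G \o S1) \o S2))//=; last 2 first.
  - exact: measurable_funM.
  - by apply: measurableT_comp => //; exact: measurableT_comp.
  have cb : c * b = a - 1 by rewrite /c divfK.
  have ca : c * (a + 1) = - b.
    apply: (mulIf b0); rewrite mulrAC cb mulNr -expr2.
    have := ab; rewrite -/a -/b; nra.
  apply: eq_integral => -[x y] _; rewrite /S1/S2/=; congr (G (_, _)).
    rewrite (_ : c * (b * (c * y + x) + y) + (c * y + x) = (c * b) * (c * y + x) + c * y + (c * y + x)); last by ring.
    by rewrite cb -[b]opprK -ca; ring.
  by rewrite mulrDr mulrA [b * c]mulrC cb; ring.
move=> ab mF F0; have [b0|] := eqVneq b 0; last by move=> ?; exact: main.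
have mrot : measurable_fun setT (fun p : RR * RR => (- p.2, p.1) : RR * RR).
  by apply: measurable_fun_pair => //=; exact: measurableT_comp.
have [->|a1] := eqVneq a 1.
  by apply: eq_integral => -[x y] _; rewrite b0/= !mul0r !mul1r subr0 add0r.
(* The half-turn has [b = 0] and escapes the factorization; it is the quarter-turn, with [b = 1],
   applied twice. *)
have {a1} -> : a = -1.
  apply/eqP; move: ab; rewrite b0 expr0n addr0 => /eqP.
  by rewrite sqrf_eq1 (negbTE a1).
have m01 : 0 ^+ 2 + 1 ^+ 2 = 1 :> R by rewrite expr0n add0r expr1n.
pose F1 p : \bar R := F (0 * p.1 - 1 * p.2, 1 * p.1 + 0 * p.2).
have F1E : F1 = F \o (fun p : RR * RR => (- p.2, p.1) : RR * RR).
  by apply/funext => -[x y]; rewrite /F1/=; congr (F (_, _)); ring.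
have mF1 : measurable_fun setT F1 by rewrite F1E; exact: measurableT_comp.
rewrite -(main 0 1 F (oner_neq0 _) m01 mF F0) -/F1.
rewrite -(main 0 1 F1 (oner_neq0 _) m01 mF1 (fun=> F0 _)).
by apply: eq_integral => -[x y] _; rewrite /F1 b0/=; congr (F (_, _)); ring.
Qed.

End complex_plane.

(** * The normalized area measure: rotations, Gaussian integrals, Tonelli *)

Section area.
Variable R : realType.
Local Notation C := (Cplx R).
Local Notation RR := (measurableTypeR R).
Local Notation mu2 := ((@lebesgue_measure R) \x (@lebesgue_measure R))%E.

Lemma ge0_integral_dA_rotation (u : C) (F : CplxB R -> \bar R) :
  normc u = 1 -> measurable_fun setT F -> (forall x, 0 <= F x)%E ->
  (\int[dA]_z F (u * z)%R = \int[dA]_z F z)%E.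
Proof.
move=> u1 mF F0; have mp := measurableT_comp mF (@measurable_cplx_of_pair R).
have mRe := @measurable_Re R; have mIm := @measurable_Im R.
rewrite !ge0_integral_dA//; last first.
  case: u {u1} => a b.
  apply: (measurableT_comp mF); apply: measurable_cplxP.
    rewrite (_ : (fun _ => _) = (fun z : CplxB R => a * complex.Re z - b * complex.Im z)).
      by apply: measurable_funB; exact: measurable_funM.
    by apply/funext => -[x y].
  rewrite (_ : (fun _ => _) = (fun z : CplxB R => a * complex.Im z + b * complex.Re z)).
    by apply: measurable_funD; exact: measurable_funM.
  by apply/funext => -[x y].
congr (_ * _)%E.
rewrite -(@ge0_integral_rotation _ (complex.Re u) (complex.Im u) (fun p => F (p.1 +i* p.2)))//.
  by apply: eq_integral => -[x y] _ /=; case: u {u1} => a b /=; congr F; congr (_ +i* _); rewrite addrC.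
by rewrite -normc_sqr u1 expr1n.
Qed.

Lemma integral_gauss_line (a m : R) : 0 < a ->
  (\int[lebesgue_measure]_x (expR (- (a * (x - m) ^+ 2)))%:E
   = (Num.sqrt (pi / a))%:E)%E.
Proof.
(* The standard deviation for which the normal density has exponent [- a (x - m)^2]; its total mass
   1 then yields the integral. *)
move=> a0; pose s := Num.sqrt ((2 * a)^-1).
have s0 : s != 0 by rewrite gt_eqF// sqrtr_gt0 invr_gt0 mulr_gt0.
have s2 : s ^+ 2 = (2 * a)^-1 by rewrite sqr_sqrtr// invr_ge0 mulr_ge0// ltW.
have := integral_normal_pdf m s.
under eq_integral do rewrite /normal_pdf (negbTE s0) EFinM.
have mg : measurable_fun setT (fun x : RR => (normal_fun m s x)%:E).
  by apply/measurable_EFinP; exact: measurable_normal_fun.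
rewrite ge0_integralZl//; last 2 first.
- by move=> x _; rewrite lee_fin normal_fun_ge0.
- by rewrite lee_fin normal_peak_ge0.
have E : normal_fun m s = (fun x => expR (- (a * (x - m) ^+ 2))).
  apply/funext => x; rewrite /normal_fun -mulr_natr s2; congr expR.
  by field; rewrite gt_eqF.
rewrite E => H.
have np : normal_peak s = (Num.sqrt (pi / a))^-1.
  rewrite /normal_peak -mulr_natr s2; congr (_^-1); congr Num.sqrt.
  by field; rewrite gt_eqF.
have p0 : Num.sqrt (pi / a) != 0 by rewrite gt_eqF// sqrtr_gt0 divr_gt0// pi_gt0.
have := congr1 (fun t => (Num.sqrt (pi / a))%:E * t)%E H.
by rewrite muleA np -EFinM divff// mul1e mule1.
Qed.

(** The square of the line integral is [pi / a], and the normalization of [dA] removes [pi]. *)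
Lemma integral_gauss_dA (a : R) : 0 < a ->
  (\int[dA]_z (expR (- (a * normc z ^+ 2)))%:E = (a^-1)%:E)%E.
Proof.
move=> a0.
have mF : measurable_fun setT (fun z : CplxB R => (expR (- (a * normc z ^+ 2)))%:E).
  apply/measurable_EFinP; apply: measurableT_comp => //; apply: measurableT_comp => //.
  by apply: measurable_funM => //; exact: measurable_funX (@measurable_normc R).
have mline : measurable_fun setT (fun x : RR => expR (- (a * x ^+ 2))).
  apply: measurableT_comp => //; apply: measurableT_comp => //.
  by apply: measurable_funM => //; exact: measurable_funX.
rewrite ge0_integral_dA//.
rewrite fubini_tonelli1//; last by apply: (measurableT_comp mF (@measurable_cplx_of_pair R)).
have line : (\int[lebesgue_measure]_x (expR (- (a * x ^+ 2)))%:E = (Num.sqrt (pi / a))%:E)%E.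
  by rewrite -(integral_gauss_line 0 a0); apply: eq_integral => x _; rewrite subr0.
transitivity (pi^-1%:E * (\int[lebesgue_measure]_x ((expR (- (a * x ^+ 2)))%:E * (Num.sqrt (pi / a))%:E)))%E.
  congr (_ * _)%E; apply: eq_integral => x _; rewrite /fubini_F/=.
  rewrite -line -ge0_integralZl//; last first.
  - by apply/measurable_EFinP.
  apply: eq_integral => y _; rewrite -EFinM -expRD; congr (expR _)%:E.
  by rewrite (normc_sqr (x +i* y))/=; ring.
rewrite ge0_integralZr//; last first.
- by apply/measurable_EFinP.
rewrite line -!EFinM -expr2 sqr_sqrtr ?divr_ge0 ?pi_ge0 ?ltW//.
by rewrite mulrA mulVf ?mul1r// gt_eqF// pi_gt0.
Qed.

Lemma measurable_disc (z : C) (r : R) : measurable (discC z r : set (CplxB R)).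
Proof.
rewrite -[X in measurable X]setTI (_ : discC z r = (fun w : CplxB R => normc (w - z)) @^-1` `]-oo, r[%classic); last first.
  by apply/seteqP; split => w /=; rewrite in_itv.
suff : measurable_fun setT (fun w : CplxB R => normc (w - z)) by exact.
apply: (measurableT_comp (@measurable_normc R)).
apply: measurable_cplxP.
  rewrite (_ : (fun _ => _) = (fun w : CplxB R => complex.Re w - complex.Re z)).
    by apply: measurable_funB => //; exact: measurable_Re.
  by apply/funext => w /=; rewrite raddfB.
rewrite (_ : (fun _ => _) = (fun w : CplxB R => complex.Im w - complex.Im z)).
  by apply: measurable_funB => //; exact: measurable_Im.
by apply/funext => w /=; rewrite raddfB.
Qed.

(** On the disc [e^{r^2} e^{-|z|^2} >= 1], so the area is dominated by a Gaussian integral. *)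
Lemma dA_disc0_lty (r : R) : (dA (discC 0 r : set (CplxB R)) < +oo)%E.
Proof.
have mD := measurable_disc 0 r.
rewrite -[X in dA X]setIT -integral_indic//.
apply: (@le_lt_trans _ _ (\int[dA]_z ((expR (r ^+ 2))%:E * (expR (- (1 * normc (z : CplxB R) ^+ 2)))%:E))%E).
  have mg : measurable_fun setT (fun z : CplxB R => expR (- (1 * normc z ^+ 2))).
    apply: measurableT_comp => //; apply: measurableT_comp => //.
    by apply: measurable_funM => //; exact: measurable_funX (@measurable_normc R).
  apply: ge0_le_integral => //.
  - apply/measurable_EFinP; exact: measurable_indic.
  - by under eq_fun do rewrite -EFinM; apply/measurable_EFinP; exact: measurable_funM.
  move=> z _; rewrite -EFinM lee_fin indicE -expRD; case: (boolP (_ \in _)) => [|_]; last exact: expR_ge0.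
  rewrite inE /discC/= subr0 mul1r => zr; rewrite -[leLHS]expR0 ler_expR subr_ge0.
  by rewrite ler_sqr ?nnegrE ?normc_ge0// ltW// (le_lt_trans (normc_ge0 z)).
rewrite ge0_integralZl//; last first.
- apply/measurable_EFinP; apply: measurableT_comp => //; apply: measurableT_comp => //.
  by apply: measurable_funM => //; exact: measurable_funX (@measurable_normc R).
by rewrite integral_gauss_dA// -EFinM ltry.
Qed.

Lemma dA_sigma_finite : sigma_finite setT (@dA R).
Proof.
exists (fun n => discC (0 : C) n%:R : set (CplxB R)).
  apply/seteqP; split => // z _; exists (Num.truncn (normc z)).+1 => //=.
  by rewrite /discC/= subr0; exact: truncnS_gt.
by move=> n; split; [exact: measurable_disc|exact: dA_disc0_lty].
Qed.

(* A constant of its own, so that the sigma-finite measure structure can be attached to it. *)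
Definition dA_fun : set (CplxB R) -> \bar R := mscale (NngNum (inv_pi_ge0 R)) (@lebesgueC R).

HB.instance Definition _ := Measure.on dA_fun.
HB.instance Definition _ := @Measure_isSigmaFinite.Build _ _ _ dA_fun dA_sigma_finite.

Lemma dA_funE : (dA_fun : {measure set (CplxB R) -> \bar R}) = dA.
Proof. by []. Qed.

Lemma dA_tonelli (f : CplxB R * CplxB R -> \bar R) :
  measurable_fun setT f -> (forall p, 0 <= f p)%E ->
  (\int[dA]_z \int[dA]_w f (z, w) = \int[dA]_w \int[dA]_z f (z, w))%E.
Proof. by move=> mf f0; rewrite -dA_funE; exact: fubini_tonelli. Qed.

End area.

(** * Goursat's lemma for closed 1-forms on rectangles *)

Section goursat.
Variable R : realType.
Local Notation mu := (@lebesgue_measure R).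
Implicit Types (f g : R -> R) (a b c : R).

Lemma continuous_integrable_itv f a b : continuous f ->
  mu.-integrable `[a, b] (EFin \o f).
Proof.
move=> cf; apply: continuous_compact_integrable; first exact: segment_compact.
exact: continuous_subspaceT.
Qed.

Lemma Rintegral_split f a b c : continuous f -> a <= b -> b <= c ->
  \int[mu]_(t in `[a, c]) f t =
  \int[mu]_(t in `[a, b]) f t + \int[mu]_(t in `[b, c]) f t.
Proof.
move=> cf ab bc; have ac := le_trans ab bc.
have := @Rintegral_itvB R f (BLeft a) (BRight c) b (continuous_integrable_itv a c cf).
rewrite !bnd_simp ab bc => /(_ isT isT) H.
rewrite -[X in _ = _ + X]Rintegral_itv_obnd_cbnd -?H; first by rewrite addrC subrK.
apply: integrableS (continuous_integrable_itv b c cf) => //.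
by apply: subset_itvr; rewrite bnd_simp.
Qed.

Lemma Rintegral_cstr a b c : a <= b -> \int[mu]_(t in `[a, b]) c = c * (b - a).
Proof.
move=> ab; rewrite Rintegral_cst//= lebesgue_measure_itv/= lte_fin.
by move: ab; rewrite le_eqVlt => /predU1P[->|->]//=; rewrite ltxx subrr.
Qed.

Lemma Rintegral_bound f a b M : continuous f -> a <= b ->
  (forall t, a <= t <= b -> `|f t| <= M) ->
  `|\int[mu]_(t in `[a, b]) f t| <= M * (b - a).
Proof.
move=> cf ab fM; have fi := continuous_integrable_itv a b cf.
apply: le_trans (le_normr_Rintegral _ fi) _ => //.
rewrite -Rintegral_cstr//; apply: le_Rintegral => //.
- exact: integrable_norm.
by apply: continuous_integrable_itv => x; exact: cvg_cst.
Qed.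

(** Bisection by dependent choice, for an arbitrary predicate on stages and lower-left corners. The
    limit point is the supremum of the corners, coordinate by coordinate; nesting keeps it inside
    every rectangle. *)
Lemma nested_rectangles (w h : R) (Bad : nat -> R -> R -> Prop) x0 y0 :
  Bad 0 x0 y0 ->
  (forall n x y, Bad n x y -> exists x' y', [/\ Bad n.+1 x' y',
    x <= x' /\ x' + w / 2 ^+ n.+1 <= x + w / 2 ^+ n &
    y <= y' /\ y' + h / 2 ^+ n.+1 <= y + h / 2 ^+ n]) ->
  0 <= w -> 0 <= h ->
  exists X Y, forall n, exists x y, [/\ Bad n x y,
    x <= X <= x + w / 2 ^+ n & y <= Y <= y + h / 2 ^+ n].
Proof.
move=> B0 step w0 h0.
have [f fP] : {f : nat * (R * R) -> R * R & forall s, Bad s.1 s.2.1 s.2.2 ->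
    [/\ Bad s.1.+1 (f s).1 (f s).2,
    s.2.1 <= (f s).1 /\ (f s).1 + w / 2 ^+ s.1.+1 <= s.2.1 + w / 2 ^+ s.1 &
    s.2.2 <= (f s).2 /\ (f s).2 + h / 2 ^+ s.1.+1 <= s.2.2 + h / 2 ^+ s.1]}.
  apply: (@choice _ _ (fun s p => Bad s.1 s.2.1 s.2.2 ->
    [/\ Bad s.1.+1 p.1 p.2,
    s.2.1 <= p.1 /\ p.1 + w / 2 ^+ s.1.+1 <= s.2.1 + w / 2 ^+ s.1 &
    s.2.2 <= p.2 /\ p.2 + h / 2 ^+ s.1.+1 <= s.2.2 + h / 2 ^+ s.1])).
  move=> -[n [x y]] /=; have [/step[x' [y' H]]|nB] := pselect (Bad n x y).
    by exists (x', y').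
  (* A default for corners that are not bad, which the iteration started at [(x0, y0)] never
     meets. *)
  by exists (0, 0).
pose s := fix s n := if n is m.+1 then f (m, s m) else (x0, y0).
have sB n : Bad n (s n).1 (s n).2.
  by elim: n => [//|n IH] /=; have [] := fP (n, s n) IH.
have lim (u : nat -> R) (v : R) : 0 <= v ->
    (forall n, u n <= u n.+1 /\ u n.+1 + v / 2 ^+ n.+1 <= u n + v / 2 ^+ n) ->
    forall n, u n <= sup (range u) <= u n + v / 2 ^+ n.
  move=> v0 uP.
  have und m k : u m <= u (m + k)%N.
    elim: k => [|k IH]; first by rewrite addn0.
    by rewrite addnS (le_trans IH)//; have [] := uP (m + k)%N.
  have uvn m k : u (m + k)%N + v / 2 ^+ (m + k) <= u m + v / 2 ^+ m.
    elim: k => [|k IH]; first by rewrite addn0.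
    by rewrite addnS (le_trans _ IH)//; have [] := uP (m + k)%N.
  have v2 n : 0 <= v / 2 ^+ n by rewrite divr_ge0// exprn_ge0.
  have ub n : ubound (range u) (u n + v / 2 ^+ n).
    move=> _ [m _ <-]; have [mn|nm] := leqP m n.
      rewrite -(subnKC mn) (le_trans (und m (n - m)%N))// lerDl.
      by rewrite subnKC.
    rewrite (le_trans _ (uvn n (m - n)%N))// subnKC; last exact: ltnW.
    by rewrite lerDl.
  move=> n; apply/andP; split.
    apply: ub_le_sup; last by exists n.
    by exists (u 0%N + v / 2 ^+ 0); exact: ub.
  apply: ge_sup; last exact: ub.
  by exists (u 0%N); exists 0%N.
exists (sup (range (fun n => (s n).1))), (sup (range (fun n => (s n).2))) => n.
exists (s n).1, (s n).2; split => //.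
  apply: (lim (fun n => (s n).1)) => // m.
  by have [_ ? ?] := fP (m, s m) (sB m).
apply: (lim (fun n => (s n).2)) => // m.
by have [_ ? ?] := fP (m, s m) (sB m).
Qed.

Section closed_form.
Variables P Q : R -> R -> R.
(* Differentiability with a symmetric Jacobian: the 1-form P dx + Q dy is closed. *)
Hypothesis closed : forall x y, exists a b c, forall e, 0 < e ->
  exists2 d, 0 < d & forall u v, `|u| < d -> `|v| < d ->
  `|P (x + u) (y + v) - P x y - a * u - b * v| <= e * (`|u| + `|v|) /\
  `|Q (x + u) (y + v) - Q x y - b * u - c * v| <= e * (`|u| + `|v|).

Lemma continuous_of_linear_approx (F : R -> R) a x :
  (exists2 d, 0 < d & forall u, `|u| < d -> `|F (x + u) - F x - a * u| <= `|u|) ->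
  {for x, continuous F}.
Proof.
move=> [d d0 H]; apply/cvgrPdist_lt => e e0.
pose k := 2 + `|a|; have k0 : 0 < k by rewrite ltr_wpDr.
near=> t; have := H (t - x); rewrite [x + (t - x)]addrC subrK => Ht.
have td : `|t - x| < d by rewrite distrC; near: t; exact: cvgr_dist_lt.
have te : `|t - x| < e / k.
  by rewrite distrC; near: t; apply: cvgr_dist_lt => //; rewrite divr_gt0.
have := Ht td => H1; rewrite distrC.
have : `|F t - F x| <= `|F t - F x - a * (t - x)| + `|a| * `|t - x|.
  by rewrite -normrM (le_trans _ (ler_normD _ _))// subrK.
have : `|t - x| * k < e by rewrite -ltr_pdivlMr.
rewrite /k; have := normr_ge0 (t - x); nra.
Unshelve. all: by end_near. Qed.

Lemma closed_continuous :
  [/\ forall y, continuous (fun x => P x y), forall y, continuous (fun x => Q x y),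
      forall x, continuous (P x) & forall x, continuous (Q x)].
Proof.
have H x y : exists a b c, exists2 d, 0 < d & forall u v, `|u| < d -> `|v| < d ->
  `|P (x + u) (y + v) - P x y - a * u - b * v| <= (`|u| + `|v|) /\
  `|Q (x + u) (y + v) - Q x y - b * u - c * v| <= (`|u| + `|v|).
  have [a [b [c /(_ _ ltr01)[d d0 abc]]]] := closed x y.
  by exists a, b, c, d => // u v ud vd; have := abc u v ud vd; rewrite mul1r.
split.
- move=> y x; have [a [b [c [d d0 h]]]] := H x y.
  apply: (@continuous_of_linear_approx _ a); exists d => // u ud.
  by have [] := h u 0 ud; rewrite ?normr0// !addr0 mulr0 subr0.
- move=> y x; have [a [b [c [d d0 h]]]] := H x y.
  apply: (@continuous_of_linear_approx _ b); exists d => // u ud.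
  by have [] := h u 0 ud; rewrite ?normr0// !addr0 !mulr0 !subr0.
- move=> x y; have [a [b [c [d d0 h]]]] := H x y.
  apply: (@continuous_of_linear_approx _ b); exists d => // u ud.
  by have [] := h 0 u _ ud; rewrite ?normr0// !addr0 !add0r !mulr0 !subr0.
- move=> x y; have [a [b [c [d d0 h]]]] := H x y.
  apply: (@continuous_of_linear_approx _ c); exists d => // u ud.
  by have [] := h 0 u _ ud; rewrite ?normr0// !addr0 !add0r !mulr0 !subr0.
Qed.

(** The integral of [P dx + Q dy] counterclockwise around the rectangle, with opposite sides paired
    in one integral each. *)
Definition circulation x y w h :=
  \int[mu]_(t in `[x, x + w]) (P t y - P t (y + h)) +
  \int[mu]_(t in `[y, y + h]) (Q (x + w) t - Q x t).

Let cP y h : continuous (fun t => P t y - P t (y + h)).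
Proof. by move=> t; apply: cvgB; have [H _ _ _] := closed_continuous; exact: H. Qed.

Let cQ x w : continuous (fun t => Q (x + w) t - Q x t).
Proof. by move=> t; apply: cvgB; have [_ _ _ H] := closed_continuous; exact: H. Qed.

Let splitx (F : R -> R) x w : continuous F -> 0 <= w ->
  \int[mu]_(t in `[x, x + (w + w)]) F t =
  \int[mu]_(t in `[x, x + w]) F t + \int[mu]_(t in `[x + w, x + w + w]) F t.
Proof.
by move=> cF w0; rewrite addrA (@Rintegral_split _ x (x + w))// lerDl.
Qed.

Let fB (F G : R -> R) x w : continuous F -> continuous G ->
  \int[mu]_(t in `[x, w]) (F t - G t) =
  \int[mu]_(t in `[x, w]) F t - \int[mu]_(t in `[x, w]) G t.
Proof. by move=> cF cG; rewrite RintegralB//; exact: continuous_integrable_itv. Qed.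

(** The inner sides of the four quarters are run through in both directions and cancel. *)
Lemma circulation_quarter x y w h : 0 <= w -> 0 <= h ->
  circulation x y (w + w) (h + h) =
  circulation x y w h + circulation (x + w) y w h +
  (circulation x (y + h) w h + circulation (x + w) (y + h) w h).
Proof.
have [cPx cQx cPy cQy] := closed_continuous.
move=> w0 h0; rewrite /circulation !splitx// !fB// !addrA; ring.
Qed.

(** The affine part of the form at [(X, Y)] has no circulation: the horizontal sides contribute
    [- b h w] and the vertical ones [b w h], with the same [b] by symmetry of the Jacobian. What is
    left is an error of at most [e (w + h)] along a perimeter [2 (w + h)]. *)
Lemma circulation_small e : 0 < e -> forall X Y, exists2 d, 0 < d &
  forall x y w h, 0 <= w < d -> 0 <= h < d -> x <= X <= x + w -> y <= Y <= y + h ->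
  `|circulation x y w h| <= 2 * e * (w + h) ^+ 2.
Proof.
move=> e0 X Y; have [a [b [c /(_ _ e0)[d d0 abc]]]] := closed X Y.
exists d => // x y w h /andP[w0 wd] /andP[h0 hd] /andP[xX Xx] /andP[yY Yy].
have B u v : x <= u <= x + w -> y <= v <= y + h ->
    `|P u v - P X Y - a * (u - X) - b * (v - Y)| <= e * (w + h) /\
    `|Q u v - Q X Y - b * (u - X) - c * (v - Y)| <= e * (w + h).
  move=> /andP[xu ux] /andP[yv vy].
  have uX : `|u - X| <= w by rewrite ler_norml; lra.
  have vY : `|v - Y| <= h by rewrite ler_norml; lra.
  have := abc (u - X) (v - Y) (le_lt_trans uX wd) (le_lt_trans vY hd).
  rewrite ![_ + (_ - _)]addrC !subrK => -[h1 h2].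
  have UV : e * (`|u - X| + `|v - Y|) <= e * (w + h).
    by rewrite ler_pM2l// lerD.
  by split; [exact: le_trans h1 _|exact: le_trans h2 _].
have ww : x <= x + w by rewrite lerDl.
have hh : y <= y + h by rewrite lerDl.
rewrite (_ : circulation x y w h =
    \int[mu]_(t in `[x, x + w]) (P t y - P t (y + h) - (- (b * h))) +
    \int[mu]_(t in `[y, y + h]) (Q (x + w) t - Q x t - b * w)); last first.
  rewrite [X in _ = X + _]fB//; last by move=> t; exact: cvg_cst.
  rewrite [X in _ = _ + X]fB//; last by move=> t; exact: cvg_cst.
  by rewrite !Rintegral_cstr// /circulation; ring.
apply: le_trans (ler_normD _ _) _.
have -> : 2 * e * (w + h) ^+ 2 = (2 * (e * (w + h))) * (x + w - x) + (2 * (e * (w + h))) * (y + h - y).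
  by ring.
apply: lerD; apply: Rintegral_bound => //.
- by move=> t; apply: cvgB; [exact: cP|exact: cvg_cst].
- move=> t tx; have [B1 _] := B t y tx (ltac:(lra)).
  have [B2 _] := B t (y + h) tx (ltac:(lra)).
  by move: B1 B2; rewrite !ler_norml; lra.
- by move=> t; apply: cvgB; [exact: cQ|exact: cvg_cst].
- move=> t ty; have [_ B1] := B x t (ltac:(lra)) ty.
  have [_ B2] := B (x + w) t (ltac:(lra)) ty.
  by move: B1 B2; rewrite !ler_norml; lra.
Qed.

Lemma circulation_eq0 x y w h : 0 <= w -> 0 <= h -> circulation x y w h = 0.
Proof.
move=> w0 h0; apply/eqP/negPn/negP => D0.
set D := `|circulation x y w h|; have {}D0 : 0 < D by rewrite normr_gt0.
(* A rectangle of stage [n] is bad when it retains at least [4^-n] of the original circulation; one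
   of its quarters is then bad again. *)
pose Bad n x' y' := D <= 4 ^+ n * `|circulation x' y' (w / 2 ^+ n) (h / 2 ^+ n)|.
have half (v : R) n : v / 2 ^+ n = v / 2 ^+ n.+1 + v / 2 ^+ n.+1.
  by rewrite exprS; have t0 : 2 ^+ n != 0 :> R; [rewrite expf_neq0|field].
have pos (v : R) n : 0 <= v -> 0 <= v / 2 ^+ n.
  by move=> v0; rewrite divr_ge0// exprn_ge0.
have [||X [Y XY]] := @nested_rectangles w h Bad x y _ _ w0 h0.
- by rewrite /Bad !expr0 mul1r !divr1.
- move=> n x' y'; rewrite /Bad (half w n) (half h n) circulation_quarter ?pos//.
  set u := w / _; set v := h / _ => Dn.
  have u0 : 0 <= u by exact: pos.
  have v0 : 0 <= v by exact: pos.
  apply: contrapT => /forallNP H.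
  have {}H a b : x' <= a /\ a + u <= x' + (u + u) -> y' <= b /\ b + v <= y' + (v + v) ->
      4 * (4 ^+ n * `|circulation a b u v|) < D.
    move=> ha hb; rewrite ltNge; apply/negP => Dab.
    by apply: (H a); exists b; split => //; rewrite exprS -mulrA.
  have := H x' y' (ltac:(lra)) (ltac:(lra)).
  have := H (x' + u) y' (ltac:(lra)) (ltac:(lra)).
  have := H x' (y' + v) (ltac:(lra)) (ltac:(lra)).
  have := H (x' + u) (y' + v) (ltac:(lra)) (ltac:(lra)).
  move: Dn; set p := 4 ^+ n; have p0 : 0 <= p by rewrite exprn_ge0.
  set c1 := circulation _ _ _ _; set c2 := circulation _ _ _ _.
  set c3 := circulation _ _ _ _; set c4 := circulation _ _ _ _ => Dn.
  have : `|c1 + c2 + (c3 + c4)| <= `|c1| + `|c2| + (`|c3| + `|c4|).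
    by rewrite (le_trans (ler_normD _ _))// lerD// ler_normD.
  by move=> /(ler_wpM2l p0); lra.
(* With this [e] the bound [2 e (w + h)^2] of [circulation_small], scaled back by [4^n], is below
   [D]. *)
pose e := D / (4 * ((w + h) ^+ 2 + 1)).
have k0 : 0 < (w + h) ^+ 2 + 1 by rewrite ltr_wpDl// sqr_ge0.
have e0 : 0 < e by rewrite divr_gt0// mulr_gt0.
have [d d0 small] := circulation_small e0 X Y.
have [n nd] : exists n, w / 2 ^+ n < d /\ h / 2 ^+ n < d.
  pose m := Num.truncn ((w + h) / d); exists m.
  have mm : (w + h) / d < 2 ^+ m.
    apply: lt_le_trans (truncnS_gt _) _.
    by rewrite -natrX ler_nat; exact: ltn_expl.
  have : w + h < d * 2 ^+ m by rewrite mulrC -ltr_pdivrMr.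
  by rewrite !ltr_pdivrMr ?exprn_gt0//; lra.
have [x' [y' [Dn Xx Yy]]] := XY n.
have := small x' y' (w / 2 ^+ n) (h / 2 ^+ n).
rewrite !pos ?nd.1 ?nd.2//= => /(_ isT isT Xx Yy).
rewrite -mulrDl exprMn => S.
have : D <= 4 ^+ n * (2 * e * ((w + h) ^+ 2 * (2 ^+ n)^-1 ^+ 2)).
  by apply: le_trans Dn _; rewrite ler_wpM2l// exprn_ge0.
rewrite (_ : _ * _ = 2 * e * (w + h) ^+ 2); last first.
  rewrite (_ : 4 = 2 ^+ 2 :> R); last by rewrite -natrX.
  rewrite exprAC; set t := 2 ^+ n; have t0 : t != 0 by rewrite expf_neq0.
  by field.
have : e * (4 * ((w + h) ^+ 2 + 1)) = D by rewrite /e divfK// gt_eqF// mulr_gt0.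
by nra.
Qed.

End closed_form.

End goursat.

(** * Complex differentiability and the exponential *)

Section complex_diff.
Variable R : realType.
Local Notation C := (Cplx R).
Implicit Types (f g : C -> C) (z h d : C).

Lemma normC_def (z : C) : `|z| = (normc z)%:C :> C.
Proof. by []. Qed.

(** The complex derivative in epsilon form with the real-valued modulus, so that estimates stay in
    [R] and the point [h = 0] is included. *)
Definition cdiff f z d := forall e : R, 0 < e -> exists2 r : R, 0 < r &
  forall h, normc h < r -> normc (f (z + h) - f z - d * h) <= e * normc h.

Lemma cdiff_derivable f z d : cdiff f z d -> derivable f z 1.
Proof.
move=> fd; apply/cvg_ex; exists d; apply/cvgrPdist_le => e e0.
have [r re r0] : exists2 r : R, e = r%:C & 0 < r.
  by move: e e0 => [er ei]; rewrite ltcE /= => /andP[/eqP -> ?]; exists er.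
have [s s0 H] := fd r r0.
apply/nbhs_normP; exists s%:C => /=; first by rewrite ltcR.
move=> h /=; rewrite sub0r normrN normC_def ltcR => hs h0.
have {}H := H h hs.
have nh0 : 0 < normc h by rewrite lt_def normc_ge0 andbT; apply: contra h0 => /eqP/eq0_normc ->.
rewrite re distrC normC_def lecR /=.
rewrite (_ : _ - d = h^-1 * (f (z + h) - f z - d * h)); last first.
  rewrite /GRing.scale/= mulr1 [h + z]addrC [RHS]mulrBr; congr (_ - _).
  by rewrite mulrCA mulVf// mulr1.
by rewrite normcM normcV mulrC ler_pdivrMr.
Qed.

Lemma derivable_cdiff f z : derivable f z 1 -> exists d, cdiff f z d.
Proof.
move=> /cvg_ex[d /cvgrPdist_le H]; exists d => e e0.
have /H/nbhs_normP[s /= s0 {}H] : 0 < e%:C :> C by rewrite ltcR.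
have [r sr r0] : exists2 r : R, s = r%:C & 0 < r.
  by move: s s0 {H} => [er ei]; rewrite ltcE /= => /andP[/eqP -> ?]; exists er.
exists r => // h hr.
have [->|h0] := eqVneq h 0.
  by rewrite addr0 subrr mulr0 subr0 normc0 mulr0.
have := H h; rewrite /= sub0r normrN sr normC_def ltcR => /(_ hr h0).
rewrite /GRing.scale/= mulr1 [h + z]addrC distrC => {}H.
have : `|f (z + h) - f z - d * h| <= e%:C * `|h|.
  rewrite (_ : _ - _ = (h^-1 * (f (z + h) - f z) - d) * h); last by field.
  by rewrite normrM ler_wpM2r.
by rewrite !normC_def -rmorphM lecR.
Qed.

Lemma entire_cdiff f : entire f <-> forall z, exists d, cdiff f z d.
Proof.
split=> [H z|H z]; first exact/derivable_cdiff/H.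
by have [d] := H z; exact: cdiff_derivable.
Qed.

Lemma entire_differentiable f : entire f <-> forall z, differentiable f z.
Proof. by split=> H z; apply/derivable1_diffP; exact: H. Qed.

Lemma entireM f g : entire f -> entire g -> entire (fun z => f z * g z).
Proof. by move=> ef eg z; apply: derivableM; [exact: ef|exact: eg]. Qed.

Lemma entireD f g : entire f -> entire g -> entire (fun z => f z + g z).
Proof. by move=> ef eg z; apply: derivableD; [exact: ef|exact: eg]. Qed.

Lemma entire_cst (c : C) : entire (fun=> c).
Proof. by move=> z; exact: derivable_cst. Qed.

Lemma entire_id : entire (fun z => z).
Proof. by move=> z; exact: derivable_id. Qed.

Lemma entire_comp f g : entire f -> entire g -> entire (fun z => f (g z)).
Proof.
move=> /entire_differentiable df /entire_differentiable dg.
apply/entire_differentiable => z.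
exact: differentiable_comp.
Qed.

Lemma entire_cts f : entire f -> forall z (e : R), 0 < e ->
  exists2 r : R, 0 < r & forall w, normc (w - z) < r -> normc (f w - f z) < e.
Proof.
move=> /entire_cdiff ef z e e0; have [d fd] := ef z.
have [r r0 H] := fd 1 ltr01.
pose k := 2 + normc d; have k0 : 0 < k by rewrite ltr_wpDr ?normc_ge0.
exists (Num.min r (e / k)); first by rewrite lt_min r0 divr_gt0.
move=> w; rewrite lt_min => /andP[wr].
have := H _ wr; rewrite [z + _]addrC subrK mul1r => {}H.
rewrite ltr_pdivlMr// /k => we.
have : normc (f w - f z) <= normc (f w - f z - d * (w - z)) + normc d * normc (w - z).
  have := le_normcD (f w - f z - d * (w - z)) (d * (w - z)).
  by rewrite subrK normcM.
have := normc_ge0 (w - z); nra.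
Qed.

Lemma entire_measurable f : entire f ->
  measurable_fun setT (f : CplxB R -> CplxB R).
Proof.
move=> ef; apply: measurable_cplxP; apply: measurable_fun_of_continuous => z e e0;
  have [r r0 H] := entire_cts ef z e0; exists r => // w /H;
  apply: le_lt_trans; rewrite -raddfB; [exact: normc_Re_le|exact: normc_Im_le].
Qed.

Lemma expCD (u v : C) : expC (u + v) = expC u * expC v.
Proof.
case: u v => [a b] [c d]; rewrite /expC/= expRD cosD sinD.
by congr (_ +i* _); ring.
Qed.

Lemma normc_expC (u : C) : normc (expC u) = expR (complex.Re u).
Proof.
rewrite -[RHS]ger0_norm ?expR_ge0// -sqrtr_sqr /expC/=; congr Num.sqrt.
by rewrite !exprMn -mulrDr cos2Dsin2 mulr1.
Qed.

End complex_diff.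

(** * Taylor bounds for the exponential and means over circles *)

Section mean_value.
Variable R : realType.
Local Notation C := (Cplx R).
Local Notation mu := (@lebesgue_measure R).

Lemma MVT0 (f df : R -> R) (y : R) : (forall x : R, is_derive x 1 f (df x)) ->
  exists2 c, `|c| <= `|y| & f y - f 0 = df c * y.
Proof.
move=> fd; have cf a b : {within `[a, b], continuous f}.
  apply: continuous_subspaceT => x; apply: differentiable_continuous.
  by apply/derivable1_diffP; apply: ex_derive.
have [y0|y0] := leP 0 y.
  have [c] := MVT_segment y0 (fun x _ => fd x) (cf _ _).
  rewrite in_itv/= => /andP[c0 cy] E; exists c; last by rewrite E subr0.
  by rewrite !ger0_norm.
have [c] := MVT_segment (ltW y0) (fun x _ => fd x) (cf _ _).
rewrite in_itv/= => /andP[c0 cy] E; exists c.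
  by have y0' := ltW y0; rewrite !ler0_norm// lerN2.
by rewrite -opprB E sub0r mulrN opprK.
Qed.

Lemma sin_norm_le (y : R) : `|sin y| <= `|y|.
Proof.
have [c _] := MVT0 y (@is_derive_sin R); rewrite sin0 subr0 => ->.
by rewrite normrM ler_piMl// cos_max.
Qed.

Lemma cosB1_norm_le (y : R) : `|cos y - 1| <= y ^+ 2.
Proof.
have [c cy] := MVT0 y (@is_derive_cos R); rewrite cos0 => ->.
rewrite normrM normrN -[y ^+ 2]real_normK ?num_real// expr2 ler_wpM2r//.
exact: le_trans (sin_norm_le _) cy.
Qed.

Lemma sinB_norm_le (y : R) : `|sin y - y| <= `|y| ^+ 2.
Proof.
have [c cy] := MVT0 y (@is_derive_sin R); rewrite sin0 subr0 => ->.
rewrite -[X in _ - X]mul1r -mulrBl normrM expr2 ler_wpM2r//.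
have [b bc] := MVT0 c (@is_derive_cos R); rewrite cos0 => ->.
by rewrite normrM normrN (le_trans _ cy)// ler_piMl// sin_max.
Qed.

Lemma expRB1_norm_le (x : R) : `|expR x - 1| <= `|x| * expR `|x|.
Proof.
have h1 := expR_ge1Dx x; have h2 := expR_ge1Dx (- x); have e0 := expR_gt0 x.
have e1 : expR (- x) * expR x = 1 by rewrite -expRD addNr expR0.
have h3 : (1 - x) * expR x <= 1 by rewrite -[leRHS]e1 ler_wpM2r// ltW.
have [x0|x0] := leP 0 x.
  have l1 : 0 <= expR x - 1 by lra.
  by rewrite (ger0_norm l1) (ger0_norm x0); lra.
have l1 : expR x - 1 < 0 by rewrite subr_lt0 expR_lt1.
rewrite (ltr0_norm l1) (ltr0_norm x0); nra.
Qed.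

Lemma expRB1B_norm_le (x : R) : `|expR x - 1 - x| <= x ^+ 2 * expR `|x|.
Proof.
have h1 := expR_ge1Dx x; have e0 := expR_gt0 x.
have e1 : expR (- x) * expR x = 1 by rewrite -expRD addNr expR0.
have h3 : (1 - x) * expR x <= 1 by rewrite -[leRHS]e1; apply: ler_wpM2r; [exact: ltW|exact: expR_ge1Dx].
rewrite ger0_norm; last by lra.
apply: (@le_trans _ _ (`|x| * `|expR x - 1|)).
  have : x * (expR x - 1) <= `|x| * `|expR x - 1| by rewrite -normrM ler_norm.
  lra.
rewrite -[x ^+ 2]real_normK ?num_real// expr2 -mulrA ler_wpM2l//.
exact: expRB1_norm_le.
Qed.

(** The arithmetic behind [expC_taylor1] at [u = x + iy]: [a], [b] stand for [|x|], [|y|]; [e1],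
    [e2], [e3] for the exponentials of [x], [|x|], [|u|]; [A], [B], [D], [E] for the remainders
    [e^x - 1], [e^x - 1 - x], [sin y - y], [cos y - 1]. The mixed term [a b] is split by AM-GM. *)
Lemma taylor1_arith (e1 e2 e3 a b A B D E : R) :
  0 < e1 -> 0 < e2 -> e1 <= e3 -> e2 <= e3 -> 0 <= a -> 0 <= b ->
  A <= a * e2 -> B <= a ^+ 2 * e2 -> D <= b ^+ 2 -> E <= b ^+ 2 ->
  e1 * E + e1 * D + (B + b * A) <= 3 * (a ^+ 2 + b ^+ 2) * e3.
Proof.
move=> e10 e20 ex ex' a0 b0 HA HB HD HE.
have a2 : 0 <= a ^+ 2 by rewrite exprn_ge0.
have b2 : 0 <= b ^+ 2 by rewrite exprn_ge0.
have t1 : e1 * E <= e3 * b ^+ 2.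
  apply: (@le_trans _ _ (e1 * b ^+ 2)); first by rewrite ler_pM2l.
  exact: ler_wpM2r.
have t2 : e1 * D <= e3 * b ^+ 2.
  apply: (@le_trans _ _ (e1 * b ^+ 2)); first by rewrite ler_pM2l.
  exact: ler_wpM2r.
have t3 : B <= a ^+ 2 * e3 by apply: le_trans HB _; exact: ler_wpM2l.
have t4 : b * A <= (a * b) * e3.
  apply: (@le_trans _ _ (b * (a * e2))); first exact: ler_wpM2l.
  by rewrite mulrA [b * a]mulrC; apply: ler_wpM2l => //; exact: mulr_ge0.
have t5 : (a * b) * e3 <= ((a ^+ 2 + b ^+ 2) / 2) * e3.
  by apply: ler_wpM2r; [lra|have := sqr_ge0 (a - b); lra].
have t6 : 0 <= e3 * a ^+ 2 by apply: mulr_ge0 => //; lra.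
have t7 : 0 <= e3 * b ^+ 2 by apply: mulr_ge0 => //; lra.
lra.
Qed.

(** With [u = x + iy] the remainder is [e^x (e^{iy} - 1 - iy) + (e^x - 1 - x) + iy (e^x - 1)], three
    terms of second order. The bound holds for all [u], which makes it usable under an integral
    sign. *)
Lemma expC_taylor1 (u : C) :
  normc (expC u - 1 - u) <= 3 * normc u ^+ 2 * expR (normc u).
Proof.
case: u => x y; set n := normc (x +i* y).
rewrite [X in normc X](_ : _ =
  (expR x * (cos y - 1)) +i* (expR x * (sin y - y)) +
  ((expR x - 1 - x) +i* (y * (expR x - 1)))); last first.
  by apply/eqP; rewrite eq_complex/=; apply/andP; split; apply/eqP; ring.
apply: le_trans (le_normcD _ _) _.
apply: le_trans (lerD (normc_le_ReIm _) (normc_le_ReIm _)) _ => /=.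
have -> : normc (x +i* y) ^+ 2 = `|x| ^+ 2 + `|y| ^+ 2.
  by rewrite normc_sqr/= !real_normK ?num_real.
have xn : `|x| <= n by exact: (normc_Re_le (x +i* y)).
rewrite !normrM (ger0_norm (expR_ge0 _)).
apply: taylor1_arith (expRB1_norm_le x) _ (sinB_norm_le y) _ => //; rewrite ?expR_gt0//.
- by rewrite ler_expR (le_trans (ler_norm _)).
- by rewrite ler_expR.
- by rewrite real_normK ?num_real// expRB1B_norm_le.
- by rewrite real_normK ?num_real// cosB1_norm_le.
Qed.

Lemma cdiff_expC (z : C) : cdiff (@expC R) z (expC z).
Proof.
move=> e e0; pose k := expR (complex.Re z) * 3 * expR 1.
have k0 : 0 < k by rewrite !mulr_gt0 ?expR_gt0.
exists (Num.min 1 (e / k)); first by rewrite lt_min ltr01 divr_gt0.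
move=> h; rewrite lt_min => /andP[h1]; rewrite ltr_pdivlMr// => hk.
rewrite (_ : _ - _ = expC z * (expC h - 1 - h)); last by rewrite expCD; ring.
rewrite normcM normc_expC.
apply: (@le_trans _ _ (expR (complex.Re z) * (3 * normc h ^+ 2 * expR 1))).
  rewrite ler_pM2l ?expR_gt0//; apply: le_trans (expC_taylor1 _) _.
  by apply: ler_wpM2l; [rewrite mulr_ge0// sqr_ge0|rewrite ler_expR ltW].
have -> : expR (complex.Re z) * (3 * normc h ^+ 2 * expR 1) = (normc h * k) * normc h.
  by rewrite /k; ring.
by rewrite ler_wpM2r ?normc_ge0 1?ltW.
Qed.

Lemma entire_expC : entire (@expC R).
Proof. by apply/entire_cdiff => z; exists (expC z); exact: cdiff_expC. Qed.

Definition expi (t : R) : C := cos t +i* sin t.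

Lemma expCE (x y : R) : expC (x +i* y : C) = (expR x)%:C * expi y.
Proof. by rewrite /expC/expi; apply/eqP; rewrite eq_complex/= !mul0r subr0 addr0 !eqxx. Qed.

Lemma normc_expi t : normc (expi t) = 1.
Proof. by rewrite /expi /= cos2Dsin2 sqrtr1. Qed.

Lemma expiD s t : expi (s + t) = expi s * expi t.
Proof. by rewrite /expi cosD sinD; congr (_ +i* _); ring. Qed.

Lemma normcR (x : R) : normc x%:C = `|x|.
Proof. by rewrite /= expr0n addr0 sqrtr_sqr. Qed.

(* With psi z = f (w e^z), the form Im psi dx + Re psi dy is closed and 2 pi-periodic in y, so its
   integral over [{x} x [0, 2 pi]] does not depend on x, and psi tends to f 0 as x tends to -oo. *)
Lemma circle_mean_value_Re (f : C -> C) (w : C) : entire f ->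
  \int[mu]_(t in `[0, 2 * pi]) complex.Re (f (w * expi t)) =
  2 * pi * complex.Re (f 0).
Proof.
move=> ef; pose psi z := f (w * expC z).
have epsi : entire psi.
  apply: (entire_comp ef (g := fun z => w * expC z)).
  by apply: entireM; [exact: entire_cst|exact: entire_expC].
pose P x y := complex.Im (psi (x +i* y)); pose Q x y := complex.Re (psi (x +i* y)).
have closed x y : exists a b c, forall e, 0 < e ->
  exists2 d, 0 < d & forall u v, `|u| < d -> `|v| < d ->
  `|P (x + u) (y + v) - P x y - a * u - b * v| <= e * (`|u| + `|v|) /\
  `|Q (x + u) (y + v) - Q x y - b * u - c * v| <= e * (`|u| + `|v|).
  have /entire_cdiff /(_ (x +i* y))[[d1 d2] H] := epsi.
  (* Cauchy-Riemann: for [h = u + iv] the linear part has [Im = d2 u + d1 v] and [Re = d1 u - d2 v],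
     so the cross coefficients agree. *)
  exists d2, d1, (- d2) => e e0; have [r r0 {}H] := H e e0.
  exists (r / 2); first by rewrite divr_gt0.
  move=> u v ur vr; have uv := normc_le_ReIm (u +i* v).
  have /H : normc (u +i* v) < r by apply: le_lt_trans uv _; rewrite /=; lra.
  set D := psi _ - _ - _ => HD.
  have {}HD : normc D <= e * (`|u| + `|v|) by rewrite (le_trans HD)// ler_pM2l.
  split; [apply: le_trans (le_trans (normc_Im_le D) HD)|
          apply: le_trans (le_trans (normc_Re_le D) HD)].
    rewrite /D !raddfB/= /P le_eqVlt; apply/orP; left; apply/eqP; congr `|_|; ring.
  rewrite /D !raddfB/= /Q le_eqVlt; apply/orP; left; apply/eqP; congr `|_|; ring.
have [cPx cQx cPy cQy] := closed_continuous closed.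
have per x : P x 0 = P x (2 * pi).
  by rewrite /P /psi !expCE /expi [2 * pi]mulr_natl sin2pi cos2pi cos0 sin0.
have M x : x <= 0 -> \int[mu]_(t in `[0, 2 * pi]) Q 0 t = \int[mu]_(t in `[0, 2 * pi]) Q x t.
  move=> x0; have pi0 : 0 <= 2 * pi :> R by rewrite mulr_ge0// pi_ge0.
  have x0' : 0 <= - x by rewrite oppr_ge0.
  have := circulation_eq0 closed x 0 x0' pi0.
  rewrite /circulation addrN [X in X + _](_ : _ = 0) ?add0r; last first.
    rewrite (_ : (fun t => _) = cst 0) ?Rintegral_cst ?mul0r//.
    by apply/funext => t /=; rewrite ?add0r -per subrr.
  by rewrite RintegralB//; [move/subr0_eq|exact: continuous_integrable_itv..].
have -> : (fun t => complex.Re (f (w * expi t))) = Q 0.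
  by apply/funext => t; rewrite /Q /psi expCE expR0 mul1r.
apply/eqP/negPn/negP => ne.
pose e : R := `|\int[mu]_(t in `[0, 2 * pi]) Q 0 t - 2 * pi * complex.Re (f 0)|.
have e0 : 0 < e by rewrite normr_gt0 subr_eq0.
have pi2 : 0 < 2 * pi :> R by rewrite mulr_gt0// pi_gt0.
(* This tolerance over an interval of length [2 pi] amounts to [e / 2], whence the contradiction
   [e <= e / 2]. *)
have [r r0 H] := entire_cts ef 0 (e := e / (2 * (2 * pi))) (ltac:(by rewrite divr_gt0// mulr_gt0)).
(* Far enough to the left that [|w| e^x < r], because [e^{|w|/r} > |w|/r]. *)
pose x := - ((normc w) / r).
have x0 : x <= 0 by rewrite oppr_le0 divr_ge0 ?normc_ge0// ltW.
have wx : normc w * expR x < r.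
  rewrite /x expRN ltr_pdivrMr ?expR_gt0//.
  have wq : normc w = r * (normc w / r) by rewrite mulrC divfK// gt_eqF.
  rewrite [X in X < _]wq ltr_pM2l//.
  by rewrite (lt_le_trans _ (expR_ge1Dx _))// ltrDr.
have : e <= e / (2 * (2 * pi)) * (2 * pi - 0).
  apply: (@le_trans _ _ `|\int[mu]_(t in `[0, 2 * pi]) Q x t - 2 * pi * complex.Re (f 0)|).
    by rewrite /e (M x x0).
  have -> : \int[mu]_(t in `[0, 2 * pi]) Q x t - 2 * pi * complex.Re (f 0) =
     \int[mu]_(t in `[0, 2 * pi]) (Q x t - complex.Re (f 0)).
    rewrite RintegralB//; [|exact: continuous_integrable_itv|].
      by rewrite (Rintegral_cstr _ (ltW pi2)) subr0 [complex.Re _ * _]mulrC.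
    by apply: continuous_integrable_itv => t; exact: cvg_cst.
  apply: Rintegral_bound.
  - by move=> t; apply: cvgB; [exact: cQy|exact: cvg_cst].
  - exact: ltW.
  - move=> t _; rewrite /Q -raddfB; apply: le_trans (normc_Re_le _) _.
    apply: ltW; apply: H; rewrite subr0 expCE !normcM normc_expi mulr1 normcR.
    by rewrite ger0_norm ?expR_ge0.
have fld (p : R) : p != 0 -> e / (2 * p) * p = e / 2 by move=> ?; field.
rewrite subr0 fld ?gt_eqF//.
lra.
Qed.

End mean_value.

(** * Measurability of complex-valued functions *)

Section measurability.
Variable R : realType.
Local Notation C := (Cplx R).
Context d (T : measurableType d).
Implicit Types f g : T -> CplxB R.

Lemma measurable_cplxRe f : measurable_fun setT f ->
  measurable_fun setT (fun t => complex.Re (f t)).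
Proof. exact: measurableT_comp (@measurable_Re R). Qed.

Lemma measurable_cplxIm f : measurable_fun setT f ->
  measurable_fun setT (fun t => complex.Im (f t)).
Proof. exact: measurableT_comp (@measurable_Im R). Qed.

Lemma measurable_cplxnormc f : measurable_fun setT f ->
  measurable_fun setT (fun t => normc (f t)).
Proof. exact: measurableT_comp (@measurable_normc R). Qed.

Lemma measurable_cplxD f g : measurable_fun setT f -> measurable_fun setT g ->
  measurable_fun setT (fun t => f t + g t : CplxB R).
Proof.
move=> mf mg; apply: measurable_cplxP.
  under eq_fun do rewrite raddfD.
  exact: measurable_funD (measurable_cplxRe mf) (measurable_cplxRe mg).
under eq_fun do rewrite raddfD.
exact: measurable_funD (measurable_cplxIm mf) (measurable_cplxIm mg).
Qed.

Lemma complexReM (x y : R[i]) :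
  complex.Re (x * y) = complex.Re x * complex.Re y - complex.Im x * complex.Im y.
Proof. by case: x y => [? ?] []. Qed.

Lemma complexImM (x y : R[i]) :
  complex.Im (x * y) = complex.Re x * complex.Im y + complex.Im x * complex.Re y.
Proof. by case: x y => [? ?] []. Qed.

Lemma measurable_cplxM f g : measurable_fun setT f -> measurable_fun setT g ->
  measurable_fun setT (fun t => f t * g t : CplxB R).
Proof.
move=> mf mg; apply: measurable_cplxP.
  under eq_fun do rewrite complexReM.
  by apply: measurable_funB; apply: measurable_funM;
    do ?[exact: measurable_cplxRe|exact: measurable_cplxIm].
under eq_fun do rewrite complexImM.
by apply: measurable_funD; apply: measurable_funM;
  do ?[exact: measurable_cplxRe|exact: measurable_cplxIm].
Qed.

Lemma measurable_cplxN f : measurable_fun setT f ->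
  measurable_fun setT (fun t => - f t : CplxB R).
Proof.
move=> mf; apply: measurable_cplxP; under eq_fun do rewrite raddfN.
  by apply: measurableT_comp => //; exact: measurable_cplxRe.
by apply: measurableT_comp => //; exact: measurable_cplxIm.
Qed.

Lemma measurable_cplxconj f : measurable_fun setT f ->
  measurable_fun setT (fun t => conjc (f t) : CplxB R).
Proof.
move=> mf; apply: measurable_cplxP.
  rewrite (_ : (fun _ => _) = (fun t => complex.Re (f t))); first exact: measurable_cplxRe.
  by apply/funext => t; case: (f t).
rewrite (_ : (fun _ => _) = (fun t => - complex.Im (f t))).
  by apply: measurableT_comp => //; exact: measurable_cplxIm.
by apply/funext => t; case: (f t).
Qed.

Lemma measurable_cplxR (u : T -> R) : measurable_fun setT u ->
  measurable_fun setT (fun t => (u t)%:C : CplxB R).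
Proof. by move=> mu; apply: measurable_cplxP. Qed.

Lemma measurable_entire_comp (F : C -> C) f : entire F -> measurable_fun setT f ->
  measurable_fun setT (fun t => F (f t) : CplxB R).
Proof. by move=> eF; exact: measurableT_comp (entire_measurable eF). Qed.

Lemma measurable_gauss_comp f : measurable_fun setT f ->
  measurable_fun setT (fun t => gauss (f t)).
Proof.
move=> mf; rewrite /gauss; apply: measurableT_comp => //; apply: measurable_funM => //.
apply: measurableT_comp => //; apply: measurable_funX.
exact: measurable_cplxnormc.
Qed.

End measurability.

Lemma normc_conj (R : realType) (z : R[i]) : normc (conjc z) = normc z.
Proof. by case: z => x y /=; rewrite sqrrN. Qed.

Lemma conj_mul (R : realType) (z : R[i]) : conjc z * z = (normc z ^+ 2)%:C.
Proof.
rewrite normc_sqr; case: z => x y; apply/eqP; rewrite eq_complex/=.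
by apply/andP; split; apply/eqP; ring.
Qed.

(** * Integrals of complex-valued functions *)

Section integralC.
Variable R : realType.
Local Notation C := (Cplx R).
Local Notation mfun f := (measurable_fun setT (f : CplxB R -> CplxB R)).
Variable mu : {measure set (CplxB R) -> \bar R}.
Implicit Types f g : C -> C.

Definition integrableC f :=
  mfun f /\ (\int[mu]_w (normc (f w))%:E < +oo)%E.

Lemma integrable_of_le (u : CplxB R -> R) (v : CplxB R -> R) :
  measurable_fun setT u -> measurable_fun setT v -> (forall w, `|u w| <= v w) ->
  (\int[mu]_w (v w)%:E < +oo)%E -> mu.-integrable setT (EFin \o u).
Proof.
move=> mu_ mv uv fin; apply/integrableP; split; first exact/measurable_EFinP.
apply: le_lt_trans fin; apply: ge0_le_integral => //.
- exact/measurable_EFinP/measurableT_comp.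
- exact/measurable_EFinP.
- by move=> x _; rewrite lee_fin.
Qed.

Lemma integrableC_Re f : integrableC f ->
  mu.-integrable setT (EFin \o (fun w => complex.Re (f w))).
Proof.
move=> [mf fin]; apply: (integrable_of_le _ _ _ fin); first exact: measurable_cplxRe.
  exact: measurable_cplxnormc.
by move=> w; exact: normc_Re_le.
Qed.

Lemma integrableC_Im f : integrableC f ->
  mu.-integrable setT (EFin \o (fun w => complex.Im (f w))).
Proof.
move=> [mf fin]; apply: (integrable_of_le _ _ _ fin); first exact: measurable_cplxIm.
  exact: measurable_cplxnormc.
by move=> w; exact: normc_Im_le.
Qed.

Lemma integrableCZ c f : integrableC f -> integrableC (fun w => c * f w).
Proof.
move=> [mf fin]; split; first by apply: measurable_cplxM.
under eq_integral do rewrite normcM EFinM.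
rewrite ge0_integralZl//.
- rewrite lte_mul_pinfty// ?lee_fin ?normc_ge0//.
- by apply/measurable_EFinP; exact: measurable_cplxnormc.
- by move=> w _; rewrite lee_fin normc_ge0.
- by rewrite lee_fin normc_ge0.
Qed.

Lemma integrable_scale (a : R) (u : CplxB R -> R) :
  mu.-integrable setT (EFin \o u) -> mu.-integrable setT (EFin \o (fun w => a * u w)).
Proof.
by move=> Iu; apply: eq_integrable (integrableZl measurableT a Iu).
Qed.

Lemma integralCZ c f : integrableC f ->
  c * integralC mu f = integralC mu (fun w => c * f w).
Proof.
move=> If; have IR := integrableC_Re If; have II := integrableC_Im If.
rewrite /integralC; apply/eqP; rewrite eq_complex/=; case: c => a b /=.
apply/andP; split; apply/eqP.
  under [RHS]eq_Rintegral do rewrite complexReM/=.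
  rewrite RintegralB//; [|exact: integrable_scale..].
  by rewrite !RintegralZl.
under [RHS]eq_Rintegral do rewrite complexImM/=.
rewrite RintegralD//; [|exact: integrable_scale..].
by rewrite !RintegralZl.
Qed.

Lemma integrableCD f g : integrableC f -> integrableC g ->
  integrableC (fun w => f w + g w).
Proof.
move=> [mf If] [mg Ig]; split; first exact: measurable_cplxD.
apply: (@le_lt_trans _ _ (\int[mu]_w ((normc (f w))%:E + (normc (g w))%:E))%E).
  apply: ge0_le_integral => //.
  - by move=> x _; rewrite lee_fin normc_ge0.
  - by apply/measurable_EFinP/measurable_cplxnormc; exact: measurable_cplxD.
  - by apply: emeasurable_funD; apply/measurable_EFinP/measurable_cplxnormc.
  - by move=> x _; rewrite -EFinD lee_fin le_normcD.
rewrite ge0_integralD//; first exact: lte_add_pinfty.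
- by move=> x _; rewrite lee_fin normc_ge0.
- by apply/measurable_EFinP/measurable_cplxnormc.
- by move=> x _; rewrite lee_fin normc_ge0.
- by apply/measurable_EFinP/measurable_cplxnormc.
Qed.

Lemma integralCD f g : integrableC f -> integrableC g ->
  integralC mu (fun w => f w + g w) = integralC mu f + integralC mu g.
Proof.
move=> If Ig; rewrite /integralC; apply/eqP; rewrite eq_complex/=.
apply/andP; split; apply/eqP.
  under eq_Rintegral do rewrite raddfD.
  by rewrite RintegralD//; exact: integrableC_Re.
under eq_Rintegral do rewrite raddfD.
by rewrite RintegralD//; exact: integrableC_Im.
Qed.

(** A unimodular factor [c] turns the integral onto the positive real axis, where it equals the
    integral of [Re (c f)]. *)
Lemma normc_integralC_le f : mfun f ->
  ((normc (integralC mu f))%:E <= \int[mu]_w (normc (f w))%:E)%E.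
Proof.
move=> mf; have [fin|] := ltP (\int[mu]_w (normc (f w))%:E)%E +oo%E; last first.
  by rewrite leye_eq => /eqP ->; rewrite leey.
have If : integrableC f by [].
have [I IE] : exists I, I = integralC mu f by eexists.
rewrite -IE; have [->|I0] := eqVneq I 0.
  by rewrite normc0; apply: integral_ge0 => w _; rewrite lee_fin normc_ge0.
pose c : C := conjc I / (normc I)%:C.
have nI0 : normc I != 0 by apply: contra I0 => /eqP/eq0_normc ->.
have c1 : normc c = 1.
  rewrite normcM normcV normcR ger0_norm ?normc_ge0//.
  by rewrite normc_conj mulfV.
have cI : c * I = (normc I)%:C.
  rewrite /c mulrAC conj_mul expr2 rmorphM/= mulfK//.
  by apply: contra nI0 => /eqP/complexI ->.
have Icf := integrableCZ c If.
have -> : normc I = \int[mu]_w complex.Re (c * f w).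
  by have := integralCZ c If; rewrite -IE cI => /(congr1 (@complex.Re R)).
rewrite /Rintegral fineK; last by apply: integrable_fin_num => //; exact: integrableC_Re.
apply: le_integral => //.
- exact: integrableC_Re.
- apply: (@integrable_of_le _ (fun w => normc (f w))) => //.
  + exact: measurable_cplxnormc.
  + exact: measurable_cplxnormc.
  + by move=> w; rewrite ger0_norm ?normc_ge0.
move=> w _; rewrite lee_fin (le_trans (ler_norm _))// (le_trans (normc_Re_le _))//.
by rewrite normcM c1 mul1r.
Qed.

End integralC.

(** * The mean value property for the Gaussian measure *)

Section gaussian_mean.
Variable R : realType.
Local Notation C := (Cplx R).
Local Notation mfun f := (measurable_fun setT (f : CplxB R -> CplxB R)).

Lemma integral_invariance (T : CplxB R -> CplxB R) :
  (forall F : CplxB R -> \bar R, measurable_fun setT F -> (forall x, 0 <= F x)%E ->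
    (\int[dA]_z F (T z) = \int[dA]_z F z)%E) ->
  forall F : CplxB R -> \bar R, measurable_fun setT F ->
    (\int[dA]_z F (T z) = \int[dA]_z F z)%E.
Proof.
move=> inv F mF; rewrite integralE [RHS]integralE; congr (_ - _)%E.
  rewrite -(inv (F^\+)%E (measurable_funepos mF)); last by move=> x; exact: funepos_ge0.
  by apply: eq_integral => x _; rewrite !funeposE.
rewrite -(inv (F^\-)%E (measurable_funeneg mF)); last by move=> x; exact: funeneg_ge0.
by apply: eq_integral => x _; rewrite !funenegE.
Qed.

Lemma integral_dA_translation (c : C) (F : CplxB R -> \bar R) :
  measurable_fun setT F -> (\int[dA]_z F (c + z)%R = \int[dA]_z F z)%E.
Proof.
by apply: (@integral_invariance (fun z => c + z)) => G; exact: ge0_integral_dA_translation.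
Qed.

Lemma integral_dA_rotation (u : C) (F : CplxB R -> \bar R) : normc u = 1 ->
  measurable_fun setT F -> (\int[dA]_z F (u * z)%R = \int[dA]_z F z)%E.
Proof.
move=> u1; apply: (@integral_invariance (fun z => u * z)) => G.
exact: ge0_integral_dA_rotation.
Qed.

Lemma integralC_dA_translation (c : C) (f : C -> C) : mfun f ->
  integralC dA (fun z => f (c + z)) = integralC dA f.
Proof.
move=> mf; rewrite /integralC /Rintegral; congr (fine _ +i* fine _).
  apply: (integral_dA_translation c (F := fun z => (complex.Re (f z))%:E)).
  by apply/measurable_EFinP; exact: measurable_cplxRe.
apply: (integral_dA_translation c (F := fun z => (complex.Im (f z))%:E)).
by apply/measurable_EFinP; exact: measurable_cplxIm.
Qed.

Lemma gaussE (w : C) : gauss w = expR (- (2^-1 * normc w ^+ 2)).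
Proof. by rewrite /gauss; congr expR; rewrite mulNr mulrC. Qed.

Lemma gauss_gt0 (w : C) : 0 < gauss w. Proof. exact: expR_gt0. Qed.

Lemma gauss_nneg (w : C) : 0 <= gauss w. Proof. exact: expR_ge0. Qed.

Lemma gauss_le1 (w : C) : gauss w <= 1.
Proof. by rewrite gaussE -expR0 ler_expR oppr_le0 mulr_ge0// sqr_ge0. Qed.

Lemma gauss_rotation (u w : C) : normc u = 1 -> gauss (u * w) = gauss w.
Proof. by move=> u1; rewrite !gaussE normcM u1 mul1r. Qed.

Lemma measurable_gauss_fun : measurable_fun setT (@gauss R : CplxB R -> R).
Proof. exact: (measurable_gauss_comp (f := fun z => z)). Qed.

Lemma integral_gauss : (\int[dA]_w (gauss (w : C))%:E = 2%:E)%E.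
Proof.
under eq_integral do rewrite gaussE.
by rewrite integral_gauss_dA// invrK.
Qed.

Lemma integrable_RC (F : CplxB R -> R) : measurable_fun setT F ->
  (\int[dA]_w `|F w|%:E < +oo)%E -> dA.-integrable setT (EFin \o F).
Proof.
move=> mF fin; apply: (integrable_of_le _ _ _ fin) => //.
exact: measurableT_comp.
Qed.

Lemma measurable_integral_dA d (T : measurableType d) (f : T * CplxB R -> \bar R) :
  measurable_fun setT f -> (forall p, 0 <= f p)%E ->
  measurable_fun setT (fun t => \int[dA]_w f (t, w))%E.
Proof.
move=> mf f0; rewrite -dA_funE.
exact: (@measurable_fun_fubini_tonelli_F _ _ _ _ _ (@dA_fun R) f).
Qed.

Lemma expi_lip (s t : R) : normc (expi s - expi t) <= 2 * `|s - t|.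
Proof.
have -> : expi s - expi t = expi t * (expi (s - t) - 1).
  by rewrite mulrBr mulr1 -expiD [t + _]addrC subrK.
rewrite normcM normc_expi mul1r mulr_natl mulr2n.
apply: le_trans (normc_le_ReIm _) _; rewrite /= subr0; apply: lerD.
  have [c _] := MVT0 (s - t) (@is_derive_cos R); rewrite cos0 => ->.
  by rewrite normrM normrN ler_piMl// sin_max.
exact: sin_norm_le.
Qed.

Lemma continuous_circle (F : C -> C) (w : C) : entire F ->
  continuous (fun t => complex.Re (F (w * expi t))).
Proof.
move=> eF t; apply/cvgrPdist_lt => e e0.
have [r r0 H] := entire_cts eF (w * expi t) e0.
pose k := 2 * normc w + 1; have k0 : 0 < k by rewrite ltr_wpDl// mulr_ge0// normc_ge0.
near=> s; rewrite distrC -raddfB; apply: le_lt_trans (normc_Re_le _) _.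
apply: H; rewrite -mulrBr normcM.
have : `|s - t| < r / k.
  by rewrite distrC; near: s; apply: cvgr_dist_lt => //; rewrite divr_gt0.
rewrite ltr_pdivlMr// => st.
have := ler_wpM2l (normc_ge0 w) (expi_lip s t); have := normr_ge0 (s - t).
by rewrite /k in st; lra.
Unshelve. all: by end_near. Qed.

Definition dA_sfinite : {sigma_finite_measure set (CplxB R) -> \bar R} := @dA_fun R.

(** The integral of [Re F(w e^{it}) gauss(w)] over [w] in the plane and [t] in [[0, 2 pi]] is
    computed in both orders. Integrating in [w] first, rotation invariance removes [t]; integrating
    in [t] first gives a circle mean, and [gauss] has total mass 2. *)
Lemma gaussian_mean_value_Re (F : CplxB R -> C) : entire F ->
  (\int[dA]_w (normc (F w) * gauss (w : C))%:E < +oo)%E ->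
  \int[dA]_w (complex.Re (F w) * gauss (w : C)) = 2 * complex.Re (F 0).
Proof.
move=> eF fin; have mF := entire_measurable eF.
have mg := measurable_gauss_fun.
have ri0 : 0 < 2 * pi :> R by rewrite mulr_gt0// pi_gt0.
pose I : set (measurableTypeR R) := `[0, 2 * pi]%classic.
have mI : measurable I by exact: measurable_itv.
have mI1 : measurable_fun setT (\1_I : measurableTypeR R -> R) by exact: measurable_indic.
pose H (p : measurableTypeR R * CplxB R) : R :=
  \1_I p.1 * (complex.Re (F (p.2 * expi p.1)) * gauss (p.2 : C)).
have mE : measurable_fun setT (fun p : measurableTypeR R * CplxB R => p.2 * expi p.1 : CplxB R).
  apply: measurable_cplxM => //.
  apply: measurable_cplxP => /=.
    apply: (measurableT_comp (f := cos)) => //.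
    by apply: continuous_measurable_fun; exact: continuous_cos.
  apply: (measurableT_comp (f := sin)) => //.
  by apply: continuous_measurable_fun; exact: continuous_sin.
have mH : measurable_fun setT H.
  apply: measurable_funM; first exact: (measurableT_comp mI1).
  apply: measurable_funM; last exact: (measurableT_comp mg).
  by apply: measurable_cplxRe; exact: (measurableT_comp mF mE).
have rot t (G : CplxB R -> \bar R) : measurable_fun setT G ->
    (\int[dA]_w G (w * expi t)%R = \int[dA]_w G w)%E.
  move=> mG; rewrite -[RHS](integral_dA_rotation (normc_expi t) mG).
  by apply: eq_integral => w _; rewrite mulrC.
have mFg : measurable_fun setT (fun w : CplxB R => normc (F w) * gauss (w : C)).
  by apply: measurable_funM => //; exact: measurable_cplxnormc.
have mRg : measurable_fun setT (fun w : CplxB R => complex.Re (F w) * gauss (w : C)).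
  by apply: measurable_funM => //; exact: measurable_cplxRe.
have I1 : (\int[lebesgue_measure]_t (\1_I t)%:E = (2 * pi)%:E :> \bar R)%E.
  by rewrite integral_indic//= setIT /I lebesgue_measure_itv/= lte_fin ri0 -EFinB subr0.
(* Fubini's hypothesis: for each [t] the integral of [|H|] in [w] is at most that of [|F| gauss],
   again by rotation invariance. *)
have IH : ((@lebesgue_measure R) \x dA_sfinite)%E.-integrable setT (EFin \o H).
  apply/integrable12ltyP; first exact/measurable_EFinP.
  apply: (@le_lt_trans _ _ (\int[lebesgue_measure]_t ((\1_I t)%:E *
      \int[dA]_w (normc (F w) * gauss (w : C))%:E))%E).
    have mHn : measurable_fun setT (fun p => `|(EFin \o H) p|%E).
      by apply: measurableT_comp => //; exact/measurable_EFinP.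
    apply: ge0_le_integral => //.
    - by move=> t _; exact: integral_ge0.
    - exact: (@measurable_integral_dA _ _ (fun p => `|(EFin \o H) p|%E)).
    - by apply: emeasurable_funM => //; exact/measurable_EFinP.
    - move=> t _.
      change (\int[dA]_y `|(EFin \o H) (t, y)| <=
        (\1_I t)%:E * \int[dA]_w (normc (F w) * gauss (w : C))%:E)%E.
      have i0 : 0 <= \1_I t :> R by rewrite indicE.
      have mFg' : measurable_fun setT (fun w : CplxB R => (normc (F w) * gauss (w : C))%:E).
        exact/measurable_EFinP.
      rewrite -(rot t _ mFg') -ge0_integralZl//.
      + apply: ge0_le_integral => //.
        * apply/measurable_EFinP; apply: measurableT_comp => //.
          exact: (measurableT_comp mH (pair1_measurable t)).
        * apply: emeasurable_funM => //; apply/measurable_EFinP.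
          exact: (measurableT_comp mFg (measurableT_comp mE (pair1_measurable t))).
        * move=> w _; rewrite -EFinM lee_fin /H/= !normrM (ger0_norm i0).
          rewrite ler_wpM2l// [w * _]mulrC gauss_rotation ?normc_expi//.
          by rewrite (ger0_norm (ltW (gauss_gt0 _))) ler_pM2r ?gauss_gt0 ?normc_Re_le.
      + apply/measurable_EFinP.
        exact: (measurableT_comp mFg (measurableT_comp mE (pair1_measurable t))).
      + by move=> w _; rewrite lee_fin mulr_ge0 ?normc_ge0 ?ltW ?gauss_gt0.
  rewrite ge0_integralZr//.
  - by rewrite I1 lte_mul_pinfty// lee_fin ltW.
  - exact/measurable_EFinP.
  - by apply: integral_ge0 => w _; rewrite lee_fin mulr_ge0 ?normc_ge0 ?ltW ?gauss_gt0.
have : (\int[lebesgue_measure]_t \int[dA]_w (H (t, w))%:E =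
  \int[dA]_w \int[lebesgue_measure]_t (H (t, w))%:E)%E.
  exact: (@Fubini _ _ _ _ _ _ _ _ IH).
pose J := (\int[dA]_w (complex.Re (F w) * gauss (w : C))%:E)%E.
have JE : J = (\int[dA]_w (complex.Re (F w) * gauss (w : C)))%:E.
  rewrite fineK//; apply: integrable_fin_num => //; apply: integrable_RC => //.
  apply: le_lt_trans fin; apply: ge0_le_integral => //.
  - by apply/measurable_EFinP; exact: measurableT_comp.
  - exact/measurable_EFinP.
  - move=> w _; rewrite lee_fin normrM (ger0_norm (ltW (gauss_gt0 _))).
    by rewrite ler_pM2r ?gauss_gt0 ?normc_Re_le.
rewrite [X in X = _ -> _](_ : _ = (2 * pi)%:E * J)%E; last first.
  rewrite (eq_integral (fun t => (\1_I t)%:E * J)%E); last first.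
    move=> t _; rewrite /H/= indicE; case: (t \in I) => /=; last first.
      by rewrite mul0e integral0_eq// => w _; rewrite mul0r.
    rewrite mul1e /J -[RHS](rot t); last exact/measurable_EFinP.
    apply: eq_integral => w _.
    by rewrite mul1r (_ : gauss (w * expi t) = gauss w)// mulrC gauss_rotation ?normc_expi.
  rewrite JE integralZr//; first by rewrite I1.
  exact: (@integrable_indic_itv _ 0 (2 * pi) true false).
rewrite [X in _ = X -> _](_ : _ = (2 * pi)%:E * (2 * complex.Re (F 0))%:E)%E; last first.
  rewrite (eq_integral (fun w : CplxB R => (2 * pi * complex.Re (F 0))%:E * (gauss (w : C))%:E)%E); last first.
    move=> w _; have cFw := @continuous_circle F w eF.
    have iFw := continuous_integrable_itv 0 (2 * pi) cFw.
    transitivity (\int[lebesgue_measure]_(t in I)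
       ((complex.Re (F (w * expi t)))%:E * (gauss (w : C))%:E))%E.
      rewrite [RHS]integral_mkcond; apply: eq_integral => t _.
      by rewrite patchE /H/= indicE; case: ifPn => _ /=; rewrite ?mul1r ?mul0r.
    rewrite integralZr//; congr (_ * _)%E.
    by rewrite -(@circle_mean_value_Re _ F w eF) /Rintegral fineK//; exact: integrable_fin_num iFw.
  rewrite integralZl//; last first.
    apply: integrable_RC => //.
    under eq_integral do rewrite (ger0_norm (ltW (gauss_gt0 _))).
    by rewrite integral_gauss ltry.
  by rewrite integral_gauss -!EFinM; congr (_%:E); move: (pi : R) (complex.Re (F 0)) => p c; ring.
rewrite JE -!EFinM => -[]; apply: mulfI.
by rewrite gt_eqF.
Qed.

End gaussian_mean.

(** * The Bargmann projection and weighted translations *)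

Section bargmann_projection.
Variable R : realType.
Local Notation C := (Cplx R).
Local Notation mfun f := (measurable_fun setT (f : CplxB R -> CplxB R)).
Implicit Types f g : C -> C.

Lemma Re_mulR (z : R[i]) (x : R) : complex.Re (z * x%:C) = complex.Re z * x.
Proof. by rewrite complexReM/= mulr0 subr0. Qed.

Lemma Im_mulR (z : R[i]) (x : R) : complex.Im (z * x%:C) = complex.Im z * x.
Proof. by rewrite complexImM/= mulr0 add0r. Qed.

Lemma gaussian_mean_value f : entire f ->
  (\int[dA]_w (normc (f w) * gauss (w : C))%:E < +oo)%E ->
  integralC dA (fun w => f w * (2^-1 * gauss w)%:C) = f 0.
Proof.
move=> ef fin; have mg := @measurable_gauss_fun R.
have half F : entire F -> (\int[dA]_w (normc (F w) * gauss (w : C))%:E < +oo)%E ->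
    \int[dA]_w (complex.Re (F w) * (2^-1 * gauss (w : C))) = complex.Re (F 0).
  move=> eF finF; have mF := entire_measurable eF.
  under eq_Rintegral do rewrite mulrCA.
  rewrite RintegralZl//; first by rewrite gaussian_mean_value_Re// mulKf.
  apply: (@integrable_of_le _ _ _ (fun w : CplxB R => normc (F w) * gauss (w : C))) => //.
  - by apply: measurable_funM => //; exact: measurable_cplxRe.
  - by apply: measurable_funM => //; exact: measurable_cplxnormc.
  - move=> w; rewrite normrM (ger0_norm (ltW (gauss_gt0 _))).
    by rewrite ler_pM2r ?gauss_gt0 ?normc_Re_le.
rewrite /integralC; apply/eqP; rewrite eq_complex/=; apply/andP; split; apply/eqP.
  by under eq_Rintegral do rewrite Re_mulR; exact: half.
under eq_Rintegral do rewrite Im_mulR.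
(* Multiplication by [-i] moves the imaginary part to the real one. *)
pose G (z : C) : C := (0 -i* 1) * f z.
have ReG z : complex.Re (G z) = complex.Im (f z).
  by rewrite /G complexReM/= mul0r mulN1r sub0r opprK.
have eG : entire G := entireM (@entire_cst R (0 -i* 1)) ef.
rewrite -ReG -(half G eG); first by apply: eq_Rintegral => w _; rewrite ReG.
by under eq_integral do rewrite /G normcM/= expr0n sqrrN expr1n add0r sqrtr1 mul1r.
Qed.

(** The reproducing kernel of F^2 with the density of [lambda] absorbed, so that [bproj] integrates
    against [dA]. *)
Definition bkernel (z w : C) : C := expC (z * conjc w / 2) * (2^-1 * gauss w)%:C.

Definition bproj g : C -> C := fun z => integralC dA (fun w => g w * bkernel z w).

(** Twice the squared norm in [L^2(lambda)]: the factor [1/2] of the density of [lambda] is left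
    out. *)
Definition norm2 g : \bar R := (\int[dA]_w (normc (g w) ^+ 2 * gauss (w : C))%:E)%E.

Lemma invr2C : (2^-1 : R)%:C = 2^-1 :> R[i].
Proof. by rewrite (fmorphV (real_complex R)) rmorph_nat. Qed.

Lemma gauss_expC (w : C) : (gauss w)%:C = expC (- (w * conjc w / 2)).
Proof.
rewrite [w * _]mulrC conj_mul gaussE; set x := normc w ^+ 2.
have -> : - (x%:C / 2) = (- (2^-1 * x))%:C.
  by rewrite -invr2C -rmorphM -rmorphN [x * _]mulrC.
by rewrite /expC/= cos0 sin0 mulr1 mulr0.
Qed.

(** Completing the square: the Gaussian centred at [z] with the exponential factor of [wtrans] is
    the kernel at [z]. This carries the mean value at 0 to the reproducing formula at [z]. *)
Lemma gauss_translate (z w : C) :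
  expC (- ((w - z) * conjc z) / 2) * (gauss (w - z))%:C = expC (z * conjc w / 2) * (gauss w)%:C.
Proof. by rewrite !gauss_expC -!expCD; congr expC; rewrite rmorphB/=; field. Qed.

Lemma Re_mul_conj (z w : C) : complex.Re (z * conjc w) =
  (normc z ^+ 2 + normc w ^+ 2 - normc (z - w) ^+ 2) / 2.
Proof. by rewrite !normc_sqr complexReM; case: z w => [a b] [c d] /=; field. Qed.

Lemma Re_half (z : C) : complex.Re (z / 2) = complex.Re z / 2.
Proof.
have -> : z / 2 = z * (2^-1 : R)%:C by rewrite -invr2C.
by rewrite Re_mulR.
Qed.

(** Polarizing [Re (z conj w)] shows a Gaussian in [z - w], up to one weight in [z] and one in [w];
    in this form the kernel is open to Schur's test. *)
Lemma normc_bkernel (z w : C) : normc (bkernel z w) =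
  2^-1 * expR (normc z ^+ 2 / 4 - normc w ^+ 2 / 4 - normc (z - w) ^+ 2 / 4).
Proof.
rewrite /bkernel normcM normc_expC normcR ger0_norm; last first.
  by rewrite mulr_ge0 ?invr_ge0// ltW ?gauss_gt0.
rewrite Re_half Re_mul_conj gaussE mulrCA -expRD; congr (_ * expR _).
by field.
Qed.

Lemma measurable_bkernel d (T : measurableType d) (u v : T -> CplxB R) :
  measurable_fun setT u -> measurable_fun setT v ->
  measurable_fun setT (fun t => bkernel (u t) (v t) : CplxB R).
Proof.
move=> mu mv; apply: measurable_cplxM.
  apply: (measurable_entire_comp (@entire_expC R)).
  apply: measurable_cplxM => //; apply: measurable_cplxM => //.
  exact: measurable_cplxconj.
apply: measurable_cplxR; apply: measurable_funM => //.
exact: measurable_gauss_comp.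
Qed.

Lemma measurable_norm2_fun g : mfun g ->
  measurable_fun setT (fun w : CplxB R => normc (g w) ^+ 2 * gauss (w : C)).
Proof.
move=> mg; apply: measurable_funM; last exact: measurable_gauss_fun.
by apply: measurable_funX; exact: measurable_cplxnormc.
Qed.

Lemma norm2_fun_ge0 g w : 0 <= normc (g w) ^+ 2 * gauss w.
Proof. by rewrite mulr_ge0 ?sqr_ge0 ?gauss_nneg. Qed.

Lemma norm2_ge0 g : (0 <= norm2 g)%E.
Proof.
by apply: integral_ge0 => w _; rewrite lee_fin norm2_fun_ge0.
Qed.

(* AM-GM gives |g| e^{-|w|^2/2} <= (1 + |g|^2) e^{-|w|^2/2}. *)
Lemma norm2_integrable g : mfun g -> (norm2 g < +oo)%E ->
  (\int[dA]_w (normc (g w) * gauss (w : C))%:E < +oo)%E.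
Proof.
move=> mg fin; have mn := measurable_norm2_fun mg; have mga := @measurable_gauss_fun R.
apply: (@le_lt_trans _ _ (\int[dA]_w ((gauss (w : C))%:E + (normc (g w) ^+ 2 * gauss (w : C))%:E))%E).
  apply: ge0_le_integral => //.
  - by move=> w _; rewrite lee_fin mulr_ge0 ?normc_ge0 ?ltW ?gauss_gt0.
  - by apply/measurable_EFinP/measurable_funM => //; exact: measurable_cplxnormc.
  - by apply: emeasurable_funD; exact/measurable_EFinP.
  - move=> w _; rewrite -EFinD lee_fin -[X in _ <= X + _]mul1r -mulrDl ler_pM2r ?gauss_gt0//.
    have := sqr_ge0 (normc (g w) - 2^-1); lra.
rewrite ge0_integralD//.
- by rewrite integral_gauss lte_add_pinfty ?ltry.
- by move=> w _; rewrite lee_fin ltW ?gauss_gt0.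
- exact/measurable_EFinP.
- by move=> w _; rewrite lee_fin norm2_fun_ge0.
- exact/measurable_EFinP.
Qed.

(* Weighted translation [f_z(w) = f(z+w) e^{-w zbar/2 - |z|^2/4}], an isometry of F^2. *)
Definition wtrans (z : C) f : C -> C := fun w =>
  f (z + w) * expC (- (w * conjc z) / 2 - (normc z ^+ 2 / 4)%:C).

Lemma entire_lin (a b : C) : entire (fun w => w * a + b).
Proof.
by apply: entireD; [apply: entireM; [exact: entire_id|exact: entire_cst]|exact: entire_cst].
Qed.

Lemma entire_wtrans z f : entire f -> entire (wtrans z f).
Proof.
move=> ef; apply: entireM.
  apply: (entire_comp ef (g := fun w => z + w)).
  by apply: entireD; [exact: entire_cst|exact: entire_id].
apply: (entire_comp (@entire_expC R) (g := fun w => - (w * conjc z) / 2 - (normc z ^+ 2 / 4)%:C)).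
rewrite (_ : (fun w => _) = (fun w => w * (- conjc z / 2) - (normc z ^+ 2 / 4)%:C)); last first.
  by apply/funext => w; rewrite mulrA mulrN.
exact: entire_lin.
Qed.

Lemma normc_wtrans z f w : normc (wtrans z f w) ^+ 2 * gauss w =
  normc (f (z + w)) ^+ 2 * gauss (z + w).
Proof.
rewrite /wtrans normcM exprMn -mulrA; congr (_ * _).
rewrite normc_expC !gaussE expr2 -!expRD raddfB/= Re_half raddfN/= complexReM !normc_sqr.
by congr expR; case: z w => [a b] [c d] /=; field.
Qed.

End bargmann_projection.

(** * Gaussian-weighted integrability and the reproducing formula *)

Section reproducing_formula.
Variable R : realType.
Local Notation C := (Cplx R).
Local Notation mfun f := (measurable_fun setT (f : CplxB R -> CplxB R)).
Implicit Types f g : C -> C.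

Lemma measurable_gaussian (a : R) (z : C) :
  measurable_fun setT (fun w : CplxB R => expR (- (a * normc (z - w) ^+ 2))).
Proof.
apply: measurableT_comp => //; apply: measurableT_comp => //.
apply: measurable_funM => //; apply: measurable_funX.
by apply: measurable_cplxnormc; apply: measurable_cplxD => //; exact: measurable_cplxN.
Qed.

Lemma normcB (z w : C) : normc (z - w) = normc (w - z).
Proof. by rewrite -normcN opprB. Qed.

Lemma integral_gaussian (a : R) (z : C) : 0 < a ->
  (\int[dA]_w (expR (- (a * normc (z - (w : C)) ^+ 2)))%:E = (a^-1)%:E)%E.
Proof.
move=> a0; rewrite -(integral_gauss_dA a0).
have mF : measurable_fun setT (fun w : CplxB R => (expR (- (a * normc (w : C) ^+ 2)))%:E).
  apply/measurable_EFinP; have := measurable_gaussian a 0.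
  by under eq_fun do rewrite sub0r normcN.
rewrite -(integral_dA_translation (- z) mF).
by apply: eq_integral => w _; rewrite normcB [- z + _]addrC.
Qed.

(** Integrate [2 t k G <= t^2 k + k G^2] and choose the best constant [t]. *)
Lemma cauchy_schwarz_ge0 (k G : CplxB R -> R) (K : R) : 0 < K ->
  measurable_fun setT k -> measurable_fun setT G ->
  (forall w, 0 <= k w) -> (forall w, 0 <= G w) ->
  (\int[dA]_w (k w)%:E = K%:E)%E ->
  ((\int[dA]_w (k w * G w)%:E) * (\int[dA]_w (k w * G w)%:E) <=
   K%:E * \int[dA]_w (k w * G w ^+ 2)%:E)%E.
Proof.
move=> K0 mk mG k0 G0 kK.
have mkG : measurable_fun setT (fun w => k w * G w) by exact: measurable_funM.
have mkG2 : measurable_fun setT (fun w => k w * G w ^+ 2).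
  by apply: measurable_funM => //; exact: measurable_funX.
have kG0 w : 0 <= k w * G w by rewrite mulr_ge0.
have kG20 w : 0 <= k w * G w ^+ 2 by rewrite mulr_ge0// sqr_ge0.
have [sfin|] := ltP (\int[dA]_w (k w * G w ^+ 2)%:E)%E +oo%E; last first.
  by rewrite leye_eq => /eqP ->; rewrite gt0_muley ?lte_fin// leey.
have key t : 0 <= t -> ((2 * t)%:E * (\int[dA]_w (k w * G w)%:E) <=
    (t ^+ 2 * K)%:E + \int[dA]_w (k w * G w ^+ 2)%:E)%E.
  move=> t0; rewrite -ge0_integralZl//; last 3 first.
  - exact/measurable_EFinP.
  - by move=> w _; rewrite lee_fin.
  - by rewrite lee_fin mulr_ge0.
  rewrite [(t ^+ 2 * K)%:E]EFinM -kK -[X in (_ <= X + _)%E]ge0_integralZl//; last 3 first.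
  - exact/measurable_EFinP.
  - by move=> w _; rewrite lee_fin.
  - by rewrite lee_fin sqr_ge0.
  rewrite -ge0_integralD//; last 4 first.
  - by move=> w _; rewrite -EFinM lee_fin mulr_ge0// sqr_ge0.
  - by apply: emeasurable_funM => //; exact/measurable_EFinP.
  - by move=> w _; rewrite lee_fin.
  - exact/measurable_EFinP.
  apply: ge0_le_integral => //.
  - by move=> w _; rewrite -EFinM lee_fin mulr_ge0// mulr_ge0.
  - by apply: emeasurable_funM => //; exact/measurable_EFinP.
  - by apply: emeasurable_funD; [apply: emeasurable_funM => //|]; exact/measurable_EFinP.
  move=> w _; rewrite -!EFinM -EFinD lee_fin.
  have := mulr_ge0 (k0 w) (sqr_ge0 (t - G w)); lra.
have s0 : (0 <= \int[dA]_w (k w * G w ^+ 2)%:E)%E.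
  by apply: integral_ge0 => w _; rewrite lee_fin.
have m0 : (0 <= \int[dA]_w (k w * G w)%:E)%E.
  by apply: integral_ge0 => w _; rewrite lee_fin.
move: sfin key s0 m0; move: (\int[dA]_w (k w * G w ^+ 2)%:E)%E => [s| |]//.
move: (\int[dA]_w (k w * G w)%:E)%E => [m| |]// _ key; last first.
  (* The value [t = 1] rules out an infinite integral of [k G]. *)
  by have := key 1 ler01; rewrite gt0_muley ?lte_fin// leye_eq.
rewrite !lee_fin => s0 m0.
(* The optimal [t] is the mean of [G] for the weight [k]. *)
have := key (m / K) (divr_ge0 m0 (ltW K0)); rewrite lee_fin.
have -> : 2 * (m / K) * m = 2 * (m ^+ 2 / K) by field; rewrite gt_eqF.
have -> : (m / K) ^+ 2 * K = m ^+ 2 / K by field; rewrite gt_eqF.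
move=> h; have : m ^+ 2 / K <= s by lra.
by rewrite ler_pdivrMr// expr2 mulrC [s * _]mulrC.
Qed.

(* e^{c|w|} <= e^{2c^2} e^{|w|^2/8} reduces this to AM-GM. *)
Lemma norm2_exp_integrable g (c : R) : mfun g -> (norm2 g < +oo)%E ->
  (\int[dA]_w (normc (g w) * expR (c * normc (w : C)) * gauss (w : C))%:E < +oo)%E.
Proof.
move=> mg fin; have mn := measurable_norm2_fun mg; have mga := @measurable_gauss_fun R.
have mG : measurable_fun setT (fun w : CplxB R => expR (- (4^-1 * normc (w : C) ^+ 2))).
  by have := measurable_gaussian 4^-1 0; under eq_fun do rewrite sub0r normcN.
pose k := expR (2 * c ^+ 2).
have k0 : 0 < k by exact: expR_gt0.
apply: (@le_lt_trans _ _ (\int[dA]_w (k%:E * ((expR (- (4^-1 * normc (w : C) ^+ 2)))%:E + (normc (g w) ^+ 2 * gauss (w : C))%:E)))%E).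
  apply: ge0_le_integral => //.
  - by move=> w _; rewrite lee_fin !mulr_ge0 ?normc_ge0 ?expR_ge0 ?gauss_nneg.
  - apply/measurable_EFinP/measurable_funM => //; apply: measurable_funM => //.
      exact: measurable_cplxnormc.
    apply: measurableT_comp => //; apply: measurable_funM => //.
    exact: measurable_normc.
  - by apply: emeasurable_funM => //; apply: emeasurable_funD; exact/measurable_EFinP.
  - move=> w _; rewrite -EFinD -EFinM lee_fin gaussE.
    set n := normc (w : C).
    have -> : expR (- (2^-1 * n ^+ 2)) = expR (- (4^-1 * n ^+ 2)) * expR (- (4^-1 * n ^+ 2)).
      by rewrite -expRD; congr expR; field.
    set b := expR (- (8^-1 * n ^+ 2)).
    have b0 : 0 < b by exact: expR_gt0.
    have -> : expR (- (4^-1 * n ^+ 2)) = b * b.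
      by rewrite -expRD; congr expR; field.
    have h : expR (c * n) * b <= k.
      by rewrite -expRD ler_expR; have := sqr_ge0 (n / 4 - c); have := sqr_ge0 c; nra.
    set G := normc (g w); have G0 : 0 <= G := normc_ge0 _.
    have -> : G * expR (c * n) * (b * b * (b * b)) = (expR (c * n) * b) * (G * b * (b * b)) by ring.
    apply: (@le_trans _ _ (k * (G * b * (b * b)))).
      by apply: ler_wpM2r => //; rewrite !mulr_ge0// ltW.
    rewrite ler_pM2l//.
    have := sqr_ge0 (b - G * (b * b)); have := sqr_ge0 b; have := sqr_ge0 (G * (b * b)); nra.
rewrite ge0_integralZl//; last 3 first.
- by apply: emeasurable_funD; exact/measurable_EFinP.
- by move=> w _; rewrite -EFinD lee_fin addr_ge0 ?expR_ge0 ?norm2_fun_ge0.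
- by rewrite lee_fin ltW.
rewrite ge0_integralD//.
- rewrite integral_gauss_dA//; apply: lte_mul_pinfty; rewrite ?lee_fin ?expR_ge0//.
  exact: lte_add_pinfty (ltry _) fin.
- exact/measurable_EFinP.
- by move=> w _; rewrite lee_fin norm2_fun_ge0.
- exact/measurable_EFinP.
Qed.

(** A growth [e^{c |w|}] with [c] bounded for [z] in a disc is what [norm2_exp_integrable] can
    absorb. *)
Lemma bkernel_le (z w : C) : normc (bkernel z w) <= expR (normc z * normc w) * gauss w.
Proof.
rewrite normc_bkernel gaussE -expRD.
apply: (@le_trans _ _ (1 * expR (normc z ^+ 2 / 4 - normc w ^+ 2 / 4 - normc (z - w) ^+ 2 / 4))).
  by rewrite ler_pM2r ?expR_gt0//; lra.
rewrite mul1r ler_expR.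
have : normc z <= normc (z - w) + normc w by rewrite -[X in normc X <= _](subrK w) le_normcD.
have : normc w <= normc (z - w) + normc z by rewrite normcB -[X in normc X <= _](subrK z) le_normcD.
have := normc_ge0 z; have := normc_ge0 w; have := normc_ge0 (z - w).
move: (normc z) (normc w) (normc (z - w)) => a b d d0 b0 a0 h1 h2.
have : (a - b) ^+ 2 <= d ^+ 2 by nra.
have : 0 <= a * b by exact: mulr_ge0.
lra.
Qed.

Lemma integrable_bkernel g z : mfun g -> (norm2 g < +oo)%E ->
  integrableC dA (fun w => g w * bkernel z w).
Proof.
move=> mg fin; have mgk : mfun (fun w => g w * bkernel z w).
  by apply: measurable_cplxM => //; exact: measurable_bkernel.
split => //; apply: le_lt_trans (norm2_exp_integrable (normc z) mg fin).
have := @measurable_gauss_fun R => mga.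
apply: ge0_le_integral => //.
- by move=> w _; rewrite lee_fin normc_ge0.
- by apply/measurable_EFinP; exact: measurable_cplxnormc.
- apply/measurable_EFinP/measurable_funM => //; apply: measurable_funM => //.
    exact: measurable_cplxnormc.
  apply: measurableT_comp => //; apply: measurable_funM => //.
  exact: measurable_normc.
- by move=> w _; rewrite lee_fin normcM -mulrA ler_wpM2l ?normc_ge0// bkernel_le.
Qed.

Lemma norm2_wtrans z f : entire f -> norm2 (wtrans z f) = norm2 f.
Proof.
move=> ef; rewrite /norm2; under eq_integral do rewrite normc_wtrans.
apply: (integral_dA_translation z (F := fun w => (normc (f w) ^+ 2 * gauss (w : C))%:E)).
apply/measurable_EFinP; apply: measurable_norm2_fun; exact: entire_measurable.
Qed.

(** The Gaussian mean value of [wtrans z f] at 0, after the change of variable [w - z], is the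
    formula at [z]; both sides carry the factor [c = e^{-|z|^2/4}], which cancels. *)
Lemma bproj_entire_id f : entire f -> (norm2 f < +oo)%E -> bproj f = f.
Proof.
move=> ef fin; apply/funext => z; have mf := entire_measurable ef.
have et := @entire_wtrans _ z _ ef; have mt := entire_measurable et.
have ft : (norm2 (wtrans z f) < +oo)%E by rewrite norm2_wtrans.
have := gaussian_mean_value et (norm2_integrable mt ft).
pose F w := wtrans z f w * (2^-1 * gauss w)%:C.
have mF : mfun F.
  apply: measurable_cplxM => //; apply: measurable_cplxR; apply: measurable_funM => //.
  exact: measurable_gauss_fun.
rewrite -(integralC_dA_translation (- z) mF).
pose c : C := expC (- (normc z ^+ 2 / 4)%:C).
have -> : (fun w => F (- z + w)) = (fun w => c * (f w * bkernel z w)).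
  apply/funext => w; rewrite /F /wtrans addrA subrr add0r [- z + w]addrC.
  rewrite -[RHS]mulrCA -mulrA; congr (_ * _); rewrite /bkernel expCD -/c.
  have hC x : (2^-1 * x)%:C = (2^-1 : R)%:C * x%:C :> R[i] by rewrite rmorphM.
  rewrite !hC; have := gauss_translate z w.
  by move: (expC _) (expC _) (gauss _)%:C (gauss _)%:C => p q r s E; rewrite -mulrA -mulrCA; ring: E.
rewrite -integralCZ; last exact: integrable_bkernel.
rewrite /wtrans addr0 mul0r oppr0 mul0r sub0r -/c [RHS]mulrC => /mulfI; apply.
apply/eqP => /(congr1 (@normc R)); rewrite normc_expC normc0 => /eqP.
by rewrite gt_eqF ?expR_gt0.
Qed.

End reproducing_formula.

(** * Pointwise bounds and holomorphy of the projection *)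

Section projection_entire.
Variable R : realType.
Local Notation C := (Cplx R).
Local Notation mfun f := (measurable_fun setT (f : CplxB R -> CplxB R)).
Implicit Types f g : C -> C.

(** [hgauss] is the square root of [gauss]. Conjugating by it turns [|bkernel|] into the convolution
    kernel [egauss / 2], of total mass 2. *)
Definition hgauss (w : C) : R := expR (- (4^-1 * normc w ^+ 2)).
Definition egauss (z w : C) : R := expR (- (4^-1 * normc (z - w) ^+ 2)).

Lemma hgauss_sqr w : hgauss w ^+ 2 = gauss w.
Proof. by rewrite expr2 -expRD gaussE; congr expR; field. Qed.

Lemma hgauss_gt0 w : 0 < hgauss w. Proof. exact: expR_gt0. Qed.

Lemma egauss_gt0 z w : 0 < egauss z w. Proof. exact: expR_gt0. Qed.

Lemma normc_bkernelE (z w : C) :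
  normc (bkernel z w) = 2^-1 * egauss z w * (hgauss w / hgauss z).
Proof.
rewrite normc_bkernel /egauss /hgauss -expRN -mulrA -!expRD; congr (_ * expR _).
by field.
Qed.

Lemma measurable_hgauss : measurable_fun setT (hgauss : CplxB R -> R).
Proof. by have := measurable_gaussian 4^-1 (0 : C); under eq_fun do rewrite sub0r normcN. Qed.

Lemma measurable_egauss d (T : measurableType d) (u v : T -> CplxB R) :
  measurable_fun setT u -> measurable_fun setT v ->
  measurable_fun setT (fun t => egauss (u t) (v t)).
Proof.
move=> mu mv; apply: measurableT_comp => //; apply: measurableT_comp => //.
apply: measurable_funM => //; apply: measurable_funX.
by apply: measurable_cplxnormc; apply: measurable_cplxD => //; exact: measurable_cplxN.
Qed.

(* Cauchy-Schwarz for the probability density [egauss z w / 4]. *)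
Lemma bproj_pointwise g z : mfun g ->
  ((normc (bproj g z) ^+ 2 * gauss z)%:E <=
   \int[dA]_w (egauss z w * (normc (g w) ^+ 2 * gauss (w : C)))%:E)%E.
Proof.
move=> mg; pose k w := 2^-1 * egauss z w; pose G w := normc (g w) * (hgauss w / hgauss z).
have mE : measurable_fun setT (fun w : CplxB R => egauss z w) by exact: measurable_egauss.
have mk : measurable_fun setT (k : CplxB R -> R) by exact: measurable_funM.
have mG : measurable_fun setT (G : CplxB R -> R).
  apply: measurable_funM; first exact: measurable_cplxnormc.
  by apply: measurable_funM => //; exact: measurable_hgauss.
have k0 w : 0 <= k w by rewrite mulr_ge0// ltW// egauss_gt0.
have G0 w : 0 <= G w by rewrite mulr_ge0 ?normc_ge0// divr_ge0// ltW// hgauss_gt0.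
have kK : (\int[dA]_w (k w)%:E = 2%:E)%E.
  rewrite /k; under eq_integral do rewrite EFinM.
  rewrite ge0_integralZl//; last 2 first.
  - exact/measurable_EFinP.
  - by move=> w _; rewrite lee_fin ltW// egauss_gt0.
  by rewrite integral_gaussian// -EFinM; congr _%:E; field.
have cs := cauchy_schwarz_ge0 (ltr0n _ 2) mk mG k0 G0 kK.
have nI : ((normc (bproj g z))%:E <= \int[dA]_w (k w * G w)%:E)%E.
  apply: le_trans (normc_integralC_le _ _) _.
    by apply: measurable_cplxM => //; exact: measurable_bkernel.
  rewrite le_eqVlt; apply/orP; left; apply/eqP; apply: eq_integral => w _.
  by congr _%:E; rewrite normcM normc_bkernelE /k /G; ring.
have n0 : (0 <= (normc (bproj g z))%:E)%E by rewrite lee_fin normc_ge0.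
have := le_trans (lee_pmul n0 n0 nI nI) cs; rewrite -EFinM -expr2 => H.
have hz := hgauss_gt0 z.
rewrite EFinM; apply: le_trans (lee_wpmul2r _ H) _; first by rewrite lee_fin gauss_nneg.
have mkG : measurable_fun setT (fun w : CplxB R => k w * G w ^+ 2).
  by apply: measurable_funM => //; exact: measurable_funX.
rewrite muleAC -EFinM -ge0_integralZl//; last 3 first.
- exact/measurable_EFinP.
- by move=> w _; rewrite lee_fin mulr_ge0// sqr_ge0.
- by rewrite lee_fin mulr_ge0// gauss_nneg.
rewrite le_eqVlt; apply/orP; left; apply/eqP; apply: eq_integral => w _.
rewrite -EFinM; congr _%:E; rewrite /k /G -!hgauss_sqr; field.
by rewrite gt_eqF.
Qed.

Lemma egauss_le1 z w : egauss z w <= 1.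
Proof. by rewrite -expR0 ler_expR oppr_le0 mulr_ge0// sqr_ge0. Qed.

(** For entire [g] of finite norm, where [bproj g = g], this is the boundedness of point
    evaluations. *)
Lemma bproj_le_norm2 g z : mfun g ->
  ((normc (bproj g z) ^+ 2 * gauss z)%:E <= norm2 g)%E.
Proof.
move=> mg; apply: le_trans (bproj_pointwise z mg) _.
have mn := measurable_norm2_fun mg.
apply: ge0_le_integral => //.
- by move=> w _; rewrite lee_fin mulr_ge0 ?norm2_fun_ge0// ltW// egauss_gt0.
- by apply/measurable_EFinP/measurable_funM => //; exact: measurable_egauss.
- exact/measurable_EFinP.
- by move=> w _; rewrite lee_fin ler_piMl ?norm2_fun_ge0// egauss_le1.
Qed.

(** Differentiation under the integral: the integrand at [z + h] is [b e^q] with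
    [q = h conj(w) / 2], and the remainder [b (e^q - 1 - q)] is at most [|h|^2] times a fixed
    integrable function. *)
Lemma bproj_entire g : mfun g -> (norm2 g < +oo)%E -> entire (bproj g).
Proof.
move=> mg fin; apply/entire_cdiff => z.
pose b w := g w * bkernel z w.
have Ib : integrableC dA b by exact: integrable_bkernel.
have [mb _] := Ib.
(* In the exponent [|z|] comes from [bkernel_le]; of the 3, two absorb the factor [|w|^2] of the
   Taylor remainder and one bounds [e^{|q|}] for [|h| < 1]. *)
pose B w := normc (g w) * expR ((normc z + 3) * normc w) * gauss w.
have mB : measurable_fun setT (B : CplxB R -> R).
  apply: measurable_funM; last exact: measurable_gauss_fun.
  apply: measurable_funM; first exact: measurable_cplxnormc.
  apply: measurableT_comp => //; apply: measurable_funM => //.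
  exact: measurable_normc.
have Bfin : (\int[dA]_w (B w)%:E < +oo)%E by exact: norm2_exp_integrable.
have B0 w : 0 <= B w by rewrite !mulr_ge0 ?normc_ge0 ?expR_ge0 ?gauss_nneg.
pose M := fine (\int[dA]_w (B w)%:E)%E.
have ME : (\int[dA]_w (B w)%:E = M%:E)%E.
  rewrite fineK// ge0_fin_numE//; apply: integral_ge0 => w _; by rewrite lee_fin.
have bB w : normc (b w) * expR (3 * normc w) <= B w.
  rewrite /b normcM /B [(normc z + 3) * _]mulrDl expRD -!mulrA ler_wpM2l ?normc_ge0//.
  by rewrite [leRHS]mulrCA [leLHS]mulrC; exact: ler_wpM2l (expR_ge0 _) _ _ (bkernel_le z w).
have mc : measurable_fun setT (fun w : CplxB R => conjc w / 2 : CplxB R).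
  by apply: measurable_cplxM => //; exact: measurable_cplxconj.
have Id : integrableC dA (fun w => b w * (conjc w / 2)).
  split; first exact: measurable_cplxM.
  apply: le_lt_trans Bfin; apply: ge0_le_integral => //.
  - by move=> w _; rewrite lee_fin normc_ge0.
  - by apply/measurable_EFinP/measurable_cplxnormc; exact: measurable_cplxM.
  - exact/measurable_EFinP.
  - move=> w _; rewrite lee_fin; apply: le_trans (bB w); rewrite normcM.
    apply: ler_wpM2l; first exact: normc_ge0.
    rewrite normcM normc_conj normcV (_ : normc 2 = 2); last first.
      by rewrite (_ : 2 = (2 : R)%:C) ?normcR ?ger0_norm// rmorph_nat.
    have := expR_ge1Dx (3 * normc (w : C)); have := normc_ge0 (w : C); lra.
exists (integralC dA (fun w => b w * (conjc w / 2))) => e e0.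
have M0 : 0 <= M by rewrite fine_ge0// integral_ge0// => w _; rewrite lee_fin.
exists (Num.min 1 (e / (M + 1))); first by rewrite lt_min ltr01 divr_gt0// ltr_wpDl.
move=> h; rewrite lt_min => /andP[h1].
rewrite ltr_pdivlMr ?ltr_wpDl// => hM.
pose q w := h * conjc w / 2 : C.
have mq : mfun q.
  by rewrite /q; under eq_fun do rewrite -mulrA; exact: measurable_cplxM.
have bq w : b w * expC (q w) = g w * bkernel (z + h) w.
  rewrite /b /bkernel -mulrA; congr (_ * _).
  by rewrite !mulrDl expCD mulrAC.
have Ih : integrableC dA (fun w => b w * expC (q w)).
  rewrite (_ : (fun _ => _) = (fun w => g w * bkernel (z + h) w)); first exact: integrable_bkernel.
  by apply/funext => w; rewrite bq.
pose F w := b w * (expC (q w) - 1 - q w).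
have Iq : integrableC dA (fun w => b w * q w).
  have := integrableCZ h Id; rewrite (_ : (fun w => h * _) = (fun w => b w * q w))//.
  by apply/funext => w; rewrite /q; ring.
have mexp : mfun (fun w => expC (q w)).
  exact: (measurable_entire_comp (@entire_expC R)).
have IF : integrableC dA F.
  have := integrableCD (integrableCD Ih (integrableCZ (-1) Ib)) (integrableCZ (-1) Iq).
  by congr (integrableC dA _); apply/funext => w; rewrite /F; ring.
have -> : bproj g (z + h) - bproj g z - integralC dA (fun w => b w * (conjc w / 2)) * h =
    integralC dA F.
  have -> : bproj g (z + h) = integralC dA (fun w => b w * expC (q w)).
    by congr (integralC dA _); apply/funext => w; rewrite bq.
  rewrite [_ * h]mulrC integralCZ//.
  have -> : (fun w => h * (b w * (conjc w / 2))) = (fun w => b w * q w).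
    by apply/funext => w; rewrite /q; ring.
  rewrite -[- bproj g z]mulN1r -[- integralC dA (fun w => b w * q w)]mulN1r.
  rewrite /bproj -/b !integralCZ// -!integralCD//; first last.
  - exact: integrableCZ.
  - exact: integrableCZ.
  - by apply: integrableCD => //; exact: integrableCZ.
  by congr (integralC dA _); apply/funext => w; rewrite /F; ring.
have mF : mfun F by case: IF.
have n0 := normc_ge0 h.
have : ((normc (integralC dA F))%:E <= (normc h ^+ 2)%:E * M%:E)%E.
  apply: le_trans (normc_integralC_le _ mF) _.
  rewrite -ME -ge0_integralZl//; last 3 first.
  - exact/measurable_EFinP.
  - by move=> w _; rewrite lee_fin.
  - by rewrite lee_fin sqr_ge0.
  apply: ge0_le_integral => //.
  - by move=> w _; rewrite lee_fin normc_ge0.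
  - by apply/measurable_EFinP/measurable_cplxnormc.
  - by apply: emeasurable_funM => //; exact/measurable_EFinP.
  move=> w _; rewrite -EFinM lee_fin /F normcM.
  apply: (@le_trans _ _ (normc h ^+ 2 * (normc (b w) * expR (3 * normc (w : C))))).
    rewrite mulrCA ler_wpM2l ?normc_ge0//; apply: le_trans (expC_taylor1 _) _.
    have qn : normc (q w) = normc h * normc (w : C) / 2.
      rewrite /q !normcM normc_conj normcV (_ : normc 2 = 2)//.
      by rewrite (_ : 2 = (2 : R)%:C) ?normcR ?ger0_norm// rmorph_nat.
    have w0 := normc_ge0 (w : C).
    have qw : normc (q w) <= normc (w : C) by rewrite qn; nra.
    have e1 : expR (normc (q w)) <= expR (normc (w : C)) by rewrite ler_expR.
    have e2 : normc (w : C) ^+ 2 <= expR (2 * normc (w : C)).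
      rewrite expRM_natl ler_sqr ?nnegrE ?expR_ge0//.
      by apply: le_trans (expR_ge1Dx _); rewrite lerDr.
    apply: (@le_trans _ _ (3 * normc (q w) ^+ 2 * expR (normc (w : C)))).
      by rewrite ler_wpM2l// mulr_ge0// sqr_ge0.
    have -> : expR (3 * normc (w : C)) = expR (2 * normc (w : C)) * expR (normc (w : C)).
      by rewrite -expRD; congr expR; ring.
    rewrite [leRHS]mulrA ler_pM2r ?expR_gt0// qn.
    have h2 : 0 <= normc h ^+ 2 by rewrite sqr_ge0.
    have := ler_wpM2l h2 e2; have := mulr_ge0 h2 (sqr_ge0 (normc (w : C))).
    have := mulr_ge0 h2 (expR_ge0 (normc (w : C))).
    move: (normc (w : C)) (normc h) (expR _) => x y E; nra.
  by rewrite ler_wpM2l// sqr_ge0.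
rewrite -EFinM lee_fin => /le_trans; apply.
rewrite expr2 -mulrA [e * _]mulrC ler_wpM2l//.
by move: hM; rewrite mulrDr mulr1; lra.
Qed.

End projection_entire.

(** * The projection contracts the Gaussian L^2 norm *)

Section contraction.
Variable R : realType.
Local Notation C := (Cplx R).
Local Notation mfun f := (measurable_fun setT (f : CplxB R -> CplxB R)).
Implicit Types f g : C -> C.

Lemma dA_fubini (f : CplxB R * CplxB R -> R) :
  measurable_fun setT f ->
  (\int[dA]_z \int[dA]_w `|f (z, w)|%:E < +oo)%E ->
  (\int[dA]_z \int[dA]_w (f (z, w))%:E = \int[dA]_w \int[dA]_z (f (z, w))%:E)%E.
Proof.
move=> mf fin.
have If : (@dA_sfinite R \x @dA_sfinite R)%E.-integrable setT (EFin \o f).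
  by apply/integrable12ltyP => //; exact/measurable_EFinP.
exact: (@Fubini _ _ _ _ _ _ _ _ If).
Qed.

Lemma integral_egauss_l g : mfun g ->
  (\int[dA]_z \int[dA]_w (egauss z w * (normc (g w) ^+ 2 * gauss (w : C)))%:E = 4%:E * norm2 g)%E.
Proof.
move=> mg; have mn := measurable_norm2_fun mg.
pose f (p : CplxB R * CplxB R) : R := egauss p.1 p.2 * (normc (g p.2) ^+ 2 * gauss (p.2 : C)).
have mf : measurable_fun setT f.
  apply: measurable_funM; first exact: measurable_egauss.
  exact: (measurableT_comp mn).
rewrite (dA_tonelli (f := fun p => (f p)%:E)); last 2 first.
- exact/measurable_EFinP.
- by move=> p; rewrite lee_fin mulr_ge0 ?norm2_fun_ge0// ltW// egauss_gt0.
rewrite /f/= /norm2 -ge0_integralZl//; last 2 first.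
- exact/measurable_EFinP.
- by move=> w _; rewrite lee_fin norm2_fun_ge0.
apply: eq_integral => w _; under eq_integral do rewrite EFinM.
rewrite ge0_integralZr//; last 3 first.
- by apply/measurable_EFinP; exact: measurable_egauss.
- by move=> z _; rewrite lee_fin ltW// egauss_gt0.
- by rewrite lee_fin norm2_fun_ge0.
congr (_ * _)%E; rewrite -[4]invrK -(integral_gaussian w)//.
by apply: eq_integral => z _; rewrite /egauss normcB.
Qed.

(** Schur's test, where 4 is the mass of [egauss]. The constant is crude, but finiteness of
    [norm2 (bproj g)] has to be known before Fubini can exhibit the projection as self-adjoint,
    which improves the constant to 1. *)
Lemma norm2_bproj_schur g : mfun g -> (norm2 g < +oo)%E ->
  (norm2 (bproj g) <= 4%:E * norm2 g)%E.
Proof.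
move=> mg fin; rewrite -integral_egauss_l//.
have mn := measurable_norm2_fun mg.
apply: ge0_le_integral => //.
- by move=> z _; rewrite lee_fin norm2_fun_ge0.
- apply/measurable_EFinP; apply: measurable_norm2_fun; apply: entire_measurable.
  exact: bproj_entire.
- apply: (measurable_integral_dA (f := fun p : CplxB R * CplxB R => (egauss p.1 p.2 * (normc (g p.2) ^+ 2 * gauss (p.2 : C)))%:E)).
    apply/measurable_EFinP/measurable_funM; first exact: measurable_egauss.
    exact: (measurableT_comp mn).
  by move=> p; rewrite lee_fin mulr_ge0 ?norm2_fun_ge0// ltW// egauss_gt0.
- by move=> z _; exact: bproj_pointwise.
Qed.

Lemma norm2_bproj_lty g : mfun g -> (norm2 g < +oo)%E -> (norm2 (bproj g) < +oo)%E.
Proof.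
move=> mg fin; apply: le_lt_trans (norm2_bproj_schur mg fin) _.
by rewrite lte_mul_pinfty// lee_fin.
Qed.

Lemma conj_mulC (u v : C) : conjc (u * v) = conjc u * conjc v.
Proof. exact: (rmorphM (@conjc R)). Qed.

Lemma conj_expC (u : C) : conjc (expC u) = expC (conjc u).
Proof. by case: u => x y; rewrite /expC/= cosN sinN mulrN. Qed.

(** Hermitian symmetry of the kernel relative to [gauss dA], the reason for self-adjointness. *)
Lemma bkernel_sym z w :
  bkernel z w * (gauss z)%:C = conjc (bkernel w z) * (gauss w)%:C :> C.
Proof.
rewrite /bkernel conj_mulC conj_expC conjc_real.
have -> : conjc (w * conjc z / 2) = z * conjc w / 2.
  by rewrite -invr2C !conj_mulC conjcK conjc_real [conjc w * z]mulrC.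
have hC x : (2^-1 * x)%:C = (2^-1 : R)%:C * x%:C :> R[i] by rewrite rmorphM.
by rewrite !hC; move: (expC _) (gauss z)%:C (gauss w)%:C => a b c; ring.
Qed.

(* [bproj] is self-adjoint and idempotent. *)
Lemma norm2_bproj_inner g : mfun g -> (norm2 g < +oo)%E ->
  (norm2 (bproj g) = \int[dA]_w (complex.Re (conjc (g w) * bproj g w) * gauss (w : C))%:E)%E.
Proof.
move=> mg fin; set v := bproj g.
have ev : entire v by exact: bproj_entire.
have vfin : (norm2 v < +oo)%E by exact: norm2_bproj_lty.
have mv : mfun v by exact: entire_measurable.
have vv : bproj v = v by exact: bproj_entire_id.
pose f (p : CplxB R * CplxB R) : R :=
  complex.Re (conjc (v p.1) * (g p.2 * bkernel p.1 p.2)) * gauss (p.1 : C).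
have mf : measurable_fun setT f.
  apply: measurable_funM; last by apply: (measurable_gauss_comp (f := fst)).
  apply: measurable_cplxRe; apply: measurable_cplxM.
    by apply: measurable_cplxconj; exact: (measurableT_comp mv).
  apply: measurable_cplxM; first exact: (measurableT_comp mg).
  exact: measurable_bkernel.
(* Read in the other order, the integrand applies the projection to [v], where it acts as the
   identity. *)
have fE z w : f (z, w) = complex.Re (conjc (g w) * (v z * bkernel w z)) * gauss w.
  rewrite /f/= -!Re_mulR.
  have -> : conjc (v z) * (g w * bkernel z w) * (gauss z)%:C =
      (conjc (v z) * g w) * (bkernel z w * (gauss z)%:C) by ring.
  rewrite bkernel_sym.
  have -> : conjc (v z) * g w * (conjc (bkernel w z) * (gauss w)%:C) =
      conjc (conjc (g w) * (v z * bkernel w z)) * (gauss w)%:C.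
    by rewrite !conj_mulC conjcK; ring.
  by rewrite !Re_mulR; case: (conjc (g w) * _).
(* AM-GM separates the two functions; each term has a finite double integral by [integral_egauss_l],
   up to exchanging the variables. *)
have fle z w : `|f (z, w)| <= egauss z w * (normc (v z) ^+ 2 * gauss z) +
    egauss z w * (normc (g w) ^+ 2 * gauss w).
  rewrite /f/= normrM (ger0_norm (gauss_nneg _)).
  apply: (@le_trans _ _ (normc (conjc (v z) * (g w * bkernel z w)) * gauss z)).
    by rewrite ler_pM2r ?gauss_gt0// normc_Re_le.
  rewrite normcM normc_conj [normc (g w * _)]normcM normc_bkernelE -!hgauss_sqr.
  have hz := hgauss_gt0 z; have hw := hgauss_gt0 w; have E0 := egauss_gt0 z w.
  have -> : normc (v z) * (normc (g w) * (2^-1 * egauss z w * (hgauss w / hgauss z))) * hgauss z ^+ 2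
     = egauss z w * (2^-1 * ((normc (v z) * hgauss z) * (normc (g w) * hgauss w))).
    by field; rewrite gt_eqF.
  rewrite -mulrDr ler_pM2l// -!exprMn.
  move: (normc (v z) * hgauss z) (normc (g w) * hgauss w) => a b.
  have := sqr_ge0 (a - b); have := sqr_ge0 a; have := sqr_ge0 b; nra.
have mnv := measurable_norm2_fun mv; have mng := measurable_norm2_fun mg.
pose h1 (p : CplxB R * CplxB R) : R := egauss p.1 p.2 * (normc (v p.1) ^+ 2 * gauss (p.1 : C)).
pose h2 (p : CplxB R * CplxB R) : R := egauss p.1 p.2 * (normc (g p.2) ^+ 2 * gauss (p.2 : C)).
have mh1 : measurable_fun setT h1.
  apply: measurable_funM; first exact: measurable_egauss.
  exact: (measurableT_comp mnv).
have mh2 : measurable_fun setT h2.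
  apply: measurable_funM; first exact: measurable_egauss.
  exact: (measurableT_comp mng).
have h10 p : 0 <= h1 p by rewrite mulr_ge0 ?norm2_fun_ge0// ltW// egauss_gt0.
have h20 p : 0 <= h2 p by rewrite mulr_ge0 ?norm2_fun_ge0// ltW// egauss_gt0.
have finf : (\int[dA]_z \int[dA]_w `|f (z, w)|%:E < +oo)%E.
  apply: (@le_lt_trans _ _ (\int[dA]_z ((\int[dA]_w (h1 (z, w))%:E) + \int[dA]_w (h2 (z, w))%:E))%E).
    apply: ge0_le_integral => //.
    - by move=> z _; apply: integral_ge0 => w _; rewrite lee_fin.
    - apply: (measurable_integral_dA (f := fun p : CplxB R * CplxB R => `|f p|%:E)) => //.
      by apply/measurable_EFinP; exact: measurableT_comp.
    - apply: emeasurable_funD.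
        apply: (measurable_integral_dA (f := fun p : CplxB R * CplxB R => (h1 p)%:E)) => //.
        exact/measurable_EFinP.
      apply: (measurable_integral_dA (f := fun p : CplxB R * CplxB R => (h2 p)%:E)) => //.
      exact/measurable_EFinP.
    - move=> z _; rewrite -ge0_integralD//.
      + apply: ge0_le_integral => //.
        * apply/measurable_EFinP; apply: measurableT_comp => //.
          exact: (measurableT_comp mf (pair1_measurable z)).
        * by apply: emeasurable_funD; apply/measurable_EFinP;
            [exact: (measurableT_comp mh1 (pair1_measurable z))|exact: (measurableT_comp mh2 (pair1_measurable z))].
        * by move=> w _; rewrite -EFinD lee_fin fle.
      + by move=> w _; rewrite lee_fin.
      + by apply/measurable_EFinP; exact: (measurableT_comp mh1 (pair1_measurable z)).
      + by move=> w _; rewrite lee_fin.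
      + by apply/measurable_EFinP; exact: (measurableT_comp mh2 (pair1_measurable z)).
  rewrite ge0_integralD//; last 4 first.
  - by move=> z _; apply: integral_ge0 => w _; rewrite lee_fin.
  - apply: (measurable_integral_dA (f := fun p : CplxB R * CplxB R => (h1 p)%:E)) => //.
    exact/measurable_EFinP.
  - by move=> z _; apply: integral_ge0 => w _; rewrite lee_fin.
  - apply: (measurable_integral_dA (f := fun p : CplxB R * CplxB R => (h2 p)%:E)) => //.
    exact/measurable_EFinP.
  have lt4 (a : \bar R) : (a < +oo -> 4%:E * a < +oo)%E.
    by move=> aoo; apply: lte_mul_pinfty.
  have E2 : (\int[dA]_z \int[dA]_w (h2 (z, w))%:E)%E = (4%:E * norm2 g)%E.
    exact: (integral_egauss_l mg).
  rewrite E2; apply: lte_add_pinfty; last exact: lt4.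
  rewrite (dA_tonelli (f := fun p => (h1 p)%:E)); last 2 first.
  - exact/measurable_EFinP.
  - by move=> p; rewrite lee_fin.
  apply: le_lt_trans (lt4 _ vfin); rewrite le_eqVlt; apply/orP; left; apply/eqP.
  rewrite -(integral_egauss_l mv); apply: eq_integral => w _; apply: eq_integral => z _.
  by rewrite /h1/= /egauss normcB.
have := dA_fubini mf finf.
rewrite (_ : (\int[dA]_z \int[dA]_w (f (z, w))%:E)%E = norm2 v); last first.
  apply: eq_integral => z _.
  have Ib := integrable_bkernel z mg fin.
  transitivity ((\int[dA]_w complex.Re (conjc (v z) * (g w * bkernel z w)) * gauss (z : C))%:E).
    rewrite EFinM /Rintegral fineK; last first.
      by apply: integrable_fin_num => //; exact: (integrableC_Re (integrableCZ _ Ib)).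
    rewrite -integralZr//; exact: (integrableC_Re (integrableCZ _ Ib)).
  congr (_%:E); congr (_ * _).
  have := congr1 (@complex.Re R) (integralCZ (conjc (v z)) Ib).
  rewrite (_ : integralC _ _ = v z)// conj_mul => E; exact/esym.
move=> ->; apply: eq_integral => w _.
have Ib := integrable_bkernel w mv vfin.
under eq_integral do rewrite fE EFinM.
rewrite integralZr//; last exact: (integrableC_Re (integrableCZ _ Ib)).
rewrite EFinM; congr (_ * _)%E.
have := congr1 (@complex.Re R) (integralCZ (conjc (g w)) Ib).
rewrite (_ : integralC _ (fun w0 => v w0 * bkernel w w0) = v w); last by rewrite -[in RHS]vv.
move=> ->; rewrite /= /Rintegral fineK//.
by apply: integrable_fin_num => //; exact: (integrableC_Re (integrableCZ _ Ib)).
Qed.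

(** From [|Pg|^2 = Re <g, Pg> <= (|g|^2 + |Pg|^2) / 2], where the finite term [|Pg|^2 / 2] can be
    subtracted. *)
Lemma norm2_bproj_le g : mfun g -> (norm2 g < +oo)%E -> (norm2 (bproj g) <= norm2 g)%E.
Proof.
move=> mg fin; have vfin := norm2_bproj_lty mg fin.
have ev := bproj_entire mg fin; have mv := entire_measurable ev.
have mng := measurable_norm2_fun mg; have mnv := measurable_norm2_fun mv.
have : (norm2 (bproj g) <= 2^-1%:E * (norm2 g + norm2 (bproj g)))%E.
  rewrite {1}norm2_bproj_inner//.
  have E : (2^-1%:E * (norm2 g + norm2 (bproj g)) =
    \int[dA]_w (2^-1 * (normc (g w) ^+ 2 * gauss (w : C) + normc (bproj g w) ^+ 2 * gauss (w : C)))%:E)%E.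
    rewrite -ge0_integralD//; last 4 first.
    - by move=> w _; rewrite lee_fin norm2_fun_ge0.
    - exact/measurable_EFinP.
    - by move=> w _; rewrite lee_fin norm2_fun_ge0.
    - exact/measurable_EFinP.
    rewrite -ge0_integralZl//.
    - by apply: emeasurable_funD; exact/measurable_EFinP.
    - by move=> w _; rewrite -EFinD lee_fin addr_ge0// norm2_fun_ge0.
  have Ifin : (\int[dA]_w (2^-1 * (normc (g w) ^+ 2 * gauss (w : C) + normc (bproj g w) ^+ 2 * gauss (w : C)))%:E < +oo)%E.
    by rewrite -E lte_mul_pinfty ?lee_fin// lte_add_pinfty.
  have mh : measurable_fun setT (fun w : CplxB R => 2^-1 * (normc (g w) ^+ 2 * gauss (w : C) + normc (bproj g w) ^+ 2 * gauss (w : C))).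
    by apply: measurable_funM => //; exact: measurable_funD.
  have le w : `|complex.Re (conjc (g w) * bproj g w) * gauss w| <=
      2^-1 * (normc (g w) ^+ 2 * gauss w + normc (bproj g w) ^+ 2 * gauss w).
    rewrite normrM (ger0_norm (gauss_nneg _)) -mulrDl mulrA ler_pM2r ?gauss_gt0//.
    apply: le_trans (normc_Re_le _) _; rewrite normcM normc_conj.
    have := sqr_ge0 (normc (g w) - normc (bproj g w)); lra.
  rewrite E; apply: le_integral => //.
  - apply: (integrable_of_le _ mh le Ifin).
    apply: measurable_funM; last exact: measurable_gauss_fun.
    apply: measurable_cplxRe; apply: measurable_cplxM => //.
    exact: measurable_cplxconj.
  - apply: (integrable_of_le mh mh _ Ifin) => w.
    by rewrite ger0_norm// mulr_ge0// addr_ge0// norm2_fun_ge0.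
  - by move=> w _; rewrite lee_fin (le_trans (ler_norm _)).
have := norm2_ge0 (bproj g); have := norm2_ge0 g; move: fin vfin.
move: (norm2 g) (norm2 (bproj g)) => [a| |]// [b| |]//= _ _; rewrite !lee_fin => *.
lra.
Qed.

End contraction.

(** * Maximum principle and averages of log over roots of unity *)

Section log_subharmonic.
Variable R : realType.
Local Notation C := (Cplx R).
Local Notation mfun f := (measurable_fun setT (f : CplxB R -> CplxB R)).
Implicit Types f g h : C -> C.

(** After a rotation making [h 0] positive, the real circle mean equals [|h 0|] and is at most
    [X]. *)
Lemma circle_max_principle h (w : C) (X : R) : entire h ->
  (forall t, 0 <= t -> normc (h (w * expi t)) <= X) -> normc (h 0) <= X.
Proof.
move=> eh hX; have [h0|h0] := eqVneq (h 0) 0.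
  by rewrite h0 normc0 (le_trans _ (hX 0 _))// normc_ge0.
have n0 : normc (h 0) != 0 by apply: contra h0 => /eqP/eq0_normc ->.
pose c : C := conjc (h 0) / (normc (h 0))%:C.
have c1 : normc c = 1.
  by rewrite normcM normcV normcR ger0_norm ?normc_ge0// normc_conj mulfV.
have ch : c * h 0 = (normc (h 0))%:C.
  rewrite /c mulrAC conj_mul expr2 rmorphM/= mulfK//.
  by apply: contra n0 => /eqP/complexI ->.
have ech : entire (fun z => c * h z) by exact: (entireM (@entire_cst R c) eh).
have := circle_mean_value_Re w ech; rewrite ch /= => E.
have pi2 : 0 < 2 * pi :> R by rewrite mulr_gt0// pi_gt0.
rewrite -(ler_pM2l pi2) -E -[2 * pi in leRHS]subr0 [leRHS]mulrC.
apply: le_trans (ler_norm _) _; apply: Rintegral_bound; last 1 first.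
- move=> t /andP[t0 _]; apply: le_trans (normc_Re_le _) _.
  by rewrite normcM c1 mul1r hX.
- exact: (@continuous_circle _ (fun z => c * h z)).
- exact: ltW.
Qed.

Lemma entire_prod (F : nat -> C -> C) N : (forall k, entire (F k)) ->
  entire (fun z => \prod_(k < N) F k z).
Proof.
move=> eF; elim: N => [|N IH].
  by under eq_fun do rewrite big_ord0; exact: entire_cst.
by under eq_fun do rewrite big_ord_recr/=; exact: (entireM IH (eF N)).
Qed.

Lemma sum_shift (G : nat -> R) N : G N = G 0%N ->
  \sum_(k < N) G k.+1 = \sum_(k < N) G k.
Proof.
move=> GN; have : \sum_(k < N.+1) G k = \sum_(k < N.+1) G k by [].
rewrite {1}big_ord_recl big_ord_recr [nat_of_ord ord_max]/= GN.
have -> : \sum_(k < N) G k.+1 = \sum_(k < N) G (lift ord0 k) by exact: eq_bigr.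
by rewrite [nat_of_ord ord0]/= => H; apply: (addrI (G 0%N)); rewrite H addrC.
Qed.

Lemma normc_prod (F : nat -> C) N :
  normc (\prod_(k < N) F k) = \prod_(k < N) normc (F k).
Proof.
elim: N => [|N IH]; first by rewrite !big_ord0 normc1.
by rewrite !big_ord_recr/= normcM IH.
Qed.

Lemma expiX (t : R) n : expi t ^+ n = expi (n%:R * t).
Proof.
elim: n => [|n IH]; first by rewrite expr0 mul0r /expi cos0 sin0.
by rewrite exprS IH -expiD -natr1 mulrDl mul1r addrC.
Qed.

Lemma expi2pi : expi (2 * pi) = 1 :> C.
Proof. by rewrite /expi [2 * pi]mulr_natl cos2pi sin2pi. Qed.

(* The product of h over the N-th roots of unity is entire, so the maximum principle compares
   its value at 0 with Riemann sums of log |h|^2 over circles. *)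
Lemma log_subharmonic_grid h (e r K : R) (w : C) (N : nat) : entire h -> h 0 != 0 ->
  0 < e -> (0 < N)%N -> 0 <= r -> 0 <= K -> normc w <= r ->
  let L z := ln (normc (h z) ^+ 2 + e) in
  (forall z z', normc z <= r -> normc z' <= r -> `|L z - L z'| <= K * normc (z - z')) ->
  N%:R * ln (normc (h 0) ^+ 2) <=
  \sum_(k < N) L (expi (2 * pi / N%:R) ^+ k * w) + 4 * pi * r * K.
Proof.
move=> eh h0 e0 N0 r0 K0 wr L Llip; set om := expi _.
have NR : 0 < N%:R :> R by rewrite ltr0n.
have omN : om ^+ N = 1.
  by rewrite expiX mulrC divfK ?gt_eqF// expi2pi.
have om1 k : normc (om ^+ k) = 1 by rewrite expiX normc_expi.
set S := \sum_(k < N) L (om ^+ k * w).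
have p0 : 0 < pi :> R by exact: pi_gt0.
(* Multiplying by a power of [om] permutes the grid cyclically. *)
have shift m u : \sum_(k < N) L (om ^+ (k + m) * u) = \sum_(k < N) L (om ^+ k * u).
  elim: m => [|m <-]; first by apply: eq_bigr => k _; rewrite addn0.
  rewrite -(@sum_shift (fun k => L (om ^+ (k + m) * u))).
    by apply: eq_bigr => k _; rewrite addSnnS.
  by rewrite exprD omN mul1r.
have bound t : 0 <= t -> \sum_(k < N) L (om ^+ k * (w * expi t)) <= S + 4 * pi * r * K.
  (* Modulo the grid the angle may be taken as [s <= 2 pi / N]. Each of the [N] points then moves by
     at most [4 pi r / N], so the total error [4 pi r K] does not depend on [N]. *)
  move=> t0; pose m := Num.truncn (t / (2 * pi / N%:R)); pose s := t - m%:R * (2 * pi / N%:R).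
  have d0 : 0 < 2 * pi / N%:R :> R by rewrite divr_gt0// mulr_gt0.
  have s0 : 0 <= s <= 2 * pi / N%:R.
    have := truncn_itv (divr_ge0 t0 (ltW d0)); rewrite -/m => /andP[].
    by rewrite ler_pdivlMr// ltr_pdivrMr// -natr1 mulrDl mul1r /s; lra.
  have -> : expi t = om ^+ m * expi s by rewrite expiX -expiD /s addrC subrK.
  have -> : \sum_(k < N) L (om ^+ k * (w * (om ^+ m * expi s))) =
            \sum_(k < N) L (om ^+ (k + m) * (w * expi s)).
    by apply: eq_bigr => k _; rewrite exprD; congr L; ring.
  rewrite shift.
  have -> : S + 4 * pi * r * K = \sum_(k < N) (L (om ^+ k * w) + 4 * pi * r * K / N%:R).
    rewrite big_split/= sumr_const card_ord -[_ *+ N]mulr_natr divfK// gt_eqF//.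
  apply: ler_sum => k _.
  have := Llip (om ^+ k * (w * expi s)) (om ^+ k * w).
  rewrite !normcM om1 normc_expi mul1r mulr1 -mulrBr normcM om1 mul1r.
  move=> /(_ wr wr); rewrite ler_norml => /andP[_ +].
  have : normc (w * expi s - w) <= r * (2 * (2 * pi / N%:R)).
    rewrite -[X in _ - X]mulr1 -mulrBr normcM; apply: ler_pM; rewrite ?normc_ge0//.
    have := expi_lip s 0; rewrite [expi 0](_ : _ = 1); last by rewrite /expi cos0 sin0.
    move=> /le_trans; apply; rewrite subr0 ler_pM2l//.
    by case/andP: s0 => s0 s1; rewrite ger0_norm.
  move=> /(ler_wpM2l K0).
  have -> : K * (r * (2 * (2 * pi / N%:R))) = 4 * pi * r * K / N%:R.
    by move: (pi : R) => p; field; rewrite gt_eqF.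
  lra.
pose H z := \prod_(k < N) h (om ^+ k * z).
have eH : entire H.
  apply: (@entire_prod (fun k z => h (om ^+ k * z))) => k.
  apply: (entire_comp eh (g := fun z => om ^+ k * z)).
  exact: (entireM (@entire_cst R (om ^+ k)) (@entire_id R)).
pose X := expR (S + 4 * pi * r * K).
have pos z : 0 < normc (h z) ^+ 2 + e by rewrite ltr_wpDl// sqr_ge0.
(* The sum of the [L] values bounds the logarithm of [|H|^2], hence the square root; adding [e] only
   increases each factor. *)
have HX t : 0 <= t -> normc (H (w * expi t)) <= Num.sqrt X.
  move=> t0; rewrite -[leLHS]ger0_norm ?normc_ge0// -sqrtr_sqr ler_sqrt ?expR_ge0//.
  apply: le_trans (_ : expR (\sum_(k < N) L (om ^+ k * (w * expi t))) <= _); last first.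
    by rewrite ler_expR bound.
  rewrite expR_sum (@normc_prod (fun k => h (om ^+ k * (w * expi t)))) -prodrXl.
  apply: ler_prod => k _; rewrite sqr_ge0/= /L lnK ?posrE//.
  by rewrite lerDl ltW.
have := circle_max_principle eH HX.
rewrite /H; under eq_bigr do rewrite mulr0.
rewrite (@normc_prod (fun=> h 0)) prodr_const card_ord => H0.
have hp : 0 < normc (h 0).
  by rewrite lt_def normc_ge0 andbT; apply: contra h0 => /eqP/eq0_normc ->.
rewrite mulr_natl -lnXn ?exprn_gt0// -ler_expR lnK ?posrE ?exprn_gt0//.
rewrite -exprM mulnC exprM -/X -[X in _ <= X]sqr_sqrtr ?expR_ge0//.
by rewrite ler_sqr ?nnegrE ?sqrtr_ge0// exprn_ge0// normc_ge0.
Qed.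

End log_subharmonic.

(** * Local Lipschitz bounds and the mean of log over a disc *)

Section log_subharmonic_mean.
Variable R : realType.
Local Notation C := (Cplx R).
Local Notation mfun f := (measurable_fun setT (f : CplxB R -> CplxB R)).
Implicit Types f g h : C -> C.

Lemma normc_half (z : C) : normc (z / 2) = normc z / 2.
Proof. by rewrite -invr2C normcM normcR ger0_norm// invr_ge0. Qed.

Lemma expCB1_le (u : C) : normc (expC u - 1) <= 4 * normc u * expR (2 * normc u).
Proof.
have := le_normcD (expC u - 1 - u) u; rewrite subrK.
have := expC_taylor1 u; have := normc_ge0 u; move: (normc u) => x x0.
move=> h1 h2.
have e1 : 1 + x <= expR x by exact: expR_ge1Dx.
have -> : expR (2 * x) = expR x * expR x by rewrite -expRD; congr expR; ring.
move: h1 e1; move: (expR x) => E h1 e1.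
have E0 : 0 <= E by lra.
have : x * (x * E) <= x * (E * E) by apply: ler_wpM2l => //; apply: ler_wpM2r => //; lra.
have : x * 1 <= x * (E * E) by apply: ler_wpM2l => //; nra.
lra.
Qed.

(** Factor out [e^b] and apply [expCB1_le] to [u], which is proportional to [z - z']. In the
    exponent [r] bounds [|b|], [2 r] bounds [2 |u|], and 1 absorbs the factor [|w|] of [u]. *)
Lemma bkernel_lip (r : R) (z z' w : C) : 0 <= r -> normc z <= r -> normc z' <= r ->
  normc (bkernel z w - bkernel z' w) <=
  normc (z - z') * (expR ((3 * r + 1) * normc w) * gauss w).
Proof.
move=> r0 zr z'r; pose b : C := z' * conjc w / 2; pose u : C := (z - z') * conjc w / 2.
have -> : bkernel z w - bkernel z' w = expC b * (expC u - 1) * (2^-1 * gauss w)%:C.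
  rewrite /bkernel (_ : z * conjc w / 2 = b + u) ?expCD; last by rewrite /b /u; ring.
  by rewrite -/b; ring.
have g0 := gauss_nneg w.
rewrite !normcM normcR ger0_norm; last by rewrite mulr_ge0// invr_ge0.
have n0 := normc_ge0 w; have d0 := normc_ge0 (z - z').
have zz' : normc (z - z') <= 2 * r.
  by have := le_normcD z (- z'); rewrite normcN; lra.
have un : normc u = normc (z - z') * normc w / 2 by rewrite /u normc_half normcM normc_conj.
have bn : normc b <= r * normc w.
  rewrite /b normc_half normcM normc_conj.
  have : normc z' * normc w <= r * normc w by exact: ler_wpM2r.
  have : 0 <= normc z' * normc w by rewrite mulr_ge0 ?normc_ge0.
  lra.
have ur : normc u <= r * normc w.
  by rewrite un; have : normc (z - z') * normc w <= 2 * r * normc w; [exact: ler_wpM2r|lra].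
have h1 : normc (expC b) <= expR (r * normc w).
  by rewrite normc_expC ler_expR (le_trans _ bn)// (le_trans (ler_norm _))// normc_Re_le.
have h2 : normc (expC u - 1) <= 2 * (normc (z - z') * normc w) * expR (2 * (r * normc w)).
  apply: le_trans (expCB1_le u) _; rewrite [4 * normc u](_ : _ = 2 * (normc (z - z') * normc w)); last by rewrite un; field.
  by apply: ler_wpM2l; [rewrite !mulr_ge0|rewrite ler_expR ler_pM2l].
have nw : normc w <= expR (normc w) by apply: le_trans (expR_ge1Dx _); rewrite lerDr.
have -> : expR ((3 * r + 1) * normc w) = expR (r * normc w) * expR (2 * (r * normc w)) * expR (normc w).
  by rewrite -!expRD; congr expR; ring.
apply: (@le_trans _ _ (expR (r * normc w) * (2 * (normc (z - z') * normc w) * expR (2 * (r * normc w))) * (2^-1 * gauss w))).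
  apply: ler_wpM2r; first by rewrite mulr_ge0// invr_ge0.
  by apply: ler_pM => //; exact: normc_ge0.
have -> : expR (r * normc w) * (2 * (normc (z - z') * normc w) * expR (2 * (r * normc w))) * (2^-1 * gauss w)
  = normc w * (normc (z - z') * (expR (r * normc w) * expR (2 * (r * normc w))) * gauss w).
  by field.
have -> : normc (z - z') * (expR (r * normc w) * expR (2 * (r * normc w)) * expR (normc w) * gauss w)
  = expR (normc w) * (normc (z - z') * (expR (r * normc w) * expR (2 * (r * normc w))) * gauss w) by ring.
by apply: ler_wpM2r => //; rewrite !mulr_ge0 ?expR_ge0.
Qed.

(** Applied to an entire function, which is its own projection, this gives the Lipschitz bound on
    discs required by the grid estimate. *)
Lemma bproj_lip g (r : R) : mfun g -> (norm2 g < +oo)%E -> 0 <= r ->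
  exists2 K : R, 0 <= K & forall z z', normc z <= r -> normc z' <= r ->
    normc (bproj g z - bproj g z') <= K * normc (z - z').
Proof.
move=> mg fin r0.
pose B w := normc (g w) * expR ((3 * r + 1) * normc w) * gauss w.
have mB : measurable_fun setT (B : CplxB R -> R).
  apply: measurable_funM; last exact: measurable_gauss_fun.
  apply: measurable_funM; first exact: measurable_cplxnormc.
  apply: measurableT_comp => //; apply: measurable_funM => //.
  exact: measurable_normc.
have B0 w : 0 <= B w by rewrite !mulr_ge0 ?normc_ge0 ?expR_ge0 ?gauss_nneg.
have Bfin : (\int[dA]_w (B w)%:E < +oo)%E by exact: norm2_exp_integrable.
pose M := fine (\int[dA]_w (B w)%:E)%E.
have ME : (\int[dA]_w (B w)%:E = M%:E)%E.
  by rewrite fineK// ge0_fin_numE//; apply: integral_ge0 => w _; rewrite lee_fin.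
exists M; first by rewrite fine_ge0// integral_ge0// => w _; rewrite lee_fin.
move=> z z' zr z'r.
pose F w := g w * bkernel z w + (-1) * (g w * bkernel z' w).
have Iz := integrable_bkernel z mg fin; have Iz' := integrable_bkernel z' mg fin.
have IF : integrableC dA F := integrableCD Iz (integrableCZ (-1) Iz').
have -> : bproj g z - bproj g z' = integralC dA F.
  by rewrite integralCD//; [rewrite -integralCZ// mulN1r|exact: integrableCZ].
have mF : mfun F by case: IF.
rewrite -lee_fin; apply: le_trans (normc_integralC_le _ mF) _.
rewrite mulrC EFinM -ME -ge0_integralZl//; last 3 first.
- exact/measurable_EFinP.
- by move=> w _; rewrite lee_fin.
- by rewrite lee_fin normc_ge0.
apply: ge0_le_integral => //.
- by move=> w _; rewrite lee_fin normc_ge0.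
- by apply/measurable_EFinP; exact: measurable_cplxnormc.
- by apply: emeasurable_funM => //; exact/measurable_EFinP.
move=> w _; rewrite -EFinM lee_fin /F mulN1r -mulrBr normcM /B.
rewrite -mulrA mulrCA; apply: ler_wpM2l; first exact: normc_ge0.
exact: bkernel_lip.
Qed.

Lemma ln_lip (e x y : R) : 0 < e -> e <= x -> e <= y -> `|ln x - ln y| <= `|x - y| / e.
Proof.
move=> e0; wlog yx : x y / y <= x.
  move=> H ex ey; have [|/ltW] := leP y x; first by move=> /H; apply.
  by move=> /H; rewrite distrC [`|x - y|]distrC; apply.
move=> ex ey; have x0 : 0 < x := lt_le_trans e0 ex; have y0 : 0 < y := lt_le_trans e0 ey.
have lyx : ln y <= ln x by rewrite ler_ln ?posrE.
rewrite !ger0_norm ?subr_ge0// -ln_div ?posrE//.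
have y0' := ltW y0.
have q : -1 < (x - y) / y by rewrite (lt_le_trans (ltrN10 _))// divr_ge0 ?subr_ge0.
have := le_ln1Dx q; rewrite (_ : 1 + _ = x / y); last by field; rewrite gt_eqF.
move=> /le_trans; apply; rewrite ler_wpM2l ?subr_ge0//.
by rewrite lef_pV2 ?posrE.
Qed.

Lemma ln_normc_lip h (e r : R) : entire h -> (norm2 h < +oo)%E -> 0 < e -> 0 <= r ->
  exists2 K : R, 0 <= K & forall z z', normc z <= r -> normc z' <= r ->
    `|ln (normc (h z) ^+ 2 + e) - ln (normc (h z') ^+ 2 + e)| <= K * normc (z - z').
Proof.
move=> eh fin e0 r0.
have [K K0] := bproj_lip (entire_measurable eh) fin r0.
rewrite (bproj_entire_id eh fin) => H.
pose b := normc (h 0) + K * r.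
have hb z : normc z <= r -> normc (h z) <= b.
  move=> zr; have := H z 0 zr; rewrite normc0 => /(_ r0); rewrite subr0 => hz.
  have := le_normcD (h z - h 0) (h 0); rewrite subrK /b.
  by have : K * normc z <= K * r; [exact: ler_wpM2l|lra].
have b0 : 0 <= b by rewrite addr_ge0 ?mulr_ge0 ?normc_ge0.
have e0' := ltW e0.
exists (2 * b * K / e); first by rewrite divr_ge0 ?mulr_ge0.
move=> z z' zr z'r; apply: le_trans (ln_lip e0 _ _) _; rewrite ?lerDr ?sqr_ge0//.
rewrite [leRHS]mulrAC ler_pM2r ?invr_gt0//.
rewrite opprD addrACA subrr addr0 subr_sqr normrM mulrC -[leRHS]mulrA.
have hz := hb z zr; have hz' := hb z' z'r.
have n1 := normc_ge0 (h z); have n2 := normc_ge0 (h z').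
apply: ler_pM => //; first by rewrite ger0_norm; lra.
apply: le_trans (H z z' zr z'r).
have := le_normcD (h z - h z') (h z'); have := le_normcD (h z' - h z) (h z).
by rewrite !subrK normcB ler_norml; lra.
Qed.

Lemma integrable_disc (r M : R) (u : CplxB R -> R) : measurable_fun setT u ->
  (forall w : C, normc w < r -> `|u w| <= M) ->
  dA.-integrable (discC 0 r : set (CplxB R)) (EFin \o u).
Proof.
move=> mu uM; apply: measurable_bounded_integrable.
- exact: measurable_disc.
- exact: dA_disc0_lty.
- exact: measurable_funTS.
exists M; split; first exact: num_real.
by move=> x Mx y; rewrite /discC/= subr0 => /uM /le_trans; apply; exact: ltW.
Qed.

(** Integrate the grid estimate over the disc: by rotation invariance the [N] terms have equal
    integrals, so [N] times the defect is bounded by a constant independent of [N]. A positive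
    defect would be contradicted by a large [N]. *)
Lemma log_subharmonic_disc h (e r : R) : entire h -> (norm2 h < +oo)%E -> h 0 != 0 ->
  0 < e -> 0 <= r ->
  fine (dA (discC 0 r : set (CplxB R))) * ln (normc (h 0) ^+ 2) <=
  \int[dA]_(w in (discC 0 r : set (CplxB R))) ln (normc (h w) ^+ 2 + e).
Proof.
move=> eh fin h0 e0 r0; set B : set (CplxB R) := discC 0 r; set a := fine _.
pose L w := ln (normc (h w) ^+ 2 + e).
have [K K0 Llip] := ln_normc_lip eh fin e0 r0.
have mB : measurable B by exact: measurable_disc.
have mL : measurable_fun setT (L : CplxB R -> R).
  apply: measurableT_comp => //; apply: measurable_funD => //; apply: measurable_funX.
  by apply: measurable_cplxnormc; exact: entire_measurable.
have Lb w : normc w < r -> `|L w| <= `|L 0| + K * r.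
  move=> wr; have := Llip w 0 (ltW wr); rewrite normc0 => /(_ r0).
  rewrite subr0 -/(L w) -/(L 0) => H; have := ler_normD (L w - L 0) (L 0); rewrite subrK.
  have : K * normc w <= K * r by apply: ler_wpM2l => //; exact: ltW.
  lra.
pose rot N (k : nat) : C := expi (2 * pi / N%:R) ^+ k.
have rot1 N k : normc (rot N k) = 1 by rewrite /rot expiX normc_expi.
have mrot (u : C) : measurable_fun setT (fun w : CplxB R => u * w : CplxB R) by exact: measurable_cplxM.
have ILk N k : dA.-integrable B (EFin \o (fun w => L (rot N k * w))).
  apply: (@integrable_disc _ (`|L 0| + K * r)); first exact: (measurableT_comp mL (mrot _)).
  by move=> w wr; apply: Lb; rewrite normcM rot1 mul1r.
have rotint N k : \int[dA]_(w in B) L (rot N k * w) = \int[dA]_(w in B) L w.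
  rewrite /Rintegral; congr fine; rewrite integral_mkcond [RHS]integral_mkcond.
  have mLB : measurable_fun setT ((fun w => (L w)%:E) \_ B).
    apply/(measurable_restrictT _ _).1 => //; apply/measurable_EFinP; exact: measurable_funTS.
  rewrite -(integral_dA_rotation (rot1 N k) mLB); apply: eq_integral => w _.
  rewrite !patchE (_ : (rot N k * w \in B) = (w \in B))//.
  by rewrite /B; apply/idP/idP; rewrite !inE /discC/= !subr0 normcM rot1 mul1r.
have main N : N%:R * (a * ln (normc (h 0) ^+ 2) - \int[dA]_(w in B) L w) <= 4 * pi * r * K * a.
  case: N => [|N].
    by rewrite mul0r !mulr_ge0 ?pi_ge0// fine_ge0.
  have afin : dA B = a%:E by rewrite fineK// ge0_fin_numE ?dA_disc0_lty.
  pose S n : CplxB R -> R := fun w => \sum_(k < n) L (rot N.+1 k * w).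
  have S0 : S 0%N = fun=> 0 by apply/funext => w; rewrite /S big_ord0.
  have SS n : S n.+1 = fun w => S n w + L (rot N.+1 n * w).
    by apply/funext => w; rewrite /S big_ord_recr.
  have sumint n : dA.-integrable B (EFin \o S n) /\
      \int[dA]_(w in B) S n w = n%:R * \int[dA]_(w in B) L w.
    elim: n => [|n [IH1 IH2]].
      rewrite S0 Rintegral_cst// !mul0r; split => //.
      by apply: (@integrable_disc _ 0) => // w _; rewrite normr0.
    rewrite SS; split; first by have := integrableD mB IH1 (ILk N.+1 n).
    by rewrite RintegralD// IH2 rotint -natr1 mulrDl mul1r.
  have [I1 I2] := sumint N.+1.
  have Icst (c : R) : dA.-integrable B (EFin \o (fun=> c)).
    by apply: (@integrable_disc _ `|c|).
  have : \int[dA]_(w in B) (N.+1%:R * ln (normc (h 0) ^+ 2)) <=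
         \int[dA]_(w in B) (S N.+1 w + 4 * pi * r * K).
    apply: le_Rintegral => //.
      by have := integrableD mB I1 (Icst (4 * pi * r * K)).
    move=> w; rewrite /B/discC/= subr0 => /ltW wr.
    by rewrite (log_subharmonic_grid eh h0 e0 _ r0 K0 wr Llip).
  rewrite RintegralD// I2 !Rintegral_cst// -/a.
  lra.
rewrite -subr_le0 leNgt; apply/negP => D0.
set D := a * _ - _ in D0 main.
have := main (Num.truncn (4 * pi * r * K * a / D)).+1.
rewrite leNgt => /negP; apply; rewrite -ltr_pdivrMr//.
exact: truncnS_gt.
Qed.

End log_subharmonic_mean.

(** * Luecking's theorem for relatively dense sets *)

Section luecking.
Variable R : realType.
Local Notation C := (Cplx R).
Local Notation mfun f := (measurable_fun setT (f : CplxB R -> CplxB R)).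
Local Notation disc0 r := (discC (0 : C) r : set (CplxB R)).
Implicit Types f g h : C -> C.

Lemma entire_bounded_disc h (r : R) : entire h -> (norm2 h < +oo)%E ->
  exists2 b : R, 0 <= b & forall w, normc w < r -> normc (h w) ^+ 2 <= b.
Proof.
move=> eh fin; pose N := fine (norm2 h).
have NE : norm2 h = N%:E by rewrite fineK// ge0_fin_numE// norm2_ge0.
have N0 : 0 <= N by rewrite fine_ge0// norm2_ge0.
exists (N * expR (2^-1 * r ^+ 2)); first by rewrite mulr_ge0// expR_ge0.
move=> w wr; have := bproj_le_norm2 w (entire_measurable eh).
rewrite (bproj_entire_id eh fin) NE lee_fin gaussE expRN ler_pdivrMr ?expR_gt0//.
move=> /le_trans; apply; rewrite ler_wpM2l// ler_expR ler_pM2l// ler_sqr ?nnegrE ?normc_ge0 1?ltW//.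
by rewrite (le_lt_trans _ wr)// normc_ge0.
Qed.

(* Jensen's inequality for the probability measure dA/dA(B) on the disc B and a weight W
   of nonnegative logarithmic mean. *)
Lemma weighted_jensen_disc h (r k1 k2 : R) (W : CplxB R -> R) :
  entire h -> (norm2 h < +oo)%E -> 0 <= r -> 0 < k1 -> measurable_fun setT W ->
  (forall w, k1 <= W w <= k2) -> 0 <= \int[dA]_(w in disc0 r) ln (W w) ->
  fine (dA (disc0 r)) * normc (h 0) ^+ 2 <=
  \int[dA]_(w in disc0 r) (W w * normc (h w) ^+ 2).
Proof.
move=> eh fin r0 k10 mW Wk lnW; set B : set (CplxB R) := disc0 r; set a := fine _.
have mB : measurable B by exact: measurable_disc.
have a0 : 0 <= a by rewrite fine_ge0.
have W0 w : 0 < W w by have /andP[/(lt_le_trans k10)] := Wk w.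
have k20 : 0 < k2 by have /andP[h1 h2] := Wk 0; lra.
have WW w : 0 <= W w by rewrite ltW.
have R0 : 0 <= \int[dA]_(w in B) (W w * normc (h w) ^+ 2).
  by apply: Rintegral_ge0 => w _; rewrite mulr_ge0// sqr_ge0.
have [h0|h0] := eqVneq (h 0) 0; first by rewrite h0 normc0 expr0n mulr0.
have [a00|aN0] := eqVneq a 0; first by rewrite a00 mul0r.
have {aN0}a0 : 0 < a by rewrite lt_def aN0.
have [b b0 hb] := entire_bounded_disc r eh fin.
have mh : measurable_fun setT (fun w : CplxB R => normc (h w) ^+ 2).
  by apply: measurable_funX; apply: measurable_cplxnormc; exact: entire_measurable.
have mWh : measurable_fun setT (fun w : CplxB R => W w * normc (h w) ^+ 2) by exact: measurable_funM.
have Icst (c : R) : dA.-integrable B (EFin \o (fun=> c)).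
  by apply: (@integrable_disc _ _ `|c|).
have IW : dA.-integrable B (EFin \o W).
  by apply: (@integrable_disc _ _ k2) => // w _; rewrite ger0_norm//; case/andP: (Wk w).
have IWh : dA.-integrable B (EFin \o (fun w => W w * normc (h w) ^+ 2)).
  apply: (@integrable_disc _ _ (k2 * b)) => // w wr.
  rewrite ger0_norm; last by apply: mulr_ge0 => //; exact: sqr_ge0.
  apply: ler_pM; rewrite ?sqr_ge0 ?hb//.
  by case/andP: (Wk w).
have IlnW : dA.-integrable B (EFin \o (fun w => ln (W w))).
  apply: (@integrable_disc _ _ (`|ln k1| + `|ln k2|)); first exact: measurableT_comp.
  move=> w _; have /andP[w1 w2] := Wk w.
  have : ln k1 <= ln (W w) by rewrite ler_ln ?posrE.
  have : ln (W w) <= ln k2 by rewrite ler_ln ?posrE.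
  have := ler_norm (ln k2); have := ler_norm (- ln k1); rewrite normrN => *.
  have := normr_ge0 (ln k1); have := normr_ge0 (ln k2).
  by rewrite ler_norml; lra.
suff main e : 0 < e -> a * normc (h 0) ^+ 2 <=
    \int[dA]_(w in B) (W w * normc (h w) ^+ 2) + e * \int[dA]_(w in B) W w.
  rewrite leNgt; apply/negP; set X := \int[_]_(w in _) _; set Y := a * _ => XY.
  pose V := \int[dA]_(w in B) W w.
  have V0 : 0 <= V by apply: Rintegral_ge0.
  (* This value of [e] makes [e V <= (Y - X) / 2], incompatible with [X < Y]. *)
  have d0 : 0 < (Y - X) / (V + 1) / 2 by rewrite !divr_gt0 ?subr_gt0// ltr_wpDl.
  have := main _ d0; rewrite -/X -/Y -/V.
  have : (Y - X) / (V + 1) / 2 * V <= (Y - X) / 2.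
    rewrite mulrAC ler_pM2r ?invr_gt0// -mulrA ler_piMr ?subr_ge0 1?ltW//.
    by rewrite mulrC ltr_pdivrMr ?ltr_wpDl// mul1r ltrDl.
  lra.
move=> e0; pose Y w := normc (h w) ^+ 2 + e.
have Y0 w : 0 < Y w by rewrite ltr_wpDl// sqr_ge0.
have mY : measurable_fun setT (Y : CplxB R -> R) by exact: measurable_funD.
have IWY : dA.-integrable B (EFin \o (fun w => W w * Y w)).
  apply: (@integrable_disc _ _ (k2 * (b + e))); first exact: measurable_funM.
  move=> w wr; rewrite ger0_norm ?mulr_ge0 ?(ltW (Y0 w))//; apply: ler_pM => //.
  - by rewrite (ltW (Y0 w)).
  - by case/andP: (Wk w).
  - by rewrite lerD2r hb.
have IL : dA.-integrable B (EFin \o (fun w => ln (Y w))).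
  apply: (@integrable_disc _ _ (`|ln e| + `|ln (b + e)|)); first exact: measurableT_comp.
  move=> w wr; have hw := hb w wr.
  have : ln e <= ln (Y w) by rewrite ler_ln ?posrE// lerDr sqr_ge0.
  have : ln (Y w) <= ln (b + e) by rewrite ler_ln ?posrE ?lerD2r// ltr_wpDl.
  have := ler_norm (ln (b + e)); have := ler_norm (- ln e); rewrite normrN => *.
  have := normr_ge0 (ln e); have := normr_ge0 (ln (b + e)).
  by rewrite ler_norml; lra.
have -> : \int[dA]_(w in B) (W w * normc (h w) ^+ 2) + e * \int[dA]_(w in B) W w =
    \int[dA]_(w in B) (W w * Y w).
  rewrite -RintegralZl// -RintegralD//; last by have := integrableZl mB e IW.
  by apply: eq_Rintegral => w _; rewrite /Y; ring.
set I := \int[dA]_(w in B) (W w * Y w).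
have I0 : 0 < I.
  have : \int[dA]_(w in B) (k1 * e) <= I.
    apply: le_Rintegral => // w _; have /andP[w1 _] := Wk w.
    by apply: ler_pM; [exact: ltW|exact: ltW|exact: w1|rewrite lerDr sqr_ge0].
  by rewrite Rintegral_cst// -/a; apply: lt_le_trans; rewrite !mulr_gt0.
(* Jensen by a tangent line: [c] is the mean of [W Y], and [ln y <= y / c + ln c - 1] lies above the
   concave logarithm, touching it at [c]. *)
pose c := I / a; have c0 : 0 < c by rewrite divr_gt0.
have : \int[dA]_(w in B) (ln (W w) + ln (Y w)) <=
       \int[dA]_(w in B) (c^-1 * (W w * Y w) + (ln c - 1)).
  have I1 : dA.-integrable B (EFin \o (fun w => c^-1 * (W w * Y w))).
    by have := integrableZl mB c^-1 IWY.
  apply: le_Rintegral => //.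
  - by have := integrableD mB IlnW IL.
  - by have := integrableD mB I1 (Icst (ln c - 1)).
  move=> w _; have WY0 : 0 < W w * Y w by rewrite mulr_gt0.
  rewrite -lnM ?posrE//; have q : -1 < W w * Y w / c - 1.
    by rewrite ltrBDl addrN divr_gt0.
  have := le_ln1Dx q; rewrite addrC subrK ln_div ?posrE// [c^-1 * _]mulrC; lra.
rewrite RintegralD// RintegralD//; last by have := integrableZl mB c^-1 IWY.
rewrite RintegralZl// -/I Rintegral_cst// -/a.
have -> : c^-1 * I = a by rewrite /c; field; rewrite !gt_eqF.
have := log_subharmonic_disc eh fin h0 e0 r0; rewrite -/B -/a => H1 H2.
have H3 : a * ln (normc (h 0) ^+ 2) <= a * ln c by lra.
have hp : 0 < normc (h 0) ^+ 2.
  rewrite exprn_gt0// lt_def normc_ge0 andbT; apply: contra h0 => /eqP/eq0_normc ->.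
  exact: eqxx.
move: H3; rewrite ler_pM2l// ler_ln ?posrE// /c ler_pdivlMr//.
by rewrite mulrC.
Qed.

Variables (G : set (CplxB R)) (mG : measurable G).

(** The weighted Jensen inequality for [wtrans z f], whose value at 0 carries the weight of [f] at
    [z]. The translated function lacks a factor [gauss w], which is at least [e^{-r^2/2}] on the
    disc; this accounts for the exponential constant. *)
Lemma luecking_pointwise f (z : C) (r k1 k2 : R) : entire f -> (norm2 f < +oo)%E ->
  0 <= r -> 0 < k1 -> k1 <= k2 ->
  0 <= \int[dA]_(w in disc0 r) ln (k2 * \1_G (z + w) + k1 * (1 - \1_G (z + w))) ->
  ((fine (dA (disc0 r)))%:E * (normc (f z) ^+ 2 * gauss z)%:E <=
   \int[dA]_w ((expR (2^-1 * r ^+ 2) * (\1_(disc0 r) w * ((k2 * \1_G (z + w) + k1 * (1 - \1_G (z + w))) *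
     (normc (f (z + w)) ^+ 2 * gauss (z + w)))))%:E))%E.
Proof.
move=> ef fin r0 k10 k12 lnW; set B : set (CplxB R) := disc0 r.
have mB : measurable B by exact: measurable_disc.
pose h := wtrans z f.
have eh : entire h by exact: entire_wtrans.
have hfin : (norm2 h < +oo)%E by rewrite norm2_wtrans.
pose W w : R := k2 * \1_G (z + w) + k1 * (1 - \1_G (z + w)).
have mT : measurable_fun setT (fun w : CplxB R => z + w : CplxB R) by exact: measurable_cplxD.
have m1 : measurable_fun setT (fun w : CplxB R => \1_G (z + w) : R).
  exact: (measurableT_comp (measurable_indic mG) mT).
have mW : measurable_fun setT (W : CplxB R -> R).
  by apply: measurable_funD; apply: measurable_funM => //; exact: measurable_funB.
have Wk w : k1 <= W w <= k2.
  by rewrite /W indicE; case: (_ \in _) => /=; rewrite ?subrr ?subr0 ?mulr0 ?mulr1 ?addr0 ?add0r ?lexx ?k12.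
have := weighted_jensen_disc eh hfin r0 k10 mW Wk lnW.
have h0 : normc (h 0) ^+ 2 = normc (f z) ^+ 2 * gauss z.
  have := normc_wtrans z f 0; rewrite addr0 => <-.
  by rewrite gaussE normc0 expr0n mulr0 oppr0 expR0 mulr1.
rewrite h0 -lee_fin -EFinM => H; apply: le_trans H _.
have [b b0 hb] := entire_bounded_disc r eh hfin.
have mh : measurable_fun setT (fun w : CplxB R => normc (h w) ^+ 2).
  by apply: measurable_funX; apply: measurable_cplxnormc; exact: entire_measurable.
have WW w : 0 <= W w by case/andP: (Wk w) => ? _; lra.
rewrite /Rintegral fineK; last first.
  apply: integrable_fin_num => //; apply: (@integrable_disc _ _ (k2 * b)).
    exact: measurable_funM.
  move=> w wr; rewrite ger0_norm; last by apply: mulr_ge0 => //; exact: sqr_ge0.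
  apply: ler_pM; rewrite ?sqr_ge0 ?hb//.
  by case/andP: (Wk w).
have mF : measurable_fun setT (fun w : CplxB R => normc (f w) ^+ 2 * gauss (w : C)).
  exact: measurable_norm2_fun (entire_measurable ef).
have E0 : 0 <= expR (2^-1 * r ^+ 2) by exact: expR_ge0.
rewrite integral_mkcond; apply: ge0_le_integral => //.
- by move=> w _; rewrite patchE; case: ifPn => // _; rewrite lee_fin mulr_ge0// sqr_ge0.
- apply/(measurable_restrictT _ _).1 => //; apply/measurable_EFinP; apply: measurable_funTS.
  exact: measurable_funM.
- apply/measurable_EFinP; apply: measurable_funM => //; apply: measurable_funM => //.
  apply: measurable_funM => //; exact: (measurableT_comp mF mT).
move=> w _; rewrite patchE indicE; case: ifPn => wB; last by rewrite mul0r mulr0.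
rewrite lee_fin mul1r -/(W w) [leRHS]mulrCA; apply: ler_wpM2l => //.
rewrite -normc_wtrans -/h mulrC -mulrA ler_peMr ?sqr_ge0// gaussE -expRD -[leLHS]expR0 ler_expR.
move: wB; rewrite inE /B/discC/= subr0 => wr.
by rewrite addrC subr_ge0 ler_pM2l// ler_sqr ?nnegrE ?normc_ge0//; exact: ltW.
Qed.

(** Tonelli and translation invariance. *)
Lemma ge0_integral_convolution (r : R) (F : CplxB R -> R) : measurable_fun setT F ->
  (forall w, 0 <= F w) ->
  (\int[dA]_z \int[dA]_w (\1_(disc0 r) w * F (z + w)%R)%:E =
   dA (disc0 r) * \int[dA]_w (F w)%:E)%E.
Proof.
move=> mF F0; have mB : measurable (disc0 r) by exact: measurable_disc.
have mI : measurable_fun setT (\1_(disc0 r) : CplxB R -> R) by exact: measurable_indic.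
have I0 w : 0 <= \1_(disc0 r) w :> R by rewrite indicE.
pose H (p : CplxB R * CplxB R) : R := \1_(disc0 r) p.2 * F (p.1 + p.2).
have mH : measurable_fun setT H.
  apply: measurable_funM; first exact: (measurableT_comp mI).
  by apply: (measurableT_comp mF); exact: measurable_cplxD.
rewrite (dA_tonelli (f := fun p => (H p)%:E)); last 2 first.
- exact/measurable_EFinP.
- by move=> p; rewrite lee_fin mulr_ge0.
rewrite -[X in dA X]setIT -integral_indic// -ge0_integralZr//; last 2 first.
- exact/measurable_EFinP.
- by apply: integral_ge0 => w _; rewrite lee_fin.
apply: eq_integral => w _; rewrite /H/=.
have mEF : measurable_fun setT (fun w : CplxB R => (F w)%:E) by exact/measurable_EFinP.
rewrite -(integral_dA_translation w mEF) -ge0_integralZl//.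
- by apply: eq_integral => z _; rewrite -EFinM addrC.
- by apply: (measurableT_comp mEF); exact: measurable_cplxD.
- by move=> z _; rewrite lee_fin.
Qed.

Lemma luecking (r c : R) : 0 <= r -> 0 < c ->
  (forall z : C, (c%:E <= \int[dA]_w (\1_(disc0 r) w * \1_G (z + w)%R)%:E)%E) ->
  exists2 d : R, 0 < d & forall f, entire f -> (norm2 f < +oo)%E ->
    (d%:E * norm2 f <= \int[dA]_w (\1_G w * (normc (f w) ^+ 2 * gauss (w : C)))%:E)%E.
Proof.
move=> r0 c0 dens; set B : set (CplxB R) := disc0 r.
have mB : measurable B by exact: measurable_disc.
pose a := fine (dA B).
have aE : dA B = a%:E by rewrite fineK// ge0_fin_numE ?dA_disc0_lty.
have mI : measurable_fun setT (\1_B : CplxB R -> R) by exact: measurable_indic.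
have mIG : measurable_fun setT (\1_G : CplxB R -> R) by exact: measurable_indic.
have mT (z : C) : measurable_fun setT (fun w : CplxB R => z + w : CplxB R) by exact: measurable_cplxD.
pose M := expR (2^-1 * r ^+ 2); have M1 : 1 <= M.
  by rewrite -expR0 ler_expR mulr_ge0// sqr_ge0.
(* After integration over all centres the part off [G] is at most [M k1] times the norm; this choice
   makes it one half, which the left-hand side absorbs. *)
pose k1 := (2 * M)^-1.
have k10 : 0 < k1 by rewrite invr_gt0; lra.
have k11 : k1 <= 1 by rewrite invf_le1; lra.
have a0 : 0 <= a by rewrite fine_ge0.
have lk1 : ln k1 <= 0 by exact: ln_le0.
(* Chosen so that [c ln k2 + a ln k1 = 0]: as [G] has area at least [c] in every disc, the integral
   of [ln W] is nonnegative. *)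
pose k2 := expR (- (a * ln k1 / c)).
have k21 : 1 <= k2.
  by rewrite -expR0 ler_expR -mulNr -mulrN divr_ge0 ?mulr_ge0 ?oppr_ge0// ltW.
have k12 : k1 <= k2 by lra.
have lnW (z : C) : 0 <= \int[dA]_(w in B) ln (k2 * \1_G (z + w) + k1 * (1 - \1_G (z + w))).
  have -> : (fun w : CplxB R => ln (k2 * \1_G (z + w) + k1 * (1 - \1_G (z + w)))) =
      (fun w : CplxB R => (ln k2 - ln k1) * \1_G (z + w) + ln k1).
    apply/funext => w; rewrite indicE; case: (_ \in _) => /=.
      by rewrite subrr !mulr1 mulr0 addr0 subrK.
    by rewrite subr0 !mulr0 mulr1 !add0r.
  have m1 : measurable_fun setT (fun w : CplxB R => \1_G (z + w) : R) by exact: (measurableT_comp mIG (mT z)).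
  have I1 : dA.-integrable B (EFin \o (fun w => \1_G (z + w) : R)).
    by apply: (@integrable_disc _ _ 1) => // w _; rewrite indicE; case: (_ \in _); rewrite ?normr0 ?normr1.
  have Icst (x : R) : dA.-integrable B (EFin \o (fun=> x)).
    by apply: (@integrable_disc _ _ `|x|).
  rewrite RintegralD//; last by have := integrableZl mB (ln k2 - ln k1) I1.
  rewrite RintegralZl// Rintegral_cst// -/a.
  set m := \int[_]_(_ in _) _.
  have cm : c <= m.
    have := dens z; rewrite (_ : (\int[dA]_w _)%E = m%:E) ?lee_fin//.
    rewrite fineK; last exact: integrable_fin_num.
    rewrite [RHS]integral_mkcond; apply: eq_integral => w _.
    by rewrite patchE [\1_B w]indicE; case: ifPn => _; rewrite ?mul1r ?mul0r.
  have lk2 : ln k2 = - (a * ln k1 / c) by rewrite expRK.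
  have e1 : ln k2 * c = - (a * ln k1) by rewrite lk2 mulNr divfK// gt_eqF.
  have k2l : 0 <= ln k2 by exact: ln_ge0.
  have : ln k2 * c <= ln k2 * m by exact: ler_wpM2l.
  have : 0 <= - ln k1 * m by rewrite mulr_ge0 ?oppr_ge0//; lra.
  lra.
have ap : 0 < a.
  rewrite -lte_fin -aE; apply: (@lt_le_trans _ _ c%:E); first by rewrite lte_fin.
  apply: le_trans (dens 0) _; rewrite -[X in dA X]setIT -integral_indic//.
  apply: ge0_le_integral => //.
  - by apply/measurable_EFinP/measurable_funM => //; exact: (measurableT_comp mIG (mT 0)).
  - exact/measurable_EFinP.
  - by move=> w _; rewrite lee_fin !indicE ler_piMr//; case: (_ \in G).
exists (2 * M * k2)^-1; first by rewrite invr_gt0 !mulr_gt0//; lra.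
move=> f ef fin; have mf := measurable_norm2_fun (entire_measurable ef).
pose P w := normc (f w) ^+ 2 * gauss w.
have P0 w : 0 <= P w by exact: norm2_fun_ge0.
pose W w : R := k2 * \1_G w + k1 * (1 - \1_G w).
have WE w : W w = if w \in G then k2 else k1.
  by rewrite /W indicE; case: (_ \in _) => /=; rewrite ?subrr ?subr0 ?mulr1 ?mulr0 ?addr0 ?add0r.
have W0 w : 0 <= W w by rewrite WE; case: ifP => _; lra.
have mW : measurable_fun setT (W : CplxB R -> R).
  by apply: measurable_funD; apply: measurable_funM => //; exact: measurable_funB.
have mWP : measurable_fun setT (fun w : CplxB R => W w * P w) by exact: measurable_funM.
have mF : measurable_fun setT (fun p : CplxB R * CplxB R => (M * (\1_B p.2 * (W (p.1 + p.2) * P (p.1 + p.2))))%:E).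
  apply/measurable_EFinP; apply: measurable_funM => //; apply: measurable_funM.
    exact: (measurableT_comp mI).
  by apply: (measurableT_comp mWP); exact: measurable_cplxD.
have I0 w : 0 <= \1_B w :> R by rewrite indicE.
have WP0 w : 0 <= W w * P w by exact: mulr_ge0.
have T0 z w : 0 <= \1_B w * (W (z + w) * P (z + w)) by exact: mulr_ge0.
have G0 w : 0 <= \1_G w * P w by apply: mulr_ge0 => //; rewrite indicE.
have step1 : (a%:E * norm2 f <= M%:E * (a%:E * \int[dA]_w (W w * P w)%:E))%E.
  rewrite -{2}aE -(ge0_integral_convolution r mWP WP0).
  rewrite -ge0_integralZl//; last 3 first.
  - apply: (measurable_integral_dA (f := fun p : CplxB R * CplxB R => (\1_B p.2 * (W (p.1 + p.2) * P (p.1 + p.2)))%:E)).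
      apply/measurable_EFinP; apply: measurable_funM; first exact: (measurableT_comp mI).
      by apply: (measurableT_comp mWP); exact: measurable_cplxD.
    by move=> p; rewrite lee_fin T0.
  - by move=> z _; apply: integral_ge0 => w _; rewrite lee_fin T0.
  - by rewrite lee_fin; lra.
  rewrite /norm2 -[X in (X <= _)%E]ge0_integralZl//; last 2 first.
  - exact/measurable_EFinP.
  - by move=> z _; rewrite lee_fin P0.
  apply: ge0_le_integral => //.
  - by move=> z _; rewrite mule_ge0 ?lee_fin ?P0.
  - by apply: emeasurable_funM => //; exact/measurable_EFinP.
  - apply: emeasurable_funM => //.
    apply: (measurable_integral_dA (f := fun p : CplxB R * CplxB R => (\1_B p.2 * (W (p.1 + p.2) * P (p.1 + p.2)))%:E)).
      apply/measurable_EFinP; apply: measurable_funM; first exact: (measurableT_comp mI).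
      by apply: (measurableT_comp mWP); exact: measurable_cplxD.
    by move=> p; rewrite lee_fin T0.
  move=> z _; apply: le_trans (luecking_pointwise ef fin r0 k10 k12 (lnW z)) _.
  rewrite -ge0_integralZl//.
  - apply/measurable_EFinP; apply: measurable_funM => //.
    exact: (measurableT_comp mWP (mT z)).
  - by move=> w _; rewrite lee_fin T0.
  - by rewrite lee_fin; lra.
have mGP : measurable_fun setT (fun w : CplxB R => \1_G w * P w) by exact: measurable_funM.
have step2 : (\int[dA]_w (W w * P w)%:E <= k2%:E * \int[dA]_w (\1_G w * P w)%:E + k1%:E * norm2 f)%E.
  have k1w : 0 <= k1 by exact: ltW.
  have k2w : 0 <= k2 by lra.
  have -> : (k2%:E * \int[dA]_w (\1_G w * P w)%:E = \int[dA]_w (k2 * (\1_G w * P w))%:E)%E.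
    by rewrite -ge0_integralZl//; [exact/measurable_EFinP|move=> w _; rewrite lee_fin].
  have -> : (k1%:E * norm2 f = \int[dA]_w (k1 * P w)%:E)%E.
    by rewrite /norm2 -ge0_integralZl//; [exact/measurable_EFinP|move=> w _; rewrite lee_fin P0].
  rewrite -ge0_integralD//.
  + apply: ge0_le_integral => //.
    - by move=> w _; rewrite lee_fin WP0.
    - exact/measurable_EFinP.
    - by apply: emeasurable_funD; apply/measurable_EFinP; exact: measurable_funM.
    - move=> w _; rewrite -EFinD lee_fin WE indicE; have := P0 w => Pw.
      have : 0 <= k1 * P w by rewrite mulr_ge0.
      by case: ifP => _ /=; lra.
  + by move=> w _; rewrite lee_fin mulr_ge0.
  + by apply/measurable_EFinP; exact: measurable_funM.
  + by move=> w _; rewrite lee_fin mulr_ge0.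
  + by apply/measurable_EFinP; exact: measurable_funM.
move: step1 step2.
have Q0 : (0 <= \int[dA]_w (\1_G w * P w)%:E)%E.
  by apply: integral_ge0 => w _; rewrite lee_fin G0.
have V0 : (0 <= \int[dA]_w (W w * P w)%:E)%E.
  by apply: integral_ge0 => w _; rewrite lee_fin WP0.
have N0 := norm2_ge0 f; move: fin N0 V0 Q0.
move: (norm2 f) => [N| |]// _.
move: (\int[dA]_w (\1_G w * P w)%:E)%E => [Q| |]//; last first.
  by move=> _ _ _ _ _; rewrite leey.
move: (\int[dA]_w (W w * P w)%:E)%E => [V| |]//.
rewrite !lee_fin => N0 V0 Q0 h1 h2.
have h3 : N <= M * V by move: h1; rewrite mulrCA ler_pM2l.
have h4 : M * V <= M * (k2 * Q + k1 * N) by rewrite ler_wpM2l//; lra.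
have kM : M * (k1 * N) = N / 2 by rewrite /k1; field; rewrite gt_eqF//; lra.
rewrite mulrC ler_pdivrMr; last by rewrite !mulr_gt0//; lra.
lra.
Qed.

End luecking.

(** * Norm estimates and multiplication by bounded symbols *)

Section fock_operations.
Variable R : realType.
Local Notation C := (Cplx R).
Local Notation mfun f := (measurable_fun setT (f : CplxB R -> CplxB R)).
Implicit Types f g h : C -> C.

Lemma fatou_cvg d (T : measurableType d) (mu : {measure set T -> \bar R})
    (F : nat -> T -> R) (G : T -> R) (c : \bar R) :
  (forall n, measurable_fun setT (F n)) -> (forall n t, 0 <= F n t) ->
  (forall t, F ^~ t @ \oo --> G t) -> (forall n, \int[mu]_t (F n t)%:E <= c)%E ->
  (\int[mu]_t (G t)%:E <= c)%E.
Proof.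
move=> mF F0 FG Fc.
rewrite (eq_integral (fun t => limn_einf (fun n => (F n t)%:E))); last first.
  move=> t _; have FGt : (F n t)%:E @[n --> \oo] --> (G t)%:E by apply: cvg_EFin; [exact: nearW|exact: FG].
  rewrite is_cvg_limn_einfE; first by apply/esym/cvg_lim.
  by apply/cvg_ex; exists (G t)%:E.
apply: le_trans (fatou _ _ _ _) _ => //.
- by move=> n; exact/measurable_EFinP.
- by move=> n t _; rewrite lee_fin.
rewrite limn_einf_lim; apply: lime_le; first exact: is_cvg_einfs.
apply: nearW => n; apply: le_trans (Fc n).
by apply: ereal_inf_lbound; exists n => /=.
Qed.

Lemma norm2_fin g : (norm2 g < +oo)%E -> norm2 g = (fine (norm2 g))%:E.
Proof. by move=> fin; rewrite fineK// ge0_fin_numE// norm2_ge0. Qed.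

(** A weighted AM-GM instead of the triangle inequality for norms: with [x] small the coefficient of
    [norm2 h] is as close to 1 as wanted, which preserves a contraction factor on [h]. *)
Lemma norm2D_le g h (x : R) : 0 < x -> mfun g -> mfun h ->
  (norm2 (fun w => g w + h w)%R <= (1 + x^-1)%:E * norm2 g + (1 + x)%:E * norm2 h)%E.
Proof.
move=> x0 mg mh; have mng := measurable_norm2_fun mg; have mnh := measurable_norm2_fun mh.
have c1 : 0 <= 1 + x^-1 by rewrite addr_ge0// invr_ge0 ltW.
have c2 : 0 <= 1 + x by rewrite addr_ge0// ltW.
rewrite /norm2 -[X in (_ <= X + _)%E]ge0_integralZl//; last 2 first.
- exact/measurable_EFinP.
- by move=> w _; rewrite lee_fin norm2_fun_ge0.
rewrite -[X in (_ <= _ + X)%E]ge0_integralZl//; last 2 first.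
- exact/measurable_EFinP.
- by move=> w _; rewrite lee_fin norm2_fun_ge0.
rewrite -ge0_integralD//; last 4 first.
- by move=> w _; rewrite -EFinM lee_fin mulr_ge0// norm2_fun_ge0.
- by apply: emeasurable_funM => //; exact/measurable_EFinP.
- by move=> w _; rewrite -EFinM lee_fin mulr_ge0// norm2_fun_ge0.
- by apply: emeasurable_funM => //; exact/measurable_EFinP.
apply: ge0_le_integral => //.
- by move=> w _; rewrite lee_fin mulr_ge0 ?sqr_ge0 ?gauss_nneg.
- by apply/measurable_EFinP; apply: measurable_norm2_fun; exact: measurable_cplxD.
- by apply: emeasurable_funD; apply: emeasurable_funM => //; exact/measurable_EFinP.
move=> w _; rewrite -!EFinM -EFinD lee_fin !mulrA -mulrDl ler_pM2r ?gauss_gt0//.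
have := le_normcD (g w) (h w); have := normc_ge0 (g w); have := normc_ge0 (h w).
have := normc_ge0 (g w + h w).
move: (normc (g w)) (normc (h w)) (normc _) => a b s s0 b0 a0 sab.
have s2 : s ^+ 2 <= (a + b) ^+ 2 by rewrite ler_sqr ?nnegrE ?addr_ge0.
have y0 : 0 < x^-1 by rewrite invr_gt0.
have : 0 <= x^-1 * (a - x * b) ^+ 2 by rewrite mulr_ge0 ?sqr_ge0// ltW.
have -> : x^-1 * (a - x * b) ^+ 2 = x^-1 * a ^+ 2 - 2 * (a * b) + x * b ^+ 2.
  by field; rewrite gt_eqF.
lra.
Qed.

Lemma norm2D_lty g h : mfun g -> mfun h -> (norm2 g < +oo)%E -> (norm2 h < +oo)%E ->
  (norm2 (fun w => g w + h w)%R < +oo)%E.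
Proof.
move=> mg mh fg fh; apply: le_lt_trans (norm2D_le ltr01 mg mh) _.
by rewrite (norm2_fin fg) (norm2_fin fh) -!EFinM -EFinD ltry.
Qed.

Lemma norm2Z (c : C) g : mfun g -> norm2 (fun w => c * g w) = ((normc c ^+ 2)%:E * norm2 g)%E.
Proof.
move=> mg; rewrite /norm2 -ge0_integralZl//.
- by apply: eq_integral => w _; rewrite -EFinM normcM; congr _%:E; ring.
- by apply/measurable_EFinP; exact: measurable_norm2_fun.
- by move=> w _; rewrite lee_fin norm2_fun_ge0.
- by rewrite lee_fin sqr_ge0.
Qed.

Lemma norm2Z_lty (c : C) g : mfun g -> (norm2 g < +oo)%E -> (norm2 (fun w => c * g w)%R < +oo)%E.
Proof. by move=> mg fg; rewrite norm2Z// (norm2_fin fg) -EFinM ltry. Qed.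

Lemma bprojD g h : mfun g -> mfun h -> (norm2 g < +oo)%E -> (norm2 h < +oo)%E ->
  bproj (fun w => g w + h w) = fun z => bproj g z + bproj h z.
Proof.
move=> mg mh fg fh; apply/funext => z; rewrite /bproj -integralCD//.
- by congr (integralC dA _); apply/funext => w; rewrite mulrDl.
- exact: integrable_bkernel.
- exact: integrable_bkernel.
Qed.

Lemma bprojZ (c : C) g : mfun g -> (norm2 g < +oo)%E ->
  bproj (fun w => c * g w) = fun z => c * bproj g z.
Proof.
move=> mg fg; apply/funext => z; rewrite /bproj integralCZ//.
- by congr (integralC dA _); apply/funext => w; rewrite mulrA.
- exact: integrable_bkernel.
Qed.

(** The space [fock] written with [norm2]; [fock_in_fock] identifies the two. *)
Definition in_fock f := entire f /\ (norm2 f < +oo)%E.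

Lemma in_fockD f g : in_fock f -> in_fock g -> in_fock (fun z => f z + g z).
Proof.
move=> [ef ff] [eg fg]; split; first exact: (entireD ef eg).
by apply: norm2D_lty => //; exact: entire_measurable.
Qed.

Lemma in_fockZ (c : C) f : in_fock f -> in_fock (fun z => c * f z).
Proof.
move=> [ef ff]; split; first exact: (entireM (@entire_cst R c) ef).
by apply: norm2Z_lty => //; exact: entire_measurable.
Qed.

Lemma in_fock_bproj g : mfun g -> (norm2 g < +oo)%E -> in_fock (bproj g).
Proof. by move=> mg fg; split; [exact: bproj_entire|exact: norm2_bproj_lty]. Qed.

Lemma in_fock_bound f z : in_fock f -> ((normc (f z) ^+ 2 * gauss z)%:E <= norm2 f)%E.
Proof.
move=> [ef ff]; have := bproj_le_norm2 z (entire_measurable ef).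
by rewrite bproj_entire_id.
Qed.

Definition mulfR (psi : C -> R) g : C -> C := fun w => (psi w)%:C * g w.

Lemma measurable_mulfR psi g : measurable_fun setT (psi : CplxB R -> R) -> mfun g -> mfun (mulfR psi g).
Proof. by move=> mp mg; apply: measurable_cplxM => //; exact: measurable_cplxR. Qed.

(** Since [psi^2 <= M psi], one factor [psi] stays under the integral, and the bound retains the
    quadratic form of the Toeplitz operator. *)
Lemma norm2_mulfR_le psi g (M : R) : measurable_fun setT (psi : CplxB R -> R) ->
  mfun g -> (forall w, 0 <= psi w <= M) ->
  (norm2 (mulfR psi g) <= M%:E * \int[dA]_w (psi w * (normc (g w) ^+ 2 * gauss (w : C)))%:E)%E.
Proof.
move=> mp mg pM; have mn := measurable_norm2_fun mg.
have p0 w : 0 <= psi w by case/andP: (pM w).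
have M0 : 0 <= M by have /andP[h1 h2] := pM 0; exact: le_trans h1 h2.
rewrite -ge0_integralZl//; last 2 first.
- by apply/measurable_EFinP; exact: measurable_funM.
- by move=> w _; rewrite lee_fin mulr_ge0// norm2_fun_ge0.
apply: ge0_le_integral => //.
- by move=> w _; rewrite lee_fin norm2_fun_ge0.
- by apply/measurable_EFinP; apply: measurable_norm2_fun; exact: measurable_mulfR.
- by apply: emeasurable_funM => //; apply/measurable_EFinP; exact: measurable_funM.
move=> w _; rewrite -EFinM lee_fin /mulfR normcM normcR ger0_norm// exprMn -mulrA expr2.
rewrite -mulrA; apply: ler_wpM2r; last by case/andP: (pM w).
by rewrite mulr_ge0// norm2_fun_ge0.
Qed.

Lemma norm2_mulfR_le_norm2 psi g (M : R) : measurable_fun setT (psi : CplxB R -> R) ->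
  mfun g -> (forall w, 0 <= psi w <= M) -> (norm2 (mulfR psi g) <= (M ^+ 2)%:E * norm2 g)%E.
Proof.
move=> mp mg pM; have mn := measurable_norm2_fun mg.
have p0 w : 0 <= psi w by case/andP: (pM w).
have M0 : 0 <= M by have /andP[h1 h2] := pM 0; exact: le_trans h1 h2.
apply: le_trans (norm2_mulfR_le mp mg pM) _.
rewrite expr2 EFinM -muleA; apply: lee_wpmul2l; first by rewrite lee_fin.
rewrite -ge0_integralZl//; last 2 first.
- exact/measurable_EFinP.
- by move=> w _; rewrite lee_fin norm2_fun_ge0.
apply: ge0_le_integral => //.
- by move=> w _; rewrite lee_fin mulr_ge0// norm2_fun_ge0.
- by apply/measurable_EFinP; exact: measurable_funM.
- by apply: emeasurable_funM => //; exact/measurable_EFinP.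
move=> w _; rewrite -EFinM lee_fin; apply: ler_wpM2r; first exact: norm2_fun_ge0.
by case/andP: (pM w).
Qed.

Lemma norm2_mulfR_lty psi g (M : R) : measurable_fun setT (psi : CplxB R -> R) ->
  mfun g -> (forall w, 0 <= psi w <= M) -> (norm2 g < +oo)%E -> (norm2 (mulfR psi g) < +oo)%E.
Proof.
move=> mp mg pM fg; apply: le_lt_trans (norm2_mulfR_le_norm2 mp mg pM) _.
by rewrite (norm2_fin fg) -EFinM ltry.
Qed.

End fock_operations.

(** * Neumann series of a strictly contracting compression *)

Section neumann_series.
Variable R : realType.
Local Notation C := (Cplx R).
Local Notation mfun f := (measurable_fun setT (f : CplxB R -> CplxB R)).
Implicit Types f g h : C -> C.

Variables (psi : C -> R) (q : R).
Hypothesis mpsi : measurable_fun setT (psi : CplxB R -> R).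
Hypothesis psi01 : forall w, 0 <= psi w <= 1.
Hypothesis q01 : 0 < q < 1.

Let A g := bproj (mulfR psi g).

Hypothesis A_le : forall g, in_fock g -> (norm2 (A g) <= q%:E * norm2 g)%E.

Let fockA g : in_fock g -> in_fock (A g).
Proof.
move=> [eg fg]; have mg := entire_measurable eg.
by apply: in_fock_bproj; [exact: measurable_mulfR|exact: norm2_mulfR_lty fg].
Qed.

Let hn f n := iter n A f.

Let fock_hn f n : in_fock f -> in_fock (hn f n).
Proof. by move=> ff; elim: n => [//|n IH]; exact: fockA. Qed.

Let norm2_hn f n : in_fock f -> (norm2 (hn f n) <= (q ^+ n)%:E * norm2 f)%E.
Proof.
move=> ff; elim: n => [|n IH]; first by rewrite expr0 mul1e.
rewrite exprS EFinM -muleA; apply: le_trans (A_le (fock_hn n ff)) _.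
by apply: lee_wpmul2l => //; rewrite lee_fin; case/andP: q01 => /ltW.
Qed.

Let Sn f n : C -> C := fun z => \sum_(k < n) hn f k z.

Let SnS f n z : Sn f n.+1 z = f z + Sn (A f) n z.
Proof.
rewrite /Sn big_ord_recl/=; congr (_ + _); apply: eq_bigr => k _.
by rewrite /hn -iterSr.
Qed.

Let fockSn f n : in_fock f -> in_fock (Sn f n).
Proof.
elim: n f => [|n IH] f ff.
  rewrite (_ : Sn f 0 = fun=> 0); last by apply/funext => z; rewrite /Sn big_ord0.
  split; first exact: entire_cst.
  by rewrite /norm2 integral0_eq// => w _; rewrite normc0 expr0n mul0r.
rewrite (_ : Sn f n.+1 = fun z => f z + Sn (A f) n z); last by apply/funext => z; rewrite SnS.
by apply: in_fockD => //; exact/IH/fockA.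
Qed.

(** [x] gives [(1 + x) q = (1 + q) / 2 < 1], and [K] solves [K = (1 + x^-1) + K (1 + q) / 2]. With
    these the bound by [K] on partial sums is stable under [S_{n+1} f = f + S_n (A f)]. *)
Let x : R := (1 - q) / (2 * q).
Let K : R := 2 * (1 + x^-1) / (1 - q).

Let x0 : 0 < x.
Proof. by case/andP: q01 => q0 q1; rewrite divr_gt0 ?subr_gt0// mulr_gt0. Qed.

Let K0 : 0 <= K.
Proof.
case/andP: q01 => q0 q1; rewrite divr_ge0//; last by rewrite subr_ge0 ltW.
by rewrite mulr_ge0// addr_ge0// invr_ge0 ltW.
Qed.

Let xq : (1 + x) * q = (1 + q) / 2.
Proof. by case/andP: q01 => q0 q1; rewrite /x; field; rewrite gt_eqF. Qed.

Let norm2_Sn f n : in_fock f -> (norm2 (Sn f n) <= K%:E * norm2 f)%E.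
Proof.
elim: n f => [|n IH] f ff.
  rewrite (_ : norm2 _ = 0)%E; first by rewrite mule_ge0 ?lee_fin ?norm2_ge0.
  by rewrite /norm2 integral0_eq// => w _; rewrite /Sn big_ord0 normc0 expr0n mul0r.
have fAf := fockA ff.
rewrite (_ : Sn f n.+1 = fun z => f z + Sn (A f) n z); last by apply/funext => z; rewrite SnS.
have [efA ffA] := fockSn n fAf; have [ef fin] := ff.
apply: le_trans (norm2D_le x0 (entire_measurable ef) (entire_measurable efA)) _.
have := IH _ fAf; have := A_le ff.
have N0 := norm2_ge0 f; have NA0 := norm2_ge0 (A f); have NS0 := norm2_ge0 (Sn (A f) n).
move: fin ffA (fAf.2) N0 NA0 NS0.
move: (norm2 f) (norm2 (A f)) (norm2 (Sn (A f) n)) => [a| |]// [b| |]// [s| |]// _ _ _.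
rewrite !lee_fin => a0 b0 s0 ba sb; case/andP: q01 => q0 q1.
have h1 : (1 + x) * s <= (1 + x) * (K * b) by rewrite ler_wpM2l// addr_ge0// ltW.
have h2 : (1 + x) * (K * b) <= (1 + x) * (K * (q * a)).
  by rewrite ler_wpM2l ?ler_wpM2l// addr_ge0// ltW.
have h3 : (1 + x) * (K * (q * a)) = K * a * ((1 + q) / 2) by rewrite -xq; ring.
have h4 : 1 + x^-1 = K * (1 - q) / 2.
  have qn : 1 - q != 0 by rewrite gt_eqF// subr_gt0.
  by rewrite /K divfK// mulrAC mulfV ?mul1r.
rewrite h4; lra.
Qed.

Let r f z := Num.sqrt (fine (norm2 f) / gauss z).

(** Bounded point evaluations turn decay in norm into geometric decay at each point, with ratio
    [sqrt q] since [norm2] is quadratic. *)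
Let hn_bound f n z : in_fock f -> normc (hn f n z) <= r f z * Num.sqrt q ^+ n.
Proof.
move=> ff; have := le_trans (in_fock_bound z (fock_hn n ff)) (norm2_hn n ff).
case/andP: q01 => q0 q1.
rewrite (norm2_fin ff.2) -EFinM lee_fin -ler_pdivlMr ?gauss_gt0// => H.
have N0 : 0 <= fine (norm2 f) by rewrite fine_ge0// norm2_ge0.
rewrite -[leLHS]ger0_norm ?normc_ge0// -sqrtr_sqr /r.
have -> : Num.sqrt q ^+ n = Num.sqrt (q ^+ n).
  elim: (n) => [|m IH]; first by rewrite !expr0 sqrtr1.
  by rewrite !exprS IH sqrtrM// ltW.
rewrite -sqrtrM ?divr_ge0 ?gauss_nneg// ler_sqrt; last first.
  by rewrite mulr_ge0 ?divr_ge0 ?gauss_nneg// exprn_ge0// ltW.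
by rewrite mulrAC [_ * q ^+ n]mulrC.
Qed.

Let cvg_part (p : C -> R) f z : in_fock f -> (forall u, `|p u| <= normc u) ->
  cvgn (series (fun n => p (hn f n z))).
Proof.
move=> ff pn; apply: (@normed_cvg R R^o).
apply: (series_le_cvg (v_ := geometric (r f z) (Num.sqrt q))) => //.
- by move=> n; exact: normr_ge0.
- by move=> n /=; rewrite mulr_ge0 ?sqrtr_ge0// exprn_ge0// sqrtr_ge0.
- by move=> n; apply: le_trans (pn _) _; exact: hn_bound.
- apply: is_cvg_geometric_series; rewrite ger0_norm ?sqrtr_ge0//.
  by case/andP: q01 => q0 q1; rewrite -[ltRHS]sqrtr1 ltr_sqrt.
Qed.

(** The pointwise sum of the series. It is measurable as a limit and of finite norm by Fatou; its
    holomorphy is established only in [neumann_fixpoint]. *)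
Let U f : C -> C := fun z =>
  limn (series (fun n => complex.Re (hn f n z))) +i*
  limn (series (fun n => complex.Im (hn f n z))).

Let Re_Sn f n z : complex.Re (Sn f n z) = series (fun n => complex.Re (hn f n z)) n.
Proof. by rewrite /Sn raddf_sum/= /series/= big_mkord. Qed.

Let Im_Sn f n z : complex.Im (Sn f n z) = series (fun n => complex.Im (hn f n z)) n.
Proof. by rewrite /Sn raddf_sum/= /series/= big_mkord. Qed.

Let cvg_ReSn f z : in_fock f -> (fun n => complex.Re (Sn f n z)) @ \oo --> complex.Re (U f z).
Proof.
move=> ff; under eq_fun do rewrite Re_Sn.
by apply: cvg_part => // u; exact: normc_Re_le.
Qed.

Let cvg_ImSn f z : in_fock f -> (fun n => complex.Im (Sn f n z)) @ \oo --> complex.Im (U f z).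
Proof.
move=> ff; under eq_fun do rewrite Im_Sn.
by apply: cvg_part => // u; exact: normc_Im_le.
Qed.

Let cvg_n2Sn f z : in_fock f ->
  (fun n => normc (Sn f n z) ^+ 2 * gauss z : R) @ \oo --> (normc (U f z) ^+ 2 * gauss z : R).
Proof.
move=> ff; rewrite normc_sqr; under eq_fun do rewrite normc_sqr.
apply: cvgMr_tmp; apply: cvgD; rewrite expr2; under eq_fun do rewrite expr2.
  by apply: cvgM; exact: cvg_ReSn.
by apply: cvgM; exact: cvg_ImSn.
Qed.

Let mSn f n : in_fock f -> mfun (Sn f n).
Proof. by move=> ff; have [e _] := fockSn n ff; exact: entire_measurable. Qed.

Let mU f : in_fock f -> mfun (U f).
Proof.
move=> ff; apply: measurable_cplxP.
  apply: (@measurable_fun_cvg _ _ _ _ (fun n (z : CplxB R) => complex.Re (Sn f n z))).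
    by move=> n; apply: measurable_cplxRe; exact: mSn.
  by move=> z _; exact: cvg_ReSn.
apply: (@measurable_fun_cvg _ _ _ _ (fun n (z : CplxB R) => complex.Im (Sn f n z))).
  by move=> n; apply: measurable_cplxIm; exact: mSn.
by move=> z _; exact: cvg_ImSn.
Qed.

Let norm2_U f : in_fock f -> (norm2 (U f) <= K%:E * norm2 f)%E.
Proof.
move=> ff; apply: (@fatou_cvg R _ _ dA (fun n (z : CplxB R) => normc (Sn f n z) ^+ 2 * gauss (z : C))).
- by move=> n; apply: measurable_norm2_fun; exact: mSn.
- by move=> n z; exact: norm2_fun_ge0.
- by move=> z; exact: cvg_n2Sn.
- by move=> n; exact: norm2_Sn.
Qed.

Let U_bound f z : in_fock f -> normc (U f z) ^+ 2 * gauss z <= K * fine (norm2 f).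
Proof.
move=> ff; apply: (cvgr_to_le (cvg_n2Sn ff)); apply: nearW => n.
rewrite -lee_fin [(K * _)%:E]EFinM -(norm2_fin ff.2).
exact: le_trans (in_fock_bound z (fockSn n ff)) (norm2_Sn n ff).
Qed.

Let SnD f n m z : Sn f (n + m) z = Sn f n z + Sn (hn f n) m z.
Proof.
rewrite /Sn big_split_ord/=; congr (_ + _); apply: eq_bigr => k _.
by rewrite /hn addnC iterD.
Qed.

Let U_tail f n z : in_fock f -> U f z = Sn f n z + U (hn f n) z.
Proof.
move=> ff; have fn := fock_hn n ff; apply/eqP; rewrite eq_complex; apply/andP; split; apply/eqP.
  rewrite raddfD/=.
  have H : (fun m => complex.Re (Sn f (m + n) z)) @ \oo --> complex.Re (U f z).
    by rewrite (cvg_shiftn n (fun m => complex.Re (Sn f m z))); exact: cvg_ReSn.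
  have E m : complex.Re (Sn f (m + n) z) = complex.Re (Sn f n z) + complex.Re (Sn (hn f n) m z).
    by rewrite addnC SnD raddfD.
  have H2 : (fun m => complex.Re (Sn f (m + n) z)) @ \oo -->
      complex.Re (Sn f n z) + complex.Re (U (hn f n) z).
    by under eq_fun do rewrite E; apply: cvgD; [exact: cvg_cst|exact: cvg_ReSn].
  exact: (cvg_unique _ H H2).
rewrite raddfD/=.
have H : (fun m => complex.Im (Sn f (m + n) z)) @ \oo --> complex.Im (U f z).
  by rewrite (cvg_shiftn n (fun m => complex.Im (Sn f m z))); exact: cvg_ImSn.
have E m : complex.Im (Sn f (m + n) z) = complex.Im (Sn f n z) + complex.Im (Sn (hn f n) m z).
  by rewrite addnC SnD raddfD.
have H2 : (fun m => complex.Im (Sn f (m + n) z)) @ \oo -->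
    complex.Im (Sn f n z) + complex.Im (U (hn f n) z).
  by under eq_fun do rewrite E; apply: cvgD; [exact: cvg_cst|exact: cvg_ImSn].
exact: (cvg_unique _ H H2).
Qed.

Let norm2_U_lty f : in_fock f -> (norm2 (U f) < +oo)%E.
Proof.
by move=> ff; apply: le_lt_trans (norm2_U ff) _; rewrite (norm2_fin ff.2) -EFinM ltry.
Qed.

Let AD f g : mfun f -> mfun g -> (norm2 f < +oo)%E -> (norm2 g < +oo)%E ->
  A (fun w => f w + g w) = fun z => A f z + A g z.
Proof.
move=> mf mg ff fg; rewrite /A -bprojD.
- by congr bproj; apply/funext => w; rewrite /mulfR mulrDr.
- exact: measurable_mulfR.
- exact: measurable_mulfR.
- exact: norm2_mulfR_lty ff.
- exact: norm2_mulfR_lty fg.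
Qed.

Let ASn f n : in_fock f -> A (Sn f n) = Sn (A f) n.
Proof.
elim: n f => [|n IH] f ff.
  apply/funext => z; rewrite /A /bproj /Sn big_ord0.
  rewrite (_ : (fun w => _) = (fun w => 0 * 0)); last first.
    by apply/funext => w; rewrite /mulfR big_ord0 mulr0 !mul0r.
  rewrite -integralCZ ?mul0r//; split; first exact: measurable_cst.
  by rewrite integral0_eq// => w _; rewrite normc0.
have [efA ffA] := fockSn n (fockA ff); have [ef fin] := ff.
rewrite (_ : Sn f n.+1 = fun z => f z + Sn (A f) n z); last by apply/funext => z; rewrite SnS.
rewrite (AD (entire_measurable ef) (entire_measurable efA) fin ffA).
rewrite (IH _ (fockA ff)); apply/funext => z; exact/esym/SnS.
Qed.

Let A_bound g z : mfun g -> (norm2 g < +oo)%E ->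
  ((normc (A g z) ^+ 2 * gauss z)%:E <= norm2 g)%E.
Proof.
move=> mg fg; apply: le_trans (bproj_le_norm2 z (measurable_mulfR mpsi mg)) _.
by apply: le_trans (norm2_mulfR_le_norm2 mpsi mg psi01) _; rewrite expr1n mul1e.
Qed.

(** The equation is checked point by point: its defect at [z] can be expressed through the tail of
    the series after any number [n] of terms, and this is [O(q^n)] by the bounds on [U], on [A] and
    on point evaluations. *)
Lemma neumann_fixpoint f : in_fock f ->
  exists2 u, in_fock u & forall z, u z = f z + A u z.
Proof.
move=> ff; have UE z : U f z = f z + A (U f) z.
  apply/eqP; rewrite -subr_eq0; apply/eqP/eq0_normc.
  apply/eqP; rewrite -sqrf_eq0; apply/eqP.
  set D := U f z - _; set N := fine (norm2 f).
  have N0 : 0 <= N by rewrite fine_ge0// norm2_ge0.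
  have bound n : normc D ^+ 2 * gauss z <= 4 * K * N * q ^+ n.
    have fn := fock_hn n ff; have fn1 := fock_hn n.+1 ff.
    case/andP: q01 => q0 q1.
    have Nn : fine (norm2 (hn f n)) <= q ^+ n * N.
      by rewrite -lee_fin EFinM -(norm2_fin fn.2) -(norm2_fin ff.2); exact: norm2_hn.
    have Nn1 : fine (norm2 (hn f n.+1)) <= q ^+ n * N.
      apply: (@le_trans _ _ (q ^+ n.+1 * N)).
        by rewrite -lee_fin EFinM -(norm2_fin fn1.2) -(norm2_fin ff.2); exact: norm2_hn.
      by rewrite exprS ler_wpM2r// ler_piMl ?exprn_ge0// ltW.
    have AU : A (U f) z = A (Sn f n) z + A (U (hn f n)) z.
      rewrite (_ : U f = fun w => Sn f n w + U (hn f n) w); last first.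
        by apply/funext => w; exact: U_tail.
      by rewrite AD//; [exact: mSn|exact: mU|exact: (fockSn n ff).2|exact: norm2_U_lty].
    (* Splitting [U f] after [n + 1] terms and [A (U f)] after [n] terms makes the finite sums
       cancel. *)
    have DE : D = U (hn f n.+1) z + - A (U (hn f n)) z.
      by rewrite /D AU (U_tail n.+1 z ff) SnS ASn//; ring.
    have b1 := U_bound z fn1.
    have b2 : normc (A (U (hn f n)) z) ^+ 2 * gauss z <= K * fine (norm2 (hn f n)).
      rewrite -lee_fin [(K * _)%:E]EFinM -(norm2_fin fn.2).
      exact: le_trans (A_bound z (mU fn) (norm2_U_lty fn)) (norm2_U fn).
    have k1 := ler_wpM2l K0 Nn; have k2 := ler_wpM2l K0 Nn1.
    have := le_normcD (U (hn f n.+1) z) (- A (U (hn f n)) z); rewrite -DE normcN.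
    move: b1 b2; have g0 := gauss_gt0 z; have := normc_ge0 D.
    have := normc_ge0 (U (hn f n.+1) z); have := normc_ge0 (A (U (hn f n)) z).
    move: (normc D) (normc (U _ z)) (normc (A _ z)) => d a b b0 a0 d0 b1 b2 dab.
    have : d ^+ 2 * gauss z <= 2 * (a ^+ 2 * gauss z) + 2 * (b ^+ 2 * gauss z).
      rewrite !mulrA -mulrDl ler_pM2r//.
      have : d ^+ 2 <= (a + b) ^+ 2 by rewrite ler_sqr ?nnegrE ?addr_ge0.
      have := sqr_ge0 (a - b); lra.
    lra.
  have qn : (fun n => 4 * K * N * q ^+ n) @ \oo --> (0 : R).
    rewrite -[X in _ --> X](mulr0 (4 * K * N)); apply: cvgMl_tmp; apply: cvg_expr.
    by case/andP: q01 => q0 q1; rewrite ger0_norm// ltW.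
  have : normc D ^+ 2 * gauss z <= 0.
    by apply: (cvgr_to_ge qn); apply: nearW.
  rewrite pmulr_lle0 ?gauss_gt0// => H; apply/eqP.
  by rewrite eq_le H sqr_ge0.
exists (U f) => //; split; last exact: norm2_U_lty.
(* Holomorphy: [A (U f)] is the projection of a measurable function of finite norm, hence entire. *)
rewrite (_ : U f = fun z => f z + A (U f) z); last exact/funext.
have eA : entire (A (U f)).
  apply: bproj_entire; first exact: measurable_mulfR (mU ff).
  exact: norm2_mulfR_lty (mU ff) psi01 (norm2_U_lty ff).
exact: (entireD ff.1 eA).
Qed.

End neumann_series.

(** * Toeplitz operators with bounded nonnegative symbol *)

Section fock_toeplitz.
Variable R : realType.
Local Notation C := (Cplx R).
Local Notation mfun f := (measurable_fun setT (f : CplxB R -> CplxB R)).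
Implicit Types f g h : C -> C.

Lemma integral_lambda f : mfun f ->
  (\int[@lambda R]_z (normc (f z) ^+ 2)%:E = 2^-1%:E * norm2 f)%E.
Proof.
move=> mf; have mn := measurable_norm2_fun mf.
rewrite /lambda ge0_integral_density; last 2 first.
- by apply/measurable_EFinP; apply: measurable_funX; exact: measurable_cplxnormc.
- by move=> z; rewrite lee_fin sqr_ge0.
rewrite /norm2 -ge0_integralZl//; last 2 first.
- exact/measurable_EFinP.
- by move=> w _; rewrite lee_fin norm2_fun_ge0.
by apply: eq_integral => z _; rewrite -!EFinM mulrCA.
Qed.

Lemma fock_in_fock f : fock f <-> in_fock f.
Proof.
split=> -[ef fin]; have E := integral_lambda (entire_measurable ef); split=> //.
  move: (norm2_ge0 f) fin; rewrite E; case: (norm2 f) => [r _ _| |//]; first exact: ltry.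
  by rewrite gt0_muley ?lte_fin ?invr_gt0.
by rewrite E (norm2_fin fin) -EFinM ltry.
Qed.

Lemma fock_normE f : in_fock f -> fock_norm f = Num.sqrt (2^-1 * fine (norm2 f)).
Proof.
move=> [ef fin]; rewrite /fock_norm /Rintegral integral_lambda; last exact: entire_measurable.
by rewrite (norm2_fin fin) -EFinM.
Qed.

Lemma fock_norm_le f g (K : R) : in_fock f -> in_fock g -> 0 <= K ->
  (norm2 f <= (K ^+ 2)%:E * norm2 g)%E -> fock_norm f <= K * fock_norm g.
Proof.
move=> ff fg K0; rewrite !fock_normE// (norm2_fin ff.2) (norm2_fin fg.2) -EFinM lee_fin => H.
have N0 : 0 <= fine (norm2 g) by rewrite fine_ge0// norm2_ge0.
have -> : K = Num.sqrt (K ^+ 2) by rewrite sqrtr_sqr ger0_norm.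
rewrite -sqrtrM ?sqr_ge0// ler_sqrt.
  by rewrite mulrCA ler_pM2l// invr_gt0.
by apply: mulr_ge0; [exact: sqr_ge0|apply: mulr_ge0].
Qed.

Variables (phi : CplxB R -> R) (M : R).
Hypothesis mphi : measurable_fun setT phi.
Hypothesis phi_ge0 : forall z, 0 <= phi z.
Hypothesis M0 : 0 < M.
Hypothesis phiM : forall z, phi z <= M.

Let mu : {measure set (CplxB R) -> \bar R} := density dA mphi phi_ge0.

Let phi0M z : 0 <= phi z <= M. Proof. by rewrite phi_ge0 phiM. Qed.

Lemma toeplitz_bproj f : in_fock f -> toeplitz mu f = bproj (mulfR phi f).
Proof.
move=> [ef fin]; have mf := entire_measurable ef; apply/funext => z.
have mp := measurable_mulfR mphi mf.
have fp := norm2_mulfR_lty mphi mf phi0M fin.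
have Ib := integrable_bkernel z mp fp.
pose F w := f w * expC (z * conjc w / 2) * (gauss w)%:C.
have mF : mfun F.
  apply: measurable_cplxM; last by apply: measurable_cplxR; exact: measurable_gauss_fun.
  apply: measurable_cplxM => //; apply: (measurable_entire_comp (@entire_expC R)).
  by apply: measurable_cplxM => //; apply: measurable_cplxM => //; exact: measurable_cplxconj.
(* The factor 2 undoes the [2^-1] contained in [bkernel]; the definition of [toeplitz] has this
   factor outside the integral. *)
have IE : integralC mu F = integralC dA (fun w => 2 * (mulfR phi f w * bkernel z w)).
  have E w : 2 * (mulfR phi f w * bkernel z w) = F w * (phi w)%:C.
    have hC : (2^-1 * gauss w)%:C = 2^-1 * (gauss w)%:C :> R[i] by rewrite -invr2C rmorphM.
    by rewrite /mulfR /bkernel hC /F; field.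
  rewrite /integralC /Rintegral; congr (fine _ +i* fine _).
    rewrite /mu integral_density; last by apply/measurable_EFinP; exact: measurable_cplxRe.
    by apply: eq_integral => w _; rewrite E (Re_mulR (F w) (phi w)) EFinM.
  rewrite /mu integral_density; last by apply/measurable_EFinP; exact: measurable_cplxIm.
  by apply: eq_integral => w _; rewrite E (Im_mulR (F w) (phi w)) EFinM.
by rewrite /toeplitz -/F IE -integralCZ// mulrA mulVf ?mul1r// pnatr_eq0.
Qed.

Let T f := bproj (mulfR phi f).

Let mphif f : in_fock f -> mfun (mulfR phi f).
Proof. by move=> [ef _]; exact: measurable_mulfR mphi (entire_measurable ef). Qed.

Let finphif f : in_fock f -> (norm2 (mulfR phi f) < +oo)%E.
Proof. by move=> [ef fin]; exact: norm2_mulfR_lty mphi (entire_measurable ef) phi0M fin. Qed.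

Let fockT f : in_fock f -> in_fock (T f).
Proof. by move=> ff; apply: in_fock_bproj; [exact: mphif|exact: finphif]. Qed.

Let T_lin (a b : C) f g : in_fock f -> in_fock g ->
  T (fun z => a * f z + b * g z) = fun z => a * T f z + b * T g z.
Proof.
move=> ff fg; have mf := mphif ff; have mg := mphif fg.
have nf := finphif ff; have ng := finphif fg.
transitivity (bproj (fun z => a * mulfR phi f z + b * mulfR phi g z)).
  by congr bproj; apply/funext => w; rewrite /mulfR; ring.
rewrite bprojD; [|exact: measurable_cplxM|exact: measurable_cplxM|exact: norm2Z_lty|exact: norm2Z_lty].
by rewrite !bprojZ.
Qed.

(** The quadratic form [<T f, f>], doubled like [norm2]. *)
Let Phi f : \bar R := (\int[dA]_w (phi w * (normc (f w) ^+ 2 * gauss (w : C)))%:E)%E.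

(** The inequality [|T f|^2 <= M <T f, f>] for a positive operator; on kernels it converts lower
    bounds on [T] into lower bounds on the Berezin transform. *)
Lemma norm2_bproj_density_le f : in_fock f -> (norm2 (T f) <= M%:E * Phi f)%E.
Proof.
move=> ff; apply: le_trans (norm2_bproj_le (mphif ff) (finphif ff)) _.
exact: norm2_mulfR_le mphi (entire_measurable ff.1) phi0M.
Qed.

Let T_le_norm2 f : in_fock f -> (norm2 (T f) <= (M ^+ 2)%:E * norm2 f)%E.
Proof.
move=> ff; apply: le_trans (norm2_bproj_le (mphif ff) (finphif ff)) _.
exact: norm2_mulfR_le_norm2 mphi (entire_measurable ff.1) phi0M.
Qed.

Lemma integral_mu_norm2 f : mfun f ->
  (\int[mu]_w (normc (f w) ^+ 2 * gauss (w : C))%:E = Phi f)%E.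
Proof.
move=> mf; rewrite ge0_integral_density.
- by apply: eq_integral => w _; rewrite -EFinM mulrC.
- by apply/measurable_EFinP; exact: measurable_norm2_fun.
- by move=> w; rewrite lee_fin norm2_fun_ge0.
Qed.

Lemma toeplitz_bounded : fock_bounded_operator (toeplitz mu).
Proof.
split.
- by move=> f /fock_in_fock ff; rewrite toeplitz_bproj//; apply/fock_in_fock; exact: fockT.
- move=> a b f g /fock_in_fock ff /fock_in_fock fg; rewrite !toeplitz_bproj//; first exact: T_lin.
  by apply: in_fockD; exact: in_fockZ.
- exists M => f /fock_in_fock ff; rewrite toeplitz_bproj//.
  by apply: fock_norm_le => //; [exact: fockT|exact: ltW|exact: T_le_norm2].
Qed.

(* The Toeplitz operator of [psi = 1 - phi / M] contracts F^2, hence [phi = M (1 - psi)] is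
   inverted by a Neumann series. *)
Section coercive.
Variable c : R.
Hypothesis c0 : 0 < c.
Hypothesis coercive : forall f, in_fock f -> (c%:E * norm2 f <= Phi f)%E.

Let t : R := M^-1.
Let psi (z : C) : R := 1 - t * phi z.
(** The minimum with [M / 2] keeps [q >= 1/2], so that [q] is positive and can be divided by. *)
Let q : R := 1 - t * Num.min c (M / 2).

Let t0 : 0 < t. Proof. by rewrite invr_gt0. Qed.

Let tM : t * M = 1. Proof. by rewrite mulVf// gt_eqF. Qed.

Let q01 : 0 < q < 1.
Proof.
have m0 : 0 < Num.min c (M / 2) by rewrite lt_min c0 divr_gt0.
have h1 : t * Num.min c (M / 2) <= t * (M / 2) by rewrite ler_pM2l// ge_min lexx orbT.
have h2 : t * (M / 2) = 2^-1 by rewrite mulrA tM mul1r.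
have h3 : 0 < t * Num.min c (M / 2) by rewrite mulr_gt0.
rewrite /q; move: h1 h3; rewrite h2; move: (t * Num.min c (M / 2)) => y h1 h3.
by apply/andP; split; lra.
Qed.

Let mpsi : measurable_fun setT (psi : CplxB R -> R).
Proof. by apply: measurable_funB => //; exact: measurable_funM. Qed.

Let psi01 z : 0 <= psi z <= 1.
Proof.
have h1 : t * phi z <= t * M by rewrite ler_pM2l.
have h2 : 0 <= t * phi z by rewrite mulr_ge0// ltW.
by move: h1 h2; rewrite tM /psi; move: (t * phi z) => y h1 h2; apply/andP; split; lra.
Qed.

Let AE f : in_fock f -> bproj (mulfR psi f) = fun z => f z + (- t%:C) * T f z.
Proof.
move=> ff; have mf := entire_measurable ff.1.
transitivity (bproj (fun z => f z + (- t%:C) * mulfR phi f z)).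
  congr bproj; apply/funext => w; rewrite /mulfR /psi rmorphB rmorphM/=; ring.
rewrite bprojD; [|exact: mf|apply: measurable_cplxM => //; exact: mphif|exact: ff.2|apply: norm2Z_lty; [exact: mphif|exact: finphif]].
rewrite bproj_entire_id; [|exact: ff.1|exact: ff.2].
by rewrite bprojZ; [|exact: mphif|exact: finphif].
Qed.

Let Phi_ge0 f : (0 <= Phi f)%E.
Proof. by apply: integral_ge0 => w _; rewrite lee_fin mulr_ge0// norm2_fun_ge0. Qed.

(** As [psi <= 1], the left side is at most the integral of [psi |f|^2 gauss], that is
    [norm2 f - t Phi f], and coercivity bounds [Phi f] below. *)
Let A_le f : in_fock f -> (norm2 (bproj (mulfR psi f)) <= q%:E * norm2 f)%E.
Proof.
move=> ff; have mf := entire_measurable ff.1; have mn := measurable_norm2_fun mf.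
have mp := measurable_mulfR mpsi mf; have fp := norm2_mulfR_lty mpsi mf psi01 ff.2.
apply: le_trans (norm2_bproj_le mp fp) _.
apply: le_trans (norm2_mulfR_le mpsi mf psi01) _; rewrite mul1e.
set X := (\int[_]_(_ in _) _)%E.
have X0 : (0 <= X)%E.
  by apply: integral_ge0 => w _; rewrite lee_fin mulr_ge0 ?norm2_fun_ge0//; case/andP: (psi01 w).
have E : (X + t%:E * Phi f = norm2 f)%E.
  rewrite /X /Phi -ge0_integralZl//; last 3 first.
  - by apply/measurable_EFinP; exact: measurable_funM.
  - by move=> w _; rewrite lee_fin mulr_ge0// norm2_fun_ge0.
  - by rewrite lee_fin ltW.
  rewrite -ge0_integralD//.
  - by apply: eq_integral => w _; rewrite -EFinM -EFinD /psi; congr (_%:E); ring.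
  - by move=> w _; rewrite lee_fin mulr_ge0 ?norm2_fun_ge0//; case/andP: (psi01 w).
  - by apply/measurable_EFinP; exact: measurable_funM.
  - by move=> w _; rewrite -EFinM lee_fin; apply: mulr_ge0 (ltW t0) (mulr_ge0 _ (norm2_fun_ge0 f w)).
  - by apply: emeasurable_funM => //; apply/measurable_EFinP; exact: measurable_funM.
have Xf : (X < +oo)%E.
  by apply: le_lt_trans ff.2; rewrite -E leeDl// mule_ge0// lee_fin ltW.
have tPf : (t%:E * Phi f <= norm2 f)%E by rewrite -E leeDr.
have := coercive ff; have := Phi_ge0 f; have := norm2_ge0 f; move: X0 Xf tPf E ff.2.
move: (norm2 f) X (Phi f) => [N| |]// [y| |]// [P| |]//; last first.
  by move=> _ _; rewrite gt0_muley ?lte_fin.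
move=> _ _ _ [] E _; rewrite !lee_fin => N0 P0 cP.
have h1 : Num.min c (M / 2) * N <= P.
  by rewrite (le_trans _ cP)// ler_wpM2r// ge_min lexx.
have h2 : t * (Num.min c (M / 2) * N) <= t * P by rewrite ler_pM2l.
rewrite /q mulrBl mul1r -mulrA; move: h2 E.
by move: (t * P) (t * _) => u v; lra.
Qed.

(** The compression of [psi] is [1 - t T], so a fixed point of [u = t g + (1 - t T) u] satisfies
    [T u = g]. *)
Lemma toeplitz_surjective g : in_fock g -> exists2 f, in_fock f & T f = g.
Proof.
move=> fg; have ftg : in_fock (fun z => t%:C * g z) by exact: in_fockZ.
have [u fu uE] := neumann_fixpoint mpsi psi01 q01 A_le ftg.
exists u => //; apply/funext => z.
have := uE z; rewrite AE// => H.
have tC : t%:C != 0 :> C.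
  by apply/eqP => /complexI t00; have := t0; rewrite t00 ltxx.
apply: (mulfI tC); apply/eqP; rewrite -subr_eq0; apply/eqP.
have -> : t%:C * T u z - t%:C * g z = u z - (t%:C * g z + (u z + - t%:C * T u z)) by ring.
by rewrite -H subrr.
Qed.

(** Applied to [f = t T f + (1 - t T) f], [norm2D_le] with this [x] leaves [(1 + q) / 2] in front of
    [norm2 f]; solving for [norm2 f] gives [K]. *)
Let x : R := (1 - q) / (2 * q).
Let K : R := 2 * ((1 + x^-1) * t ^+ 2) / (1 - q).

Let x0 : 0 < x.
Proof. by case/andP: q01 => q0 q1; rewrite divr_gt0 ?subr_gt0// mulr_gt0. Qed.

Let K0 : 0 <= K.
Proof.
case/andP: q01 => q0 q1; rewrite divr_ge0//; last by rewrite subr_ge0 ltW.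
apply: mulr_ge0 => //; apply: mulr_ge0; last exact: sqr_ge0.
by rewrite addr_ge0// invr_ge0 ltW.
Qed.

Lemma toeplitz_lower_bound f : in_fock f -> (norm2 f <= K%:E * norm2 (T f))%E.
Proof.
move=> ff; have fT := fockT ff; have mT := entire_measurable fT.1.
have fA : in_fock (bproj (mulfR psi f)).
  have mf := entire_measurable ff.1.
  by apply: in_fock_bproj; [exact: measurable_mulfR|exact: norm2_mulfR_lty mpsi mf psi01 ff.2].
have tT : in_fock (fun z => t%:C * T f z) by exact: in_fockZ.
have fE : f = fun z => t%:C * T f z + bproj (mulfR psi f) z.
  by apply/funext => z; rewrite AE//; ring.
have := norm2D_le x0 (entire_measurable tT.1) (entire_measurable fA.1).
rewrite -fE norm2Z// normcR real_normK ?num_real//.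
have := A_le ff.
move: (norm2_ge0 f) (norm2_ge0 (T f)) (norm2_fin ff.2) (norm2_fin fT.2) (norm2_fin fA.2).
move: (norm2 (bproj (mulfR psi f))) (norm2 (T f)) (norm2 f) => nQ nP nN N0 P0 fN fP fQ.
move: N0 P0; rewrite fN fP fQ; move: (fine nN) (fine nP) (fine nQ) => N P Q {fN fP fQ}.
rewrite !lee_fin => N0 P0 QN H.
case/andP: q01 => q0 q1.
have xq : (1 + x) * q = (1 + q) / 2 by rewrite /x; field; rewrite gt_eqF.
have h1 : (1 + x) * Q <= (1 + x) * (q * N) by rewrite ler_wpM2l// addr_ge0// ltW.
have q1' : 0 < 1 - q by rewrite subr_gt0.
rewrite mulrA xq in h1.
by rewrite /K mulrAC ler_pdivlMr//; lra.
Qed.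

(** The inverse is a choice of preimages. The lower bound makes [T] injective, which forces this
    choice to be linear and a left inverse, and bounds it by [sqrt K]. *)
Lemma toeplitz_invertible : fock_invertible (toeplitz mu).
Proof.
split; first exact: toeplitz_bounded.
have [S SP] : {S : (C -> C) -> (C -> C) & forall g, in_fock g -> in_fock (S g) /\ T (S g) = g}.
  (* Outside the Fock space the chosen value is immaterial; [g] itself serves as default. *)
  apply: (@choice _ _ (fun g u => in_fock g -> in_fock u /\ T u = g)) => g.
  have [fg|nfg] := pselect (in_fock g); last by exists g.
  by have [u fu uE] := toeplitz_surjective fg; exists u.
have inj u v : in_fock u -> in_fock v -> T u = T v -> u = v.
  move=> fu fv uv; pose d z := 1 * u z + (-1) * v z.
  have fd : in_fock d by apply: in_fockD; exact: in_fockZ.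
  have Td : T d = fun=> 0.
    by rewrite T_lin// uv; apply/funext => z; ring.
  have d0 : (norm2 d <= 0)%E.
    apply: le_trans (toeplitz_lower_bound fd) _; rewrite Td.
    rewrite /norm2 integral0_eq ?mule0// => w _.
    by rewrite normc0 expr0n mul0r.
  apply/funext => z; apply/eqP; rewrite -subr_eq0; apply/eqP/eq0_normc/eqP.
  have := le_trans (in_fock_bound z fd) d0; rewrite lee_fin pmulr_lle0 ?gauss_gt0//.
  rewrite /d mul1r mulN1r => H; rewrite -sqrf_eq0 eq_le H sqr_ge0//.
exists S; split.
  split.
  - by move=> g /fock_in_fock fg; apply/fock_in_fock; exact: (SP g fg).1.
  - move=> a b f g /fock_in_fock ff /fock_in_fock fg.
    have [fSf TSf] := SP f ff; have [fSg TSg] := SP g fg.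
    have fab : in_fock (fun z => a * f z + b * g z) by apply: in_fockD; exact: in_fockZ.
    have [fS TS] := SP _ fab; apply: inj => //.
      by apply: in_fockD; exact: in_fockZ.
    by rewrite TS T_lin// TSf TSg.
  - exists (Num.sqrt K) => g /fock_in_fock fg; have [fSg TSg] := SP g fg.
    apply: fock_norm_le => //.
    by rewrite sqr_sqrtr// -{2}TSg; exact: toeplitz_lower_bound.
move=> f /fock_in_fock ff; have fT := fockT ff.
have [fSf TSf] := SP f ff; have [fSTf TSTf] := SP _ fT.
by split; rewrite toeplitz_bproj//; exact: inj.
Qed.

End coercive.

End fock_toeplitz.

(** * Normalized reproducing kernels and Gaussian averages over discs *)

Section normalized_kernels.
Variable R : realType.
Local Notation C := (Cplx R).
Implicit Types (h : C -> R) (z w : C).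

(** This is [e^{w conj(z) / 2 - |z|^2 / 4}], the normalized reproducing kernel at [z], as a weighted
    translate of the constant 1. *)
Definition fock_kernel z : C -> C := wtrans (- z) (fun=> 1).

Lemma normc_kernel z w : normc (fock_kernel z w) ^+ 2 * gauss w = gauss (z - w).
Proof. by rewrite normc_wtrans normc1 expr1n mul1r [- z + w]addrC /gauss normcB. Qed.

Lemma norm2_kernel z : norm2 (fock_kernel z) = 2%:E.
Proof.
rewrite norm2_wtrans; last exact: entire_cst.
rewrite /norm2 -integral_gauss; apply: eq_integral => w _.
by rewrite normc1 expr1n mul1r.
Qed.

Lemma kernel_in_fock z : in_fock (fock_kernel z).
Proof.
split; first by apply: entire_wtrans; exact: entire_cst.
by rewrite norm2_kernel ltry.
Qed.

Lemma measurable_gaussB z : measurable_fun setT (fun w : CplxB R => gauss (z - w)).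
Proof.
rewrite (_ : (fun _ => _) = fun w : CplxB R => expR (- (2^-1 * normc (z - (w : C)) ^+ 2))).
  exact: measurable_gaussian.
by apply/funext => w; rewrite gaussE.
Qed.

Lemma integral_gaussB z : (\int[dA]_w (gauss (z - (w : C)))%:E = 2%:E)%E.
Proof.
rewrite -(norm2_kernel z); apply: eq_integral => w _.
by rewrite normc_kernel.
Qed.

(** Off the disc [gauss] is the product of two copies of [egauss z w]: one is at most [e^{-r^2/4}],
    the other remains integrable. *)
Lemma gauss_le_disc z w (r : R) : 0 <= r ->
  gauss (z - w) <= \1_(discC z r) w + expR (- (r ^+ 2 / 4)) * egauss z w.
Proof.
move=> r0; rewrite indicE; have [|] := boolP (w \in discC z r) => /=.
  move=> _; apply: (le_trans (gauss_le1 _)).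
  by rewrite lerDl mulr_ge0// expR_ge0.
rewrite notin_setE /discC/= => /negP; rewrite -leNgt -normcB => rw.
rewrite add0r gaussE /egauss -expRD ler_expR.
have : r ^+ 2 <= normc (z - w) ^+ 2 by rewrite ler_sqr ?nnegrE// normc_ge0.
by move: (normc _ ^+ 2) (r ^+ 2) => x y; lra.
Qed.

Lemma gauss_ge_disc z w (r : R) :
  \1_(discC z r) w <= expR (r ^+ 2 / 2) * gauss (z - w).
Proof.
rewrite indicE; have [|_] := boolP (w \in discC z r) => /=; last first.
  by rewrite mulr_ge0 ?expR_ge0.
rewrite inE /discC/= -normcB => rw.
rewrite gaussE -expRD -[leLHS]expR0 ler_expR.
have : normc (z - w) ^+ 2 <= r ^+ 2.
  by rewrite ler_sqr ?nnegrE ?normc_ge0//; apply: ltW => //; exact: le_lt_trans (normc_ge0 _) rw.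
by move: (normc _ ^+ 2) (r ^+ 2) => x y; lra.
Qed.

Section disc_estimates.
Variables (h : CplxB R -> R) (M : R).
Hypothesis mh : measurable_fun setT h.
Hypothesis h0 : forall w, 0 <= h w.
Hypothesis hM : forall w, h w <= M.
Hypothesis M0 : 0 < M.

Lemma measurable_disc_mul z (r : R) :
  measurable_fun setT (fun w : CplxB R => \1_(discC z r : set (CplxB R)) w * h w).
Proof. by apply: measurable_funM => //; apply: measurable_indic; exact: measurable_disc. Qed.

(** The Gaussian tail is controlled by [r] and [M] alone, hence uniformly in [z]. *)
Lemma integral_gauss_le_disc (e : R) : 0 < e -> exists2 r : R, 0 < r &
  forall z, (\int[dA]_w (h w * gauss (z - (w : C)))%:E <=
    \int[dA]_w (\1_(discC z r : set (CplxB R)) w * h w)%:E + e%:E)%E.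
Proof.
(* As [r >= 1], [e^{r^2/4} >= r / 4 >= 4 M / e]; the tail is at most [4 M e^{-r^2/4}], 4 being the
   mass of [egauss]. *)
move=> e0; pose r : R := 1 + 16 * M / e.
have Me : 0 < 16 * M / e by rewrite divr_gt0// mulr_gt0.
have r0 : 0 < r by rewrite addr_gt0.
exists r => // z; set k := expR (- (r ^+ 2 / 4)).
have ke : M * k * 4 <= e.
  have h1 : 1 + r ^+ 2 / 4 <= expR (r ^+ 2 / 4) by exact: expR_ge1Dx.
  have h2 : r <= r ^+ 2 by rewrite expr2 ler_peMr ?(ltW r0)// lerDl ltW.
  have h3 : 4 * M / e <= expR (r ^+ 2 / 4).
    have E : 16 * M / e = 4 * (4 * M / e) by rewrite !mulrA; congr (_ * _ / _); ring.
    by move: h2 h1; rewrite {1}/r E; move: (r ^+ 2) (expR _) (_ / e) => a b y; lra.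
  rewrite /k expRN mulrAC ler_pdivrMr ?expR_gt0//.
  by rewrite mulrC; move: h3; rewrite ler_pdivrMr// mulrC [e * _]mulrC.
have meg : measurable_fun setT (fun w : CplxB R => egauss z w) by exact: measurable_gaussian.
have mg := measurable_gaussB z; have md := measurable_disc_mul z r.
have k0 : 0 <= M * k by rewrite mulr_ge0 ?expR_ge0// ltW.
apply: (@le_trans _ _ (\int[dA]_w (\1_(discC z r : set (CplxB R)) w * h w + M * k * egauss z w)%:E)%E).
  apply: ge0_le_integral => //.
  - by move=> w _; rewrite lee_fin mulr_ge0// expR_ge0.
  - by apply/measurable_EFinP; exact: measurable_funM.
  - by apply/measurable_EFinP; apply: measurable_funD => //; exact: measurable_funM.
  - move=> w _; rewrite lee_fin.
    apply: le_trans (ler_wpM2l (h0 w) (gauss_le_disc z w (ltW r0))) _.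
    rewrite mulrDr mulrC lerD2l -mulrA -/k ler_wpM2r//.
    by rewrite mulr_ge0// expR_ge0.
under eq_integral do rewrite EFinD.
rewrite ge0_integralD//; last 4 first.
- by move=> w _; rewrite lee_fin mulr_ge0.
- exact/measurable_EFinP.
- by move=> w _; rewrite lee_fin; apply: mulr_ge0 => //; exact: expR_ge0.
- by apply/measurable_EFinP; exact: measurable_funM.
rewrite leeD2l//; under eq_integral do rewrite EFinM.
rewrite ge0_integralZl//; last 2 first.
- exact/measurable_EFinP.
- by move=> w _; rewrite lee_fin expR_ge0.
by rewrite /egauss integral_gaussian// invrK -EFinM lee_fin.
Qed.

Lemma integral_disc_le_gauss z (r : R) :
  (\int[dA]_w (\1_(discC z r : set (CplxB R)) w * h w)%:E <=
   (expR (r ^+ 2 / 2))%:E * \int[dA]_w (h w * gauss (z - (w : C)))%:E)%E.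
Proof.
have mg := measurable_gaussB z; have md := measurable_disc_mul z r.
rewrite -ge0_integralZl//; last 2 first.
- by apply/measurable_EFinP; exact: measurable_funM.
- by move=> w _; rewrite lee_fin mulr_ge0// expR_ge0.
apply: ge0_le_integral => //.
- by move=> w _; rewrite lee_fin mulr_ge0.
- exact/measurable_EFinP.
- by apply: emeasurable_funM => //; apply/measurable_EFinP; exact: measurable_funM.
- move=> w _; rewrite -EFinM lee_fin mulrCA mulrC ler_wpM2l//; exact: gauss_ge_disc.
Qed.

Lemma integral_mul_gauss_le z :
  (\int[dA]_w (h w * gauss (z - (w : C)))%:E <= (M * 2)%:E)%E.
Proof.
have mg := measurable_gaussB z.
rewrite EFinM -(integral_gaussB z) -ge0_integralZl//; last 3 first.
- exact/measurable_EFinP.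
- by move=> w _; rewrite lee_fin expR_ge0.
- by rewrite lee_fin ltW.
apply: ge0_le_integral => //.
- by move=> w _; rewrite lee_fin mulr_ge0// expR_ge0.
- by apply/measurable_EFinP; exact: measurable_funM.
- by apply: emeasurable_funM => //; exact/measurable_EFinP.
- by move=> w _; rewrite -EFinM lee_fin ler_wpM2r// expR_ge0.
Qed.

End disc_estimates.
End normalized_kernels.

(** * The implications between the five conditions *)

Section equivalences.
Variable R : realType.
Local Notation C := (Cplx R).
Variables (phi : CplxB R -> R) (M : R).
Hypothesis mphi : measurable_fun setT phi.
Hypothesis phi_ge0 : forall z, 0 <= phi z.
Hypothesis M0 : 0 < M.
Hypothesis phiM : forall z, phi z <= M.

Let mu : {measure set (CplxB R) -> \bar R} := density dA mphi phi_ge0.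

Lemma berezinE z :
  (berezin mu z = 2^-1%:E * \int[dA]_w (phi w * gauss (z - (w : C)))%:E)%E.
Proof.
have mg := measurable_gaussB z.
rewrite /berezin ge0_integral_density; last 2 first.
- exact/measurable_EFinP.
- by move=> w; rewrite lee_fin expR_ge0.
by congr (_ * _)%E; apply: eq_integral => w _; rewrite -EFinM mulrC.
Qed.

Lemma mu_disc z (r : R) :
  (mu (discC z r) = \int[dA]_w (\1_(discC z r : set (CplxB R)) w * phi w)%:E)%E.
Proof.
rewrite -[LHS]/(\int[dA]_(x in (discC z r : set (CplxB R))) (phi x)%:E)%E.
rewrite integral_mkcond; apply: eq_integral => w _.
by rewrite /patch indicE; case: ifP => _; rewrite ?mul1r ?mul0r.
Qed.

(** With [k] the unit kernel at [z] and [S] the inverse, [1 = |k| <= |S| |T k|], while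
    [|T k|^2 <= M <T k, k>] and [<T k, k>] is the Berezin transform at [z]. *)
Lemma invertible_berezin_ge : fock_invertible (toeplitz mu) ->
  exists2 d : R, 0 < d & forall z, (d%:E <= berezin mu z)%E.
Proof.
(* The given bound [K] carries no sign; its maximum with 1 is positive. *)
move=> [_ [S [[_ _ [K SK]] ST]]]; pose N := Num.max K 1.
have N1 : 0 < N by rewrite lt_max ltr01 orbT.
exists ((N ^+ 2 * M)^-1) => [|z]; first by rewrite invr_gt0 mulr_gt0 ?exprn_gt0.
have fk := kernel_in_fock z; have [SE _] := ST _ ((fock_in_fock _).2 fk).
set g := toeplitz mu (fock_kernel z) in SE.
have gE : g = bproj (mulfR phi (fock_kernel z)) by exact: toeplitz_bproj.
have fg : in_fock g.
  rewrite gE; have phi0M w : 0 <= phi w <= M by rewrite phi_ge0 phiM.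
  have mk := entire_measurable fk.1.
  by apply: in_fock_bproj; [exact: measurable_mulfR|exact: norm2_mulfR_lty mphi mk phi0M fk.2].
have := SK _ ((fock_in_fock _).2 fg); rewrite SE !fock_normE// norm2_kernel /= => H.
have g0 : 0 <= fine (norm2 g) by rewrite fine_ge0// norm2_ge0.
have {}H : Num.sqrt (2^-1 * 2) <= N * Num.sqrt (2^-1 * fine (norm2 g)).
  by apply: (le_trans H); rewrite ler_wpM2r ?sqrtr_ge0// le_max lexx.
rewrite mulVf ?pnatr_eq0// sqrtr1 in H.
have {}H : 1 <= N ^+ 2 * (2^-1 * fine (norm2 g)).
  have s0 := sqrtr_ge0 (2^-1 * fine (norm2 g)).
  have -> : 2^-1 * fine (norm2 g) = Num.sqrt (2^-1 * fine (norm2 g)) ^+ 2.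
    by rewrite sqr_sqrtr// mulr_ge0.
  by rewrite -exprMn exprn_ege1.
have : (norm2 g <= M%:E * \int[dA]_w (phi w * gauss (z - (w : C)))%:E)%E.
  rewrite gE; apply: (le_trans (norm2_bproj_density_le mphi phi_ge0 phiM fk)).
  by rewrite (eq_integral (fun w => (phi w * gauss (z - (w : C)))%:E))// => w _; rewrite normc_kernel.
rewrite (norm2_fin fg.2) berezinE.
have : (0 <= \int[dA]_w (phi w * gauss (z - (w : C)))%:E)%E.
  by apply: integral_ge0 => w _; rewrite lee_fin mulr_ge0// expR_ge0.
move: (\int[dA]_w _)%E => [I| |]//; last by move=> _ _; rewrite gt0_muley ?lte_fin ?invr_gt0// leey.
rewrite -!EFinM !lee_fin => I0 gI.
rewrite -[leLHS]mul1r ler_pdivrMr ?mulr_gt0 ?exprn_gt0//.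
apply: (le_trans H); rewrite mulrCA [leRHS]mulrC -!mulrA; nra.
Qed.

Lemma berezin_ge_superlevel :
  (exists2 d : R, 0 < d & forall z, (d%:E <= berezin mu z)%E) ->
  exists2 r : R, 0 < r & reverse_carleson (chi_dA (measurable_superlevel r mphi)).
Proof.
(* As [phi <= r + M 1_G] and the Gaussian has mass 2, the hypothesis reads [2 d <= 2 r + M I], with
   [I] the Gaussian integral of [1_G] around [z]. The level [r = d / 2] leaves [I >= d / M]. *)
move=> [d d0 dB]; pose r := d / 2; have r0 : 0 < r by rewrite divr_gt0.
exists r => //; set mG := measurable_superlevel r mphi.
set G : set (CplxB R) := [set z | phi z > r].
have mh : measurable_fun setT (\1_G : CplxB R -> R) by exact: measurable_indic.
have h0 (w : CplxB R) : 0 <= \1_G w :> R by rewrite indicE.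
have h1 (w : CplxB R) : \1_G w <= 1 :> R by rewrite indicE lern1 leq_b1.
(* Half of the lower bound [d / M]: so much may be lost in the tail, and as much remains as the area
   of [G] in a disc. *)
have e0 : 0 < d / (2 * M) by rewrite divr_gt0// mulr_gt0.
have [p p0 pP] := integral_gauss_le_disc mh h0 h1 ltr01 e0.
have [|k k0 kP] := luecking mG (ltW p0) e0.
  move=> z; have mg := measurable_gaussB z.
  have trans : (\int[dA]_w (\1_(discC (0 : C) p : set (CplxB R)) w * \1_G (z + w))%:E =
      \int[dA]_w (\1_(discC z p : set (CplxB R)) w * \1_G w)%:E)%E.
    rewrite -[RHS](ge0_integral_dA_translation z); last 2 first.
    - by apply/measurable_EFinP; exact: measurable_disc_mul.
    - by move=> w; rewrite lee_fin mulr_ge0// indicE.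
    apply: eq_integral => w _; congr ((_ * _)%:E); rewrite !indicE; congr (nat_of_bool _)%:R.
    apply/idP/idP; rewrite !inE /discC/= subr0; by rewrite addrAC subrr add0r.
  rewrite trans.
  have split : (\int[dA]_w (phi w * gauss (z - (w : C)))%:E <=
      d%:E + M%:E * \int[dA]_w (\1_G w * gauss (z - (w : C)))%:E)%E.
    have -> : (d%:E = r%:E * \int[dA]_w (gauss (z - (w : C)))%:E)%E.
      by rewrite integral_gaussB -EFinM /r divfK// pnatr_eq0.
    have m1 : measurable_fun setT (fun w : CplxB R => (gauss (z - (w : C)))%:E) by exact/measurable_EFinP.
    have m2 : measurable_fun setT (fun w : CplxB R => (\1_G w * gauss (z - (w : C)))%:E).
      by apply/measurable_EFinP; exact: measurable_funM.
    rewrite -!ge0_integralZl//; last 4 first.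
    - by move=> w _; rewrite lee_fin mulr_ge0// expR_ge0.
    - by rewrite lee_fin ltW.
    - by move=> w _; rewrite lee_fin expR_ge0.
    - by rewrite lee_fin ltW.
    rewrite -ge0_integralD//; last 4 first.
    - by move=> w _; rewrite -EFinM lee_fin mulr_ge0 ?expR_ge0// ltW.
    - exact: emeasurable_funM.
    - by move=> w _; rewrite -EFinM lee_fin mulr_ge0 ?mulr_ge0 ?expR_ge0// ltW.
    - exact: emeasurable_funM.
    apply: ge0_le_integral => //.
    - by move=> w _; rewrite lee_fin mulr_ge0// expR_ge0.
    - by apply/measurable_EFinP; exact: measurable_funM.
    - by apply: emeasurable_funD; exact: emeasurable_funM.
    - move=> w _; rewrite -!EFinM -EFinD lee_fin mulrA -mulrDl ler_wpM2r ?expR_ge0//.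
      rewrite indicE; have [|] := boolP (w \in G).
        by move=> _; rewrite mulr1 (le_trans (phiM w))// lerDr ltW.
      by rewrite notin_setE /G/= mulr0 addr0 => /negP; rewrite -leNgt.
  have := pP z; have := dB z; move: split; rewrite berezinE.
  move: (\int[dA]_w (\1_(discC z p : set (CplxB R)) w * _)%:E)%E => X.
  have Y0 : (0 <= \int[dA]_w (\1_G w * gauss (z - (w : C)))%:E)%E.
    by apply: integral_ge0 => w _; rewrite lee_fin mulr_ge0// expR_ge0.
  have := integral_mul_gauss_le mphi phi_ge0 phiM M0 z.
  have := integral_mul_gauss_le mh h0 h1 ltr01 z; move: Y0.
  have P0 : (0 <= \int[dA]_w (phi w * gauss (z - (w : C)))%:E)%E.
    by apply: integral_ge0 => w _; rewrite lee_fin mulr_ge0// expR_ge0.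
  move: P0.
  move: (\int[dA]_w (phi w * _)%:E)%E (\int[dA]_w (\1_G w * _)%:E)%E => [P| |]// [Y| |]//.
  move=> P0 Y0 _ _; rewrite -!EFinM -EFinD !lee_fin => PY dP.
  case: X => [X| |]//; last by move=> _; rewrite leey.
  rewrite -EFinD !lee_fin => YX.
  rewrite ler_pdivrMr ?mulr_gt0//.
  have YM : Y * M <= (X + d / (2 * M)) * M by rewrite ler_pM2r.
  have E : (X + d / (2 * M)) * M = X * M + d / 2 by field; rewrite gt_eqF.
  by rewrite E in YM; nra.
exists k => // f ff; have fi := (fock_in_fock f).1 ff.
have mf := entire_measurable fi.1.
rewrite [leRHS](integral_mu_norm2 (measurable_indic mG) (@indic_ge0 R G) mf).
exact: kP f fi.1 fi.2.
Qed.

Lemma superlevel_reverse_carleson :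
  (exists2 r : R, 0 < r & reverse_carleson (chi_dA (measurable_superlevel r mphi))) ->
  reverse_carleson mu.
Proof.
move=> [r r0 [c c0 cP]]; exists (r * c) => [|f ff]; first exact: mulr_gt0.
have mf := entire_measurable ((fock_in_fock f).1 ff).1; have mn := measurable_norm2_fun mf.
have mG := measurable_superlevel r mphi; have mi := measurable_indic mG : measurable_fun setT (_ : CplxB R -> R).
have rE0 : (0 <= r%:E)%E by rewrite lee_fin ltW.
have := cP f ff.
rewrite [leRHS](integral_mu_norm2 (measurable_indic _) (@indic_ge0 R _) mf).
rewrite (integral_mu_norm2 mphi phi_ge0 mf).
move=> /(lee_wpmul2l rE0); rewrite muleA -EFinM => /le_trans; apply.
rewrite -ge0_integralZl//; last 2 first.
- by apply/measurable_EFinP; exact: measurable_funM.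
- by move=> w _; rewrite lee_fin mulr_ge0 ?norm2_fun_ge0.
apply: ge0_le_integral => //.
- by move=> w _; rewrite -EFinM lee_fin; apply: mulr_ge0 (ltW r0) (mulr_ge0 _ (norm2_fun_ge0 f w)).
- by apply: emeasurable_funM => //; apply/measurable_EFinP; exact: measurable_funM.
- by apply/measurable_EFinP; exact: measurable_funM.
- move=> w _; rewrite -EFinM lee_fin mulrA ler_wpM2r ?norm2_fun_ge0//.
  rewrite indicE; have [|] := boolP (_ \in _) => /=; last by rewrite mulr0.
  by rewrite inE/= mulr1 => /ltW.
Qed.

Lemma reverse_carleson_disc : reverse_carleson mu -> reverse_carleson_condition mu.
Proof.
move=> [c c0 cP].
(* Testing on the kernel, of [norm2] equal to 2, gives [2 c]; a tail of at most [c] leaves [c] for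
   the disc. *)
have [r r0 rP] := integral_gauss_le_disc mphi phi_ge0 phiM M0 c0.
(* A single constant for both bounds: [b^-1 <= c], and [b] exceeds the upper bound
   [2 M e^{r^2/2}]. *)
pose b := c^-1 + expR (r ^+ 2 / 2) * (M * 2).
have e0 : 0 < expR (r ^+ 2 / 2) * (M * 2) by rewrite !mulr_gt0// expR_gt0.
exists r, b; split => // [|z]; first by rewrite addr_gt0// invr_gt0.
rewrite mu_disc; apply/andP; split; last first.
  apply: le_trans (integral_disc_le_gauss mphi phi_ge0 z r) _.
  apply: (@le_trans _ _ (expR (r ^+ 2 / 2) * (M * 2))%:E).
    by rewrite EFinM lee_wpmul2l ?lee_fin ?expR_ge0//; exact: integral_mul_gauss_le.
  by rewrite lee_fin lerDr invr_ge0 ltW.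
have fk := kernel_in_fock z; have mk := entire_measurable fk.1.
have := cP _ ((fock_in_fock _).2 fk).
rewrite (integral_mu_norm2 mphi phi_ge0 mk) -/(norm2 _) norm2_kernel.
rewrite (eq_integral (fun w => (phi w * gauss (z - (w : C)))%:E)); last first.
  by move=> w _; rewrite normc_kernel.
move=> /le_trans/(_ (rP z)).
have bc : b^-1 <= c by rewrite invf_ple ?posrE// ?addr_gt0 ?invr_gt0// lerDl ltW.
case: (\int[dA]_w _)%E => [X| |]//; last by move=> _; rewrite leey.
by rewrite -EFinM -EFinD !lee_fin; lra.
Qed.

Lemma disc_berezin_ge : reverse_carleson_condition mu ->
  exists2 d : R, 0 < d & forall z, (d%:E <= berezin mu z)%E.
Proof.
move=> [r [c [r0 c0 cP]]]; set k := expR (r ^+ 2 / 2).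
have k0 : 0 < k by exact: expR_gt0.
exists (2 * (k * c))^-1 => [|z]; first by rewrite invr_gt0 !mulr_gt0.
have /andP[cz _] := cP z; rewrite mu_disc in cz; rewrite berezinE.
have := le_trans cz (integral_disc_le_gauss mphi phi_ge0 z r).
rewrite invfM EFinM => H; rewrite lee_wpmul2l ?lee_fin ?invr_ge0//.
rewrite invfM EFinM -(@lee_pmul2l _ k%:E)// ?lte_fin//.
by rewrite -!EFinM mulrA mulfV ?gt_eqF// mul1r.
Qed.

Lemma reverse_carleson_invertible : reverse_carleson mu -> fock_invertible (toeplitz mu).
Proof.
move=> [c c0 cP]; apply: (toeplitz_invertible mphi phi_ge0 M0 phiM c0) => f ff /=.
rewrite -(integral_mu_norm2 mphi phi_ge0); last exact: entire_measurable ff.1.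
exact: cP ((fock_in_fock f).2 ff).
Qed.

End equivalences.

Theorem theorem4p7 (R : realType) (phi : CplxB R -> R)
    (mphi : measurable_fun setT phi)
    (phi_ge0 : forall z, 0 <= phi z)
    (phi_bounded : exists M : R, forall z, phi z <= M) :
  let mu : {measure set (CplxB R) -> \bar R} := density dA mphi phi_ge0 in
  [<-> fock_invertible (toeplitz mu);
       exists2 delta : R, 0 < delta & forall z, (delta%:E <= berezin mu z)%E;
       exists2 r : R, 0 < r &
         reverse_carleson (chi_dA (measurable_superlevel r mphi));
       reverse_carleson mu;
       reverse_carleson_condition mu].
Proof.
move=> mu; have [M' phiM'] := phi_bounded; pose M := Num.max M' 1.
(* The bound is raised to at least 1 so that it can be divided by, even when [phi] vanishes. *)
have M0 : 0 < M by rewrite lt_max ltr01 orbT.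
have phiM z : phi z <= M by rewrite (le_trans (phiM' z))// le_max lexx.
tfae.
- exact: invertible_berezin_ge M0 phiM.
- exact: berezin_ge_superlevel M0 phiM.
- exact: superlevel_reverse_carleson.
- exact: reverse_carleson_disc M0 phiM.
(* The cycle closes from (e) to (a) through (b), (c) and (d). *)
- move=> /disc_berezin_ge/(berezin_ge_superlevel M0 phiM) h.
  exact: reverse_carleson_invertible M0 phiM (superlevel_reverse_carleson phi_ge0 h).
Qed.
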